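(* Let $k\ge 2$ be an integer, let $\mathbf f\in[L^2(\Omega)]^d$ and $\mathbf g\in[L^2(\partial\Omega)]^d$. Then there is one and only one pair $(\mathbf u_h,p_h)\in\mathcal W_h\times\mathcal V_h$, $\mathbf u_h=\{\mathbf u_0,\mathbf u_b,\mathbf u_g\}$, $p_h=\{p_0,p_b\}$, such that $\mathbf u_b=Q_b^k\mathbf g$ on $\partial\Omega$ and $$a((\mathbf u_h,p_h),(\mathbf v,q))+s_1(\mathbf u_h,\mathbf v)+s_2(p_h,q)=\sum_{T\in\mathcal T_h}(\mathbf f,-\Delta_w\mathbf v+\nabla_w q)_T$$ for all $\mathbf v\in\mathcal W_h^0$ and all $q\in\mathcal V_h$.
   Context: Domain and mesh. $\Omega\subset\mathbb R^d$ ($d\in\{2,3\}$) is a bounded polygonal or polyhedral domain with Lipschitz boundary. $\mathcal T_h$ is a partition of $\Omega$ into shape regular polygons ($d=2$) or polyhedra ($d=3$). $h_T$ is the diameter of $T$ and $h=\max_T h_T$. $\mathcal E_h$ is the set of all edges ($d=2$) or flat faces ($d=3$) of $\mathcal T_h$; each $e\in\mathcal E_h$ is either shared by exactly two elements or lies on $\partial\Omega$. $\mathbf n$ is the outward unit normal on $\partial T$. $(\cdot,\cdot)_T$ and $\langle\cdot,\cdot\rangle_{\partial T}$ are the $L^2$ inner products on $T$ and $\partial T$ (for scalar, vector or matrix functions). For a vector field $\mathbf v$, $(\nabla\mathbf v)_{ij}=\partial_j v_i$, so $\nabla\mathbf v\cdot\mathbf n$ is the normal derivative. $P_r$ denotes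 polynomials of degree at most $r$. $L_0^2(\Omega)$ is the space of $L^2(\Omega)$ functions with zero mean over $\Omega$. Finite element spaces. $\mathcal W_h$ is the set of triplets $\mathbf v=\{\mathbf v_0,\mathbf v_b,\mathbf v_g\}$ with $\mathbf v_0|_T\in[P_k(T)]^d$ for each $T\in\mathcal T_h$, and $\mathbf v_b|_e\in[P_k(e)]^d$, $\mathbf v_g|_e\in[P_{k-1}(e)]^{d\times d}$ for each $e\in\mathcal E_h$. $\mathcal V_h$ is the set of pairs $q=\{q_0,q_b\}$ with $q_0|_T\in P_{k-1}(T)$ for each $T$, $q_0\in L^2_0(\Omega)$, and $q_b|_e\in P_{k-1}(e)$ for each $e\in\mathcal E_h$. The components $\mathbf v_b,\mathbf v_g,q_b$ are single valued on each $e$ and independent of the traces of $\mathbf v_0,\nabla\mathbf v_0,q_0$. $\mathcal W_h^0=\{\mathbf v\in\mathcal W_h:\mathbf v_b=\mathbf 0\text{ on }\partial\Omega\}$. Discrete weak operators, defined on each $T$: $\Delta_w\mathbf v\in[P_{k-2}(T)]^d$, $\nabla_w\cdot\mathbf v\in P_{k-1}(T)$, $\nabla_w q\in[P_{k-2}(T)]^d$ are the unique polynomials with $(\Delta_w\mathbf v,\mathbf w)_T=(\mathbf v_0,\Delta\mathbf w)_T-\langle\mathbf v_b,\nabla\mathbf w\cdot\mathbf n\rangle_{\partial T}+\langle\mathbf v_g\cdot\mathbf n,\mathbf w\rangle_{\partial T}$ for all $\mathbf w\in[P_{k-2}(T)]^d$; $(\nabla_w\cdot\mathbf v,\varphi)_T=-(\mathbf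 v_0,\nabla\varphi)_T+\langle\mathbf v_b\cdot\mathbf n,\varphi\rangle_{\partial T}$ for all $\varphi\in P_{k-1}(T)$; $(\nabla_w q,\mathbf w)_T=-(q_0,\nabla\cdot\mathbf w)_T+\langle q_b,\mathbf w\cdot\mathbf n\rangle_{\partial T}$ for all $\mathbf w\in[P_{k-2}(T)]^d$. Projection. $Q_b^k$ is the $L^2(e)$-orthogonal projection onto $P_k(e)$ on each $e$, applied componentwise. Bilinear forms. $s_1(\mathbf v,\mathbf w)=\sum_{T}\big(h_T^{-1}\langle\mathbf v_0-\mathbf v_b,\mathbf w_0-\mathbf w_b\rangle_{\partial T}+h_T\langle\nabla\mathbf v_0-\mathbf v_g,\nabla\mathbf w_0-\mathbf w_g\rangle_{\partial T}\big)$, $s_2(p,q)=\sum_T h_T\langle p_0-p_b,q_0-q_b\rangle_{\partial T}$, $a((\mathbf u,p),(\mathbf v,q))=\sum_T\big((-\Delta_w\mathbf u+\nabla_w p,-\Delta_w\mathbf v+\nabla_w q)_T+(\nabla_w\cdot\mathbf u,\nabla_w\cdot\mathbf v)_T\big)$. *)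

(* Defs.v *)
From HB Require Import structures.
From mathcomp Require Import all_boot all_order all_algebra.
From mathcomp Require Import all_classical all_reals all_analysis.
(* The notations of mpoly clash with those of analysis. *)
From mathcomp Require mpoly.
Import (canonicals, coercions) mpoly.

Set Implicit Arguments.
Unset Strict Implicit.
Unset Printing Implicit Defensive.

Import Order.TTheory GRing.Theory Num.Theory.
Import numFieldNormedType.Exports.

Local Open Scope classical_set_scope.
Local Open Scope ring_scope.

Section MeasureCons.
Context {R : realType} dX (X : measurableType dX) (n : nat).
Variable mu : {sigma_finite_measure set X -> \bar R}.
Variable m : {sigma_finite_measure set (n.-tuple X) -> \bar R}.

Definition cons_pair (x : X * n.-tuple X) : n.+1.-tuple X :=
  [the n.+1.-tuple X of x.1 :: x.2].

Definition uncons_pair (t : n.+1.-tuple X) : X * n.-tuple X :=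
  (thead t, [tuple of behead t]).

Lemma measurable_cons_pair : measurable_fun setT cons_pair.
Proof. exact: measurable_cons. Qed.

Lemma measurable_uncons_pair : measurable_fun setT uncons_pair.
Proof.
apply/measurable_fun_pairP; split; last exact: measurable_behead.
exact: measurable_tnth.
Qed.

Lemma cons_pairK : cancel cons_pair uncons_pair.
Proof.
case=> x t; rewrite /uncons_pair /cons_pair /= theadE; congr pair.
exact/val_inj.
Qed.

Definition measure_cons : set (n.+1.-tuple X) -> \bar R :=
  pushforward (mu \x m)%E cons_pair.

Let measure_cons0 : measure_cons set0 = 0%E.
Proof. by rewrite /measure_cons /pushforward preimage_set0 measure0. Qed.

Let measure_cons_ge0 A : (0 <= measure_cons A)%E.
Proof. by rewrite /measure_cons /pushforward measure_ge0. Qed.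

Let measure_cons_sigma_additive : semi_sigma_additive measure_cons.
Proof.
have mc A : measurable A -> measurable (cons_pair @^-1` A).
  by move=> mA; rewrite -[X in measurable X]setTI; exact: measurable_cons_pair.
move=> A mA tA mUA; rewrite /measure_cons /pushforward preimage_bigcup.
apply: measure_semi_sigma_additive.
- by move=> i; exact: mc.
- apply/trivIsetP => /= i j _ _ ij; rewrite -preimage_setI.
  by move/trivIsetP : tA => /(_ _ _ _ _ ij) ->//; rewrite preimage_set0.
- by rewrite -preimage_bigcup; exact: mc.
Qed.

HB.instance Definition _ := isMeasure.Build _ _ _ measure_cons
  measure_cons0 measure_cons_ge0 measure_cons_sigma_additive.

Lemma measure_cons_sigma_finite : sigma_finite setT measure_cons.
Proof.
have /sigma_finiteP[F [TF ndF Foo]] := sigma_finiteT mu.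
have /sigma_finiteP[G [TG ndG Goo]] := sigma_finiteT m.
exists (fun k => uncons_pair @^-1` (F k `*` G k)).
  rewrite -preimage_bigcup -[LHS](preimage_setT uncons_pair); congr preimage.
  rewrite -setXTT TF TG predeqE => -[x y]; split.
    move=> [/= [k _ Fkx] [l _ Gly]]; exists (maxn k l) => //; split.
    - by move: x Fkx; exact/subsetPset/ndF/leq_maxl.
    - by move: y Gly; exact/subsetPset/ndG/leq_maxr.
  by move=> [k _ []/= ? ?]; split; exists k.
move=> k; have [mF Fk] := Foo k; have [mG Gk] := Goo k; split.
  rewrite -[X in measurable X]setTI; apply: measurable_uncons_pair => //.
  exact: measurableX.
rewrite /measure_cons /pushforward -comp_preimage.
rewrite (_ : uncons_pair \o cons_pair = id); last exact/funext/cons_pairK.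
by rewrite preimage_id product_measure1E// lte_mul_pinfty// ge0_fin_numE.
Qed.

HB.instance Definition _ := @Measure_isSigmaFinite.Build _ _ _
  measure_cons measure_cons_sigma_finite.

End MeasureCons.

(* n-fold product of the Lebesgue measure of the real line. *)
Fixpoint lebesgue {R : realType} (n : nat) :
    {sigma_finite_measure set (n.-tuple (measurableTypeR R)) -> \bar R} :=
  match n with
  | 0 => \d_ [tuple]
  | n'.+1 => measure_cons lebesgue_measure (lebesgue n')
  end.

Definition vec {R : realType} {n} (t : n.-tuple (measurableTypeR R)) :
  'rV[R]_n := \row_i tnth t i.

Definition integral_on {R : realType} {n} (A : set 'rV[R]_n)
    (phi : 'rV[R]_n -> R) : R :=
  \int[lebesgue n]_(t in vec @^-1` A) phi (vec t).

Definition L2_on {R : realType} {n} (A : set 'rV[R]_n)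
    (phi : 'rV[R]_n -> R) : Prop :=
  measurable_fun (vec @^-1` A) (phi \o vec) /\
  (lebesgue n).-integrable (vec @^-1` A) (fun t => (phi (vec t) ^+ 2)%:E).

Section Geometry.
Context {R : realType} {d : nat}.
Implicit Types (x y n : 'rV[R]_d) (A T e Omega : set 'rV[R]_d).

Definition dotp {m p : nat} (A B : 'M[R]_(m, p)) : R :=
  \sum_i \sum_j A i j * B i j.

(* The norm that analysis puts on 'rV_d is the sup norm. *)
Definition enorm x : R := Num.sqrt (dotp x x).

Definition diam A : R := sup [set enorm (x - y) | x in A & y in A].

Definition frontier A : set 'rV[R]_d := closure A `\` interior A.

Definition convex_polytope A : Prop :=
  (exists M : R, forall x, A x -> enorm x <= M) /\
  exists hs : seq ('rV[R]_d * R),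
    A = [set x | forall h, h \in hs -> dotp h.1 x <= h.2].

Definition polytopal A : Prop :=
  exists (N : nat) (P : 'I_N -> set 'rV[R]_d),
    (forall i, convex_polytope (P i)) /\ A = \bigcup_i P i.

(* Polygon (d = 2) or polyhedron (d = 3), as an open set, possibly nonconvex
   and not necessarily simply connected. *)
Definition polyhedral_domain T : Prop :=
  [/\ T !=set0, open T, connected T,
      interior (closure T) = T & polytopal (closure T)].

(* Locally, Omega lies below the graph of a Lipschitz function over the
   hyperplane orthogonal to n: gam is constant in the direction n. *)
Definition lipschitz_boundary Omega : Prop :=
  forall x, frontier Omega x ->
  exists (n : 'rV[R]_d) (r L : R) (gam : 'rV[R]_d -> R),
  [/\ 0 < r, dotp n n = 1,
      forall y z, `|gam y - gam z| <= L * enorm (y - z),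
      forall y t, gam (y + t *: n) = gam y &
      forall y, ball x r y -> (Omega y <-> dotp n y < gam y)].

Definition unit_normal e n : Prop :=
  dotp n n = 1 /\ forall x y, e x -> e y -> dotp n (x - y) = 0.

(* A unit normal of a flat face, chosen up to sign. *)
Definition face_normal e : 'rV[R]_d := xget 0 [set n | unit_normal e n].

Definition relint e : set 'rV[R]_d :=
  [set x | e x /\ exists2 r : R, 0 < r &
     forall y, ball x r y -> dotp (face_normal e) (y - x) = 0 -> e y].

(* Edge (d = 2) or flat polygonal face (d = 3). *)
Definition flat_face e : Prop :=
  [/\ exists n, unit_normal e n, polytopal e, relint e !=set0,
      connected (relint e) & closure (relint e) = e].

(* n is the unit normal of the flat face e pointing out of T: near each point
   of the relative interior of e, T is the half-space that n points out of. *)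
Definition outward_unit_normal T e n : Prop :=
  unit_normal e n /\
  forall x, relint e x -> exists2 r : R, 0 < r &
    forall y, ball x r y -> (T y <-> dotp n (y - x) < 0).

Definition outward_normal T e : 'rV[R]_d :=
  xget 0 [set n | outward_unit_normal T e n].

(* Surface integral over a flat face: if n is a unit normal of e and n_j != 0,
   the hyperplane of e is a graph over the coordinate hyperplane x_j = 0, whose
   area element is dy / |n_j|. *)

(* The point of the hyperplane of e whose coordinates other than j are y. *)
Definition face_lift e (j : 'I_d) (y : 'rV[R]_d.-1) : 'rV[R]_d :=
  let n := face_normal e in
  let c := dotp n (xget 0 e) in
  \row_i if unlift j i is Some i' then y 0 i'
         else (c - \sum_i' n 0 (lift j i') * y 0 i') / n 0 j.

Definition face_coord e : option 'I_d := [pick j | face_normal e 0 j != 0].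

Definition face_integral e (phi : 'rV[R]_d -> R) : R :=
  if face_coord e is Some j then
    `|face_normal e 0 j|^-1 *
      integral_on (face_lift e j @^-1` e) (phi \o face_lift e j)
  else 0.

Definition L2_face e (phi : 'rV[R]_d -> R) : Prop :=
  if face_coord e is Some j then
    L2_on (face_lift e j @^-1` e) (phi \o face_lift e j)
  else True.

End Geometry.

(* The elements and the faces are two finite families of subsets of R^d. The
   faces of an element T are the members e of the second family such that e is
   included in the boundary of T; collinear or coplanar faces of one element
   are allowed (hanging nodes). *)

Section Mesh.
Context {R : realType} {d : nat}.

Record mesh (E F : finType) := Mesh {
  elt : E -> set 'rV[R]_d;
  face : F -> set 'rV[R]_d }.

Section Predicates.
Context {E F : finType}.
Variables (Omega : set 'rV[R]_d) (M : mesh E F).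

Definition face_of (T : E) (e : F) : bool :=
  `[< face M e `<=` frontier (elt M T) >].

Definition bface (e : F) : bool := `[< face M e `<=` frontier Omega >].

Definition is_partition : Prop :=
  [/\ forall T, polyhedral_domain (elt M T) /\ elt M T `<=` Omega,
      forall T T', T != T' -> elt M T `&` elt M T' = set0 &
      closure Omega = \bigcup_T closure (elt M T)].

Definition is_face_set : Prop :=
  [/\ forall e, flat_face (face M e),
      forall e e', e != e' -> relint (face M e) `&` relint (face M e') = set0,
      forall T, frontier (elt M T) =
        \bigcup_(e in [set e | face_of T e]) face M e,
      forall T e, face_of T e ->
        exists n, outward_unit_normal (elt M T) (face M e) n &
      forall e, (#|[pred T | face_of T e]| = 2%N /\ ~~ bface e) \/
                (#|[pred T | face_of T e]| = 1%N /\ bface e)].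

Definition hT (T : E) : R := diam (elt M T).

(* Each element T contains a ball, and each of its faces a (d-1)-dimensional
   ball, of radius rho * hT T. *)
Definition shape_regular (rho : R) : Prop :=
  [/\ 0 < rho,
      forall T, exists x, forall y,
        enorm (y - x) < rho * hT T -> elt M T y &
      forall T e, face_of T e -> exists2 x, face M e x & forall y,
        dotp (face_normal (face M e)) (y - x) = 0 ->
        enorm (y - x) < rho * hT T -> face M e y].

Definition is_mesh (rho : R) : Prop :=
  [/\ is_partition, is_face_set & shape_regular rho].

Definition elt_integral (T : E) (phi : 'rV[R]_d -> R) : R :=
  integral_on (elt M T) phi.

(* phi is given face by face: v_b, the normal, etc. are not functions on the
   boundary of T but on each of its faces, which overlap in null sets only. *)
Definition bd_integral (T : E) (phi : F -> 'rV[R]_d -> R) : R :=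
  \sum_(e | face_of T e) face_integral (face M e) (phi e).

Definition nrm (T : E) (e : F) : 'rV[R]_d :=
  outward_normal (elt M T) (face M e).

End Predicates.
End Mesh.

Section Polynomials.
Context {R : realType} {d : nat}.
Local Notation mp := (mpoly.mpoly d R).

Definition degle (r : nat) (p : mp) : Prop := (mpoly.msize p <= r.+1)%N.

Definition degle_mx (r : nat) {m p} (A : 'M[mp]_(m, p)) : Prop :=
  forall i j, degle r (A i j).

Definition ev (p : mp) (x : 'rV[R]_d) : R := mpoly.meval (fun i => x 0 i) p.

Definition evm {m p} (A : 'M[mp]_(m, p)) (x : 'rV[R]_d) : 'M[R]_(m, p) :=
  \matrix_(i, j) ev (A i j) x.

Definition grad (p : mp) : 'rV[mp]_d := \row_j mpoly.mderiv j p.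

Definition gradv (v : 'rV[mp]_d) : 'M[mp]_d :=
  \matrix_(i, j) mpoly.mderiv j (v 0 i).

Definition divv (v : 'rV[mp]_d) : mp := \sum_j mpoly.mderiv j (v 0 j).

Definition laplv (v : 'rV[mp]_d) : 'rV[mp]_d :=
  \row_i \sum_j mpoly.mderiv j (mpoly.mderiv j (v 0 i)).

(* The product A n of a matrix and a vector, vectors being rows. *)
Definition mxdot (A : 'M[R]_d) (n : 'rV[R]_d) : 'rV[R]_d := n *m A^T.

End Polynomials.

(* A polynomial on an element (resp. a face) is the restriction to it of a
   polynomial on R^d. On a face several polynomials have the same restriction:
   elements of the spaces are compared by wg_eq and wp_eq below. *)

Section WeakGalerkin.
Context {R : realType} {d : nat} {E F : finType}.
Local Notation mp := (mpoly.mpoly d R).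

Record wg := Wg {
  v0 : E -> 'rV[mp]_d;
  vb : F -> 'rV[mp]_d;
  vg : F -> 'M[mp]_d }.

Record wp := Wp {
  q0 : E -> mp;
  qb : F -> mp }.

Variables (Omega : set 'rV[R]_d) (M : @mesh R d E F) (k : nat).

Definition in_W (v : wg) : Prop :=
  [/\ forall T, degle_mx k (v0 v T),
      forall e, degle_mx k (vb v e) &
      forall e, degle_mx (k - 1)%N (vg v e)].

Definition in_W0 (v : wg) : Prop :=
  in_W v /\
  forall e, bface Omega M e -> forall x, face M e x -> evm (vb v e) x = 0.

Definition in_V (q : wp) : Prop :=
  [/\ forall T, degle (k - 1)%N (q0 q T),
      \sum_T elt_integral M T (ev (q0 q T)) = 0 &
      forall e, degle (k - 1)%N (qb q e)].

Definition wg_eq (u v : wg) : Prop :=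
  (forall T x, elt M T x -> evm (v0 u T) x = evm (v0 v T) x) /\
  (forall e x, face M e x ->
     evm (vb u e) x = evm (vb v e) x /\ evm (vg u e) x = evm (vg v e) x).

Definition wp_eq (p q : wp) : Prop :=
  (forall T x, elt M T x -> ev (q0 p T) x = ev (q0 q T) x) /\
  (forall e x, face M e x -> ev (qb p e) x = ev (qb q e) x).

Definition is_weak_lapl (v : wg) (T : E) (D : 'rV[mp]_d) : Prop :=
  degle_mx (k - 2)%N D /\
  forall w : 'rV[mp]_d, degle_mx (k - 2)%N w ->
  elt_integral M T (fun x => dotp (evm D x) (evm w x)) =
    elt_integral M T (fun x => dotp (evm (v0 v T) x) (evm (laplv w) x))
    - bd_integral M T (fun e x =>
        dotp (evm (vb v e) x) (mxdot (evm (gradv w) x) (nrm M T e)))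
    + bd_integral M T (fun e x =>
        dotp (mxdot (evm (vg v e) x) (nrm M T e)) (evm w x)).

Definition weak_lapl (v : wg) (T : E) : 'rV[mp]_d :=
  xget 0 [set D | is_weak_lapl v T D].

Definition is_weak_div (v : wg) (T : E) (D : mp) : Prop :=
  degle (k - 1)%N D /\
  forall w : mp, degle (k - 1)%N w ->
  elt_integral M T (fun x => ev D x * ev w x) =
    - elt_integral M T (fun x => dotp (evm (v0 v T) x) (evm (grad w) x))
    + bd_integral M T (fun e x => dotp (evm (vb v e) x) (nrm M T e) * ev w x).

Definition weak_div (v : wg) (T : E) : mp :=
  xget 0 [set D | is_weak_div v T D].

Definition is_weak_grad (q : wp) (T : E) (G : 'rV[mp]_d) : Prop :=
  degle_mx (k - 2)%N G /\
  forall w : 'rV[mp]_d, degle_mx (k - 2)%N w ->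
  elt_integral M T (fun x => dotp (evm G x) (evm w x)) =
    - elt_integral M T (fun x => ev (q0 q T) x * ev (divv w) x)
    + bd_integral M T (fun e x => ev (qb q e) x * dotp (evm w x) (nrm M T e)).

Definition weak_grad (q : wp) (T : E) : 'rV[mp]_d :=
  xget 0 [set G | is_weak_grad q T G].

Definition is_L2_proj (r : nat) (e : F) (phi : 'rV[R]_d -> R) (p : mp) : Prop :=
  degle r p /\
  forall w : mp, degle r w ->
  face_integral (face M e) (fun x => (phi x - ev p x) * ev w x) = 0.

Definition Qb (r : nat) (g : 'rV[R]_d -> 'rV[R]_d) (e : F) : 'rV[mp]_d :=
  \row_i xget 0 [set p | is_L2_proj r e (fun x => g x 0 i) p].

Definition form_s1 (v w : wg) : R :=
  \sum_T ((hT M T)^-1 * bd_integral M T (fun e x =>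
            dotp (evm (v0 v T) x - evm (vb v e) x)
                 (evm (v0 w T) x - evm (vb w e) x))
          + hT M T * bd_integral M T (fun e x =>
            dotp (evm (gradv (v0 v T)) x - evm (vg v e) x)
                 (evm (gradv (v0 w T)) x - evm (vg w e) x))).

Definition form_s2 (p q : wp) : R :=
  \sum_T (hT M T * bd_integral M T (fun e x =>
    (ev (q0 p T) x - ev (qb p e) x) * (ev (q0 q T) x - ev (qb q e) x))).

Definition form_a (u : wg) (p : wp) (v : wg) (q : wp) : R :=
  \sum_T (elt_integral M T (fun x =>
            dotp (- evm (weak_lapl u T) x + evm (weak_grad p T) x)
                 (- evm (weak_lapl v T) x + evm (weak_grad q T) x))
          + elt_integral M T (fun x =>
              ev (weak_div u T) x * ev (weak_div v T) x)).

Definition load (f : 'rV[R]_d -> 'rV[R]_d) (v : wg) (q : wp) : R :=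
  \sum_T elt_integral M T (fun x =>
    dotp (f x) (- evm (weak_lapl v T) x + evm (weak_grad q T) x)).

Definition is_wg_solution (f g : 'rV[R]_d -> 'rV[R]_d) (u : wg) (p : wp) :
    Prop :=
  [/\ in_W u, in_V p,
      forall e, bface Omega M e -> forall x, face M e x ->
        evm (vb u e) x = evm (Qb k g e) x &
      forall (v : wg) (q : wp), in_W0 v -> in_V q ->
        form_a u p v q + form_s1 u v + form_s2 p q = load f v q].

End WeakGalerkin.

(* Main.v *)
(* The left-hand side is the polar form of a sum of squares, so the problem is
   a symmetric positive semidefinite linear system: by the Fredholm alternative
   it is solvable because the load and the lifted boundary datum vanish on the
   pairs of zero energy. Uniqueness says that these pairs are zero. On such a
   pair the jumps vanish on every face, hence, by the divergence theorem, the
   weak operators are the classical ones: Delta w = grad r and div w = 0 on each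
   element, where w, grad w and r match across faces and w = 0 on the boundary.
   Summing over the elements the integrals of div (sum_i w_i grad w_i - r w),
   the fluxes cancel and grad w = 0; then the field x_0 |w|^2 e_0 gives w = 0,
   and grad r = 0. A generic segment crosses the faces one at a time and at
   relative interior points, so r takes the same value on all the elements
   meeting a ball of Omega, and by connectedness on all elements; it is zero
   because its mean is.

   The divergence theorem is obtained from Fubini along almost all lines
   parallel to a coordinate axis: such a line meets each face transversally at a
   single relative interior point, where the indicator of the element jumps. *)

(* The unknowns are coefficients of polynomials on the whole space, and on a face many polynomials
   have the same restriction. The linear system in the coefficients is therefore singular in
   general, and injectivity cannot give existence: hence the Fredholm alternative, and uniqueness
   only up to equality of restrictions. Apart from the load, every integrand is a polynomial.
   Integrals over elements and faces thus enter the algebra as linear functionals on polynomials,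
   nonnegative on squares, and zero on a square only if the polynomial vanishes on the domain of
   integration. The divergence theorem in direction [j] produces integrals over the projection of a
   face along the axis [j], whereas [face_integral] projects along one axis picked once and for all.
   That both give the same number has to be proved: Tonelli does it for squares, and polarization
   for all polynomials. *)
Require Import Defs.
From mathcomp Require Import all_boot all_order all_algebra.
From mathcomp Require Import all_classical all_reals all_analysis.
From mathcomp Require Import measurable_realfun.
From mathcomp Require Import zify ring lra.
From mathcomp Require mpoly.
Import (canonicals, coercions) mpoly.

Set Implicit Arguments.
Unset Strict Implicit.
Unset Printing Implicit Defensive.

Import Order.TTheory GRing.Theory Num.Theory.
Import numFieldNormedType.Exports.
Local Open Scope classical_set_scope.
Local Open Scope ring_scope.

(** * Slicing the Lebesgue measure *)

Section Tonelli.
Context {R : realType}.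
Local Notation mu := (@lebesgue_measure R).
Local Notation X := (measurableTypeR R).

Definition tins n (j : 'I_n.+1) (t : X) (y : n.-tuple X) : n.+1.-tuple X :=
  [tuple if unlift j i is Some i' then tnth y i' else t | i < n.+1].

Lemma measurable_tins d (T : measurableType d) n (j : 'I_n.+1)
    (f : T -> X) (h : T -> n.-tuple X) :
  measurable_fun setT f -> measurable_fun setT h ->
  measurable_fun setT (fun x => tins j (f x) (h x)).
Proof.
move=> mf mh; apply/measurable_fun_tnthP => i.
rewrite [X in measurable_fun _ X](_ : _ = fun x =>
   if unlift j i is Some i' then tnth (h x) i' else f x); last first.
  by apply/funext => x /=; rewrite tnth_mktuple.
case: (unlift j i) => [i'|//].
exact: (measurableT_comp (measurable_tnth i')).
Qed.

Lemma tins0 n t (y : n.-tuple X) : tins ord0 t y = cons_pair (t, y).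
Proof.
apply: eq_from_tnth => i; rewrite tnth_mktuple.
by case: unliftP => [i'|] ->; rewrite ?tnthS ?tnth0.
Qed.

Lemma tinsS n (j : 'I_n.+1) t x (y : n.-tuple X) :
  tins (lift ord0 j) t (cons_pair (x, y)) = cons_pair (x, tins j t y).
Proof.
apply: eq_from_tnth => i; rewrite tnth_mktuple.
case: unliftP => [i'|] ->.
  have [k|] := unliftP ord0 i'; last first.
    move=> ->; rewrite tnth0.
    have -> : lift (lift ord0 j) ord0 = ord0 by apply: val_inj.
    by rewrite tnth0.
  move=> ->; rewrite tnthS.
  have -> : lift (lift ord0 j) (lift ord0 k) = lift ord0 (lift j k).
    by apply: val_inj; rewrite /= /bump; lia.
  by rewrite tnthS tnth_mktuple liftK.
by rewrite tnthS tnth_mktuple unlift_none.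
Qed.

Lemma lebesgueS_integral n (F : n.+1.-tuple X -> \bar R) :
  measurable_fun setT F -> (forall x, 0 <= F x)%E ->
  (\int[lebesgue n.+1]_x F x =
   \int[(mu \x lebesgue n)%E]_z F (cons_pair z))%E.
Proof.
move=> mF F0.
exact: (@ge0_integral_pushforward _ _ _ _ _ _ (@measurable_cons_pair _ X n)
   (mu \x lebesgue n)%E setT F).
Qed.

Lemma lebesgueS_tonelli1 n (F : n.+1.-tuple X -> \bar R) :
  measurable_fun setT F -> (forall x, 0 <= F x)%E ->
  (\int[lebesgue n.+1]_x F x =
   \int[mu]_t \int[lebesgue n]_y F (cons_pair (t, y)))%E.
Proof.
move=> mF F0; rewrite lebesgueS_integral//.
apply: (@fubini_tonelli1 _ _ _ _ _ mu (lebesgue n) (F \o @cons_pair _ X _)).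
  exact: measurableT_comp (@measurable_cons_pair _ X _).
by move=> z; exact: F0.
Qed.

Lemma lebesgueS_tonelli2 n (F : n.+1.-tuple X -> \bar R) :
  measurable_fun setT F -> (forall x, 0 <= F x)%E ->
  (\int[lebesgue n.+1]_x F x =
   \int[lebesgue n]_y \int[mu]_t F (cons_pair (t, y)))%E.
Proof.
move=> mF F0; rewrite lebesgueS_integral//.
apply: (@fubini_tonelli2 _ _ _ _ _ mu (lebesgue n) (F \o @cons_pair _ X _)).
  exact: measurableT_comp (@measurable_cons_pair _ X _).
by move=> z; exact: F0.
Qed.

Lemma measurable_integral_tins n (j : 'I_n.+1) (F : n.+1.-tuple X -> \bar R) :
  measurable_fun setT F -> (forall x, 0 <= F x)%E ->
  measurable_fun setT (fun y => \int[mu]_t F (tins j t y))%E.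
Proof.
move=> mF F0.
apply: (@measurable_fun_fubini_tonelli_F _ _ _ _ _ mu
  (fun p : n.-tuple X * X => F (tins j p.2 p.1))) => //.
by apply: measurableT_comp => //; exact: measurable_tins.
Qed.

(** [lebesgue] is built by adding coordinates in front, so only [j = 0] is immediate. For another
    [j], the first coordinate is split off, the induction hypothesis is applied to the remaining
    ones, and [tinsS] puts the first coordinate back. *)
Lemma tonelli_ins n (j : 'I_n.+1) (F : n.+1.-tuple X -> \bar R) :
  measurable_fun setT F -> (forall x, 0 <= F x)%E ->
  (\int[lebesgue n.+1]_x F x = \int[lebesgue n]_y \int[mu]_t F (tins j t y))%E.
Proof.
elim: n j F => [|n IH] j F mF F0.
  rewrite (lebesgueS_tonelli2 mF F0).
  apply: eq_integral => y _; apply: eq_integral => t _.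
  by rewrite (ord1 j) tins0.
case: (unliftP ord0 j) => [j'|] ->; last first.
  rewrite (lebesgueS_tonelli2 mF F0).
  apply: eq_integral => y _; apply: eq_integral => t _.
  by rewrite tins0.
rewrite (lebesgueS_tonelli1 mF F0).
pose H (z : n.+1.-tuple X) := (\int[mu]_t F (tins (lift ord0 j') t z))%E.
rewrite -[RHS]/(\int[lebesgue n.+1]_y H y)%E lebesgueS_tonelli1//; first last.
- by move=> z; exact: integral_ge0.
- exact: measurable_integral_tins.
apply: eq_integral => x _.
have mFx : measurable_fun setT (fun z => F (cons_pair (x, z))).
  apply: (measurableT_comp mF).
  apply: (measurableT_comp (@measurable_cons_pair _ X _)).
  exact: pair1_measurable.
rewrite [LHS](IH j' _ mFx (fun z => F0 _)).
by apply: eq_integral => y _; apply: eq_integral => t _; rewrite tinsS.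
Qed.

Lemma fubini_ins n (j : 'I_n.+1) (F : n.+1.-tuple X -> \bar R) :
  (lebesgue n.+1).-integrable setT F ->
  (\int[lebesgue n.+1]_x F x = \int[lebesgue n]_y \int[mu]_t F (tins j t y))%E.
Proof.
move=> iF; have mF := measurable_int _ iF.
have mFp := measurable_funepos mF; have mFn := measurable_funeneg mF.
have iFp := integrable_funepos measurableT iF.
have iFn := integrable_funeneg measurableT iF.
rewrite integralE (tonelli_ins j mFp)// (tonelli_ins j mFn)//.
have aux G : measurable_fun setT G -> (forall x, 0 <= G x)%E ->
    (lebesgue n.+1).-integrable setT G ->
    (lebesgue n).-integrable setT (fun y => \int[mu]_t G (tins j t y))%E.
  move=> mG G0 /integrableP[_ iG]; apply/integrableP; split.
    exact: measurable_integral_tins.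
  under eq_integral do rewrite gee0_abs ?integral_ge0//.
  rewrite -(tonelli_ins j mG G0).
  by under eq_integral do rewrite -[G _]gee0_abs//.
rewrite -integralB//; [|exact: aux|exact: aux].
apply: eq_integral => y _; rewrite [RHS]integralE.
by congr (_ - _)%E; apply: eq_integral => t _; rewrite ?funeposE ?funenegE.
Qed.

Definition rins n (j : 'I_n.+1) (t : R) (y : 'rV[R]_n) : 'rV[R]_n.+1 :=
  \row_i if unlift j i is Some i' then y 0 i' else t.

Lemma vec_tins n (j : 'I_n.+1) t (y : n.-tuple X) :
  vec (tins j t y) = rins j t (vec y).
Proof.
apply/rowP => i; rewrite !mxE tnth_mktuple.
by case: unliftP => // i' _; rewrite mxE.
Qed.

Lemma rinsE n (j : 'I_n.+1) t y : rins j t y 0 j = t.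
Proof. by rewrite mxE unlift_none. Qed.

Lemma rins_lift n (j : 'I_n.+1) t y i : rins j t y 0 (lift j i) = y 0 i.
Proof. by rewrite mxE liftK. Qed.

Lemma measurable_coord n (i : 'I_n) :
  measurable_fun setT (fun t : n.-tuple X => vec t 0 i).
Proof.
rewrite [X in measurable_fun _ X](_ : _ = fun t => tnth t i).
  exact: measurable_tnth.
by apply/funext => t; rewrite mxE.
Qed.

Definition cube n (c : 'rV[R]_n) (r : R) : set 'rV[R]_n :=
  [set x | forall i, `|x 0 i - c 0 i| <= r].

(** Cubes serve three times: as countable building blocks of open sets, as sets of finite measure
    around bounded sets, and as sets of positive measure on which a nonzero polynomial stays away
    from 0. *)
Lemma lebesgue_cube n (c : 'rV[R]_n) (r : R) : 0 <= r ->
  measurable (vec @^-1` cube c r) /\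
  lebesgue n (vec @^-1` cube c r) = ((r *+ 2) ^+ n)%:E.
Proof.
move=> r0; elim: n c => [|n IH] c.
  have -> : vec @^-1` cube c r = setT by apply/seteqP; split => // t _ [].
  by split => //; rewrite /= diracT.
pose I : set X := `[c 0 ord0 - r, c 0 ord0 + r]%classic.
pose c' : 'rV_n := \row_i c 0 (lift ord0 i).
have [mC lC] := IH c'.
have E : cons_pair (X:=X) (n:=n) @^-1` (vec @^-1` cube c r) =
    I `*` (vec @^-1` cube c' r).
  apply/seteqP; split => -[x y] /=.
    move=> h; split.
      have := h ord0; rewrite /I /= in_itv /= mxE tnth0 /=.
      by rewrite ler_distl.
    by move=> i; have := h (lift ord0 i); rewrite !mxE tnthS.
  move=> [hI hC] i; case: (unliftP ord0 i) => [i'|] ->.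
    by have := hC i'; rewrite !mxE tnthS.
  by move: hI; rewrite /I /= in_itv /= mxE tnth0 /= ler_distl.
split.
  rewrite (_ : vec @^-1` cube c r = (@uncons_pair _ X n) @^-1` (I `*` (vec @^-1` cube c' r))).
    rewrite -[X in measurable X]setTI; apply: measurable_uncons_pair => //.
    by apply: measurableX => //; exact: measurable_itv.
  rewrite -E -comp_preimage; apply/seteqP.
  have K t : cons_pair (uncons_pair t) = t :> n.+1.-tuple X.
    by rewrite /cons_pair /uncons_pair /=; apply/val_inj; case/tupleP: t => x t /=; rewrite theadE.
  by split => t /=; rewrite K.
have mI : measurable I by exact: measurable_itv.
have lI : mu I = (r *+ 2)%:E.
  rewrite [LHS]lebesgue_measure_itv /= lte_fin.
  have -> : ((c 0 ord0 + r)%:E - (c 0 ord0 - r)%:E)%E = (r *+ 2)%:E.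
    by rewrite -EFinB; congr EFin; rewrite mulr2n; ring.
  case: ifPn => // /negP; rewrite ltrD2l => h; have -> : r = 0 by lra.
  by rewrite mul0rn.
by rewrite /= /measure_cons /pushforward E product_measure1E// exprS EFinM; exact: congr2 lI lC.
Qed.

(** The image of the Lebesgue measure under the affine map, scaled by [|a|], agrees with the
    Lebesgue measure on the intervals []x, y]], which determine it. For [a < 0] the preimage of such
    an interval is closed on the left and open on the right, with the same length. *)
Lemma affine_integral (a b : R) (G : X -> \bar R) : a != 0 ->
  measurable_fun setT G -> (forall x, 0 <= G x)%E ->
  (\int[mu]_t G t = `|a|%:E * \int[mu]_t G (a * t + b)%R)%E.
Proof.
move=> a0 mG G0.
have mphi : measurable_fun setT (fun t : X => a * t + b : X).
  by apply: measurable_funD => //; exact: measurable_funM.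
have na : 0 < `|a| by rewrite normr_gt0.
pose phi (t : X) : X := a * t + b.
pose pf : {measure set X -> \bar R} :=
  measure_function_pushforward__canonical__measure_function_Measure mu mphi.
pose nu := mscale (NngNum (ltW na)) pf.
have nuE A : measurable A -> mu A = nu A.
  apply: lebesgue_measure_unique => _ [[x y] /= xy <-].
  change (mu `]x, y]%classic = (`|a|%:E * mu (phi @^-1` `]x, y]%classic))%E).
  have [ap|an] := ltrP 0 a.
    have -> : phi @^-1` `]x, y]%classic = `](x - b) / a, (y - b) / a]%classic.
      apply/seteqP; split => t /=; rewrite !in_itv /= /phi.
        by rewrite ltr_pdivrMr// ler_pdivlMr// ltrBlDr lerBrDr mulrC.
      by rewrite ltr_pdivrMr// ler_pdivlMr// ltrBlDr lerBrDr mulrC.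
    rewrite !lebesgue_measure_itv /= !lte_fin ltr_pM2r ?invr_gt0// ltrD2r.
    case: ifP => _; last by rewrite mule0.
    by rewrite gtr0_norm// -!EFinB -EFinM; congr EFin; field; lra.
  have an' : a < 0 by rewrite lt_neqAle a0.
  have -> : phi @^-1` `]x, y]%classic = `[(y - b) / a, (x - b) / a[%classic.
    apply/seteqP; split => t /=; rewrite !in_itv /= /phi.
      by rewrite ler_ndivrMr// ltr_ndivlMr// ltrBlDr lerBrDr mulrC andbC.
    by rewrite ler_ndivrMr// ltr_ndivlMr// ltrBlDr lerBrDr mulrC andbC.
  rewrite !lebesgue_measure_itv /= !lte_fin ltr_nM2r ?invr_lt0// ltrD2r.
  case: ifP => _; last by rewrite mule0.
  by rewrite ltr0_norm// -!EFinB -EFinM; congr EFin; field; lra.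
have -> : (\int[mu]_t G t = \int[nu]_t G t)%E.
  by apply: eq_measure_integral => A mA _; exact: nuE.
rewrite ge0_integral_mscale//=; congr (_ * _)%E.
exact: (@ge0_integral_pushforward _ _ _ _ _ _ mphi mu setT G).
Qed.

End Tonelli.

Lemma ballrV (R : realType) n (x y : 'rV[R]_n) (r : R) :
  ball x r y <-> 0 < r /\ forall i, `|x 0 i - y 0 i| < r.
Proof.
split=> [[r0 h]|[r0 h]]; split => //.
  by move=> i; have := h 0 i.
by move=> i j; rewrite (ord1 i); exact: h.
Qed.

(** Measurable sets of tuples are generated by the coordinates, not by the topology of ['rV_n]. An
    open set is reached as a countable union of closed cubes with rational centres and radii
    [1 / (m + 1)]. *)
Lemma open_measurable_vec (R : realType) n (A : set 'rV[R]_n) : open A -> measurable (vec @^-1` A).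
Proof.
move=> oA.
pose Q (c : 'rV[rat]_n * nat) : set 'rV[R]_n := cube (map_mx ratr c.1) (c.2.+1%:R^-1).
pose S (k : nat) : set 'rV[R]_n :=
  if unpickle k is Some c then if `[< Q c `<=` A >] then Q c else set0 else set0.
have -> : A = \bigcup_k S k.
  apply/seteqP; split => [x Ax|x [k _]]; last first.
    by rewrite /S; case: unpickle => [c|//]; case: asboolP => // cA /cA.
  have /nbhs_ballP[r /= r0 hr] : nbhs x A by exact: open_nbhs_nbhs.
  (* The centre is only within [1 / (m + 1)] of [x], so the cube may extend from [x] by twice its
     radius. *)
  have [m hm] : exists m : nat, m.+1%:R^-1 < r / 2.
    have := archi_boundP (ltW (divr_gt0 (@ltr0n R 2) r0)).
    set m := Num.bound _; move=> hm; exists m.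
    rewrite -[r / 2]invrK invf_div ltf_pV2 ?posrE ?divr_gt0// ?ltr0n//.
    by rewrite (lt_le_trans hm)// ler_nat leqnSn.
  have m0 : 0 < m.+1%:R^-1 :> R by rewrite invr_gt0 ltr0n.
  have /choice[q hq] : forall i, exists q : rat, `|x 0 i - ratr q| <= m.+1%:R^-1.
    move=> i; have lt : x 0 i - m.+1%:R^-1 < x 0 i + m.+1%:R^-1 by rewrite ltrD2l (lt_trans _ m0)// oppr_lt0.
    have [q] := rat_in_itvoo lt.
    by rewrite in_itv /= => /andP[h1 h2]; exists q; rewrite ler_distlC (ltW h1) (ltW h2).
  pose c : 'rV[rat]_n * nat := (\row_i q i, m).
  exists (pickle c) => //; rewrite /S pickleK; case: asboolP => [_|].
    by move=> i; rewrite !mxE.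
  case=> y Qy; apply: hr; apply/ballrV; split => // i.
  have := Qy i; have := hq i; rewrite !mxE => h1 h2.
  apply: (le_lt_trans (ler_distD (ratr (q i)) _ _)); rewrite (distrC (ratr _)).
  by apply: (le_lt_trans (lerD h1 h2)); rewrite (splitr r) ltrD.
rewrite preimage_bigcup; apply: bigcupT_measurable => k.
rewrite /S; case: unpickle => [c|]; last by rewrite preimage_set0.
case: asboolP => _; last by rewrite preimage_set0.
by have [] := @lebesgue_cube R n (map_mx ratr c.1) (c.2.+1%:R^-1) _; rewrite ?invr_ge0.
Qed.

(** * Polynomial functions *)

Section Eval.
Context {R : realType} {n : nat}.
Local Notation mp := (mpoly.mpoly n R).
Implicit Types (p q : mp) (x y v : 'rV[R]_n).

(** Evaluation, derivation and substitution are compatible with sums and products, which makes this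
    induction handier than one over monomials. *)
Lemma mp_ring_ind (P : mp -> Prop) :
  (forall c, P (mpoly.mpolyC n c)) ->
  (forall i, P (mpoly.mpolyX R (mpoly.mnm1 i))) ->
  (forall p q, P p -> P q -> P (p + q)) ->
  (forall p q, P p -> P q -> P (p * q)) ->
  forall p, P p.
Proof.
move=> hC hX hD hM.
have hprod (I : Type) (r : seq I) (F : I -> mp) :
    (forall i, P (F i)) -> P (\prod_(i <- r) F i).
  move=> hF; elim/big_ind : _ => //.
  by rewrite -[1]mpoly.mpolyC1.
elim/mpoly.mpolyind => [|c m p _ _ IH]; first by rewrite -[0]mpoly.mpolyC0.
apply: (hD) => //; rewrite -mpoly.mul_mpolyC; apply: (hM) => //.
rewrite mpoly.mpolyXE_id; apply: hprod => i.
elim: (m i) => [|k IHk]; first by rewrite expr0 -[1]mpoly.mpolyC1.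
by rewrite exprS; exact: hM.
Qed.

Lemma evD p q x : ev (p + q) x = ev p x + ev q x.
Proof. exact: mpoly.mevalD. Qed.
Lemma evN p x : ev (- p) x = - ev p x.
Proof. exact: mpoly.mevalN. Qed.
Lemma evB p q x : ev (p - q) x = ev p x - ev q x.
Proof. exact: mpoly.mevalB. Qed.
Lemma evM p q x : ev (p * q) x = ev p x * ev q x.
Proof. exact: mpoly.mevalM. Qed.
Lemma evZ c p x : ev (c *: p) x = c * ev p x.
Proof. exact: mpoly.mevalZ. Qed.
Lemma evC c x : ev (mpoly.mpolyC n c) x = c.
Proof. exact: mpoly.mevalC. Qed.
Lemma ev0 x : ev 0 x = 0.
Proof. exact: mpoly.meval0. Qed.
Lemma evX i x : ev (mpoly.mpolyX R (mpoly.mnm1 i)) x = x 0 i.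
Proof. exact: mpoly.mevalXU. Qed.
Lemma ev_sum (I : Type) (r : seq I) (P : pred I) (F : I -> mp) x :
  ev (\sum_(i <- r | P i) F i) x = \sum_(i <- r | P i) ev (F i) x.
Proof. exact: (raddf_sum (mpoly.meval (fun i => x 0 i))). Qed.

Lemma ev_prod (I : Type) (r : seq I) (F : I -> mp) x :
  ev (\prod_(i <- r) F i) x = \prod_(i <- r) ev (F i) x.
Proof. exact: (rmorph_prod (mpoly.meval (fun i => x 0 i))). Qed.

Lemma ev_continuous p : continuous (ev p : 'rV[R]_n -> R).
Proof.
elim/mp_ring_ind : p => [c|i|p q hp hq|p q hp hq] x.
- rewrite (_ : ev _ = cst c); first exact: cst_continuous.
  by apply/funext => y; rewrite evC.
- rewrite (_ : ev _ = fun y : 'rV[R]_n => y 0 i); first exact: coord_continuous.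
  by apply/funext => y; rewrite evX.
- rewrite (_ : ev _ = ev p \+ ev q); first exact: cvgD (hp x) (hq x).
  by apply/funext => y; rewrite evD.
- rewrite (_ : ev _ = ev p \* ev q); first exact: cvgM (hp x) (hq x).
  by apply/funext => y; rewrite evM.
Qed.

Lemma ev_measurable p : measurable_fun setT (ev p \o (@vec R n)).
Proof.
elim/mp_ring_ind : p => [c|i|p q hp hq|p q hp hq].
- rewrite (_ : _ \o _ = cst c); first exact: measurable_cst.
  by apply/funext => y /=; rewrite evC.
- rewrite (_ : _ \o _ = fun t => vec t 0 i); first exact: measurable_coord.
  by apply/funext => y /=; rewrite evX.
- rewrite (_ : _ \o _ = (ev p \o @vec R n) \+ (ev q \o @vec R n)).
    exact: measurable_funD.
  by apply/funext => y /=; rewrite evD.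
- rewrite (_ : _ \o _ = (ev p \o @vec R n) \* (ev q \o @vec R n)).
    exact: measurable_funM.
  by apply/funext => y /=; rewrite evM.
Qed.

Definition bounded_rV (A : set 'rV[R]_n) :=
  exists r : R, forall x, A x -> forall i, `|x 0 i| <= r.

Lemma ev_bounded p (A : set 'rV[R]_n) : bounded_rV A ->
  exists C : R, forall x, A x -> `|ev p x| <= C.
Proof.
move=> [r hr]; elim/mp_ring_ind : p => [c|i|p q [C hC] [D hD]|p q [C hC] [D hD]].
- by exists `|c| => x _; rewrite evC.
- by exists r => x /hr; rewrite evX.
- exists (C + D) => x Ax; rewrite evD (le_trans (ler_normD _ _))//.
  by rewrite lerD ?hC ?hD.
- exists (C * D) => x Ax; rewrite evM normrM.
  by rewrite ler_pM ?normr_ge0 ?hC ?hD.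
Qed.

Lemma ev_derive p x v (t : R) :
  is_derive t 1 (fun s : R => ev p (x + s *: v))
    (\sum_j v 0 j * ev (mpoly.mderiv j p) (x + t *: v)).
Proof.
elim/mp_ring_ind : p => [c|i|p q hp hq|p q hp hq].
- rewrite (_ : (fun _ => _) = cst c); last by apply/funext => s; rewrite evC.
  rewrite big1; first exact: is_derive_cst.
  by move=> j _; rewrite mpoly.mderivC ev0 mulr0.
- rewrite (_ : (fun _ => _) = (cst (x 0 i) + (v 0 i \*: id))); last first.
    by apply/funext => s; rewrite evX !mxE /= mulrC.
  apply: is_derive_eq; rewrite add0r (bigD1 i)//= big1 ?addr0.
    rewrite mpoly.mderivX mpoly.mnm1E eqxx scale1r.
    rewrite (_ : mpoly.mnm_sub _ _ = mpoly.mnm0); last first.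
      by apply/mpoly.mnmP => j; rewrite !mpoly.mnmE subnn.
    by rewrite mpoly.mpolyX0 [ev _ _]mpoly.meval1 mulr1 scaler1.
  move=> j ji; rewrite mpoly.mderivX mpoly.mnm1E eq_sym (negbTE ji) scale0r.
  by rewrite ev0 mulr0.
- rewrite (_ : (fun _ => _) = (fun s : R => ev p (x + s *: v)) +
      (fun s : R => ev q (x + s *: v))); last first.
    by apply/funext => s; rewrite evD.
  apply: is_derive_eq; rewrite -big_split; apply: eq_bigr => j _ /=.
  by rewrite mpoly.mderivD evD mulrDr.
- rewrite (_ : (fun _ => _) = (fun s : R => ev p (x + s *: v)) *
      (fun s : R => ev q (x + s *: v))); last first.
    by apply/funext => s; rewrite evM.
  apply: is_derive_eq; rewrite !scaler_sumr -big_split; apply: eq_bigr => j _ /=.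
  by rewrite mpoly.mderivM evD !evM /GRing.scale /=; ring.
Qed.

End Eval.

Section PolyFacts.
Context {R : realType} {n : nat}.
Local Notation mp := (mpoly.mpoly n R).
Implicit Types (p q : mp) (x y v : 'rV[R]_n).

(** With a strict bound, [degbnd 0] holds of the zero polynomial alone, which is the base case of
    [ev_eq0_ball]. *)
Definition degbnd (k : nat) (p : mp) := forall m, m \in mpoly.msupp p -> (mpoly.mdeg m < k)%N.

Lemma degbndP k p : reflect (degbnd k p) (mpoly.msize p <= k)%N.
Proof.
apply: (iffP idP) => [h m hm|h].
  exact: leq_trans (mpoly.msize_mdeg_lt hm) h.
by rewrite mpoly.msizeE; apply/bigmax_leqP_seq => m hm _; exact: h.
Qed.

Lemma degbnd_mderiv k j p : degbnd k.+1 p -> degbnd k (mpoly.mderiv j p).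
Proof.
move=> h m; rewrite mpoly.mcoeff_msupp mpoly.mcoeff_deriv => hm.
have : (mpoly.mnm_add m (mpoly.mnm1 j)) \in mpoly.msupp p.
  by rewrite mpoly.mcoeff_msupp; apply: contraNneq hm => ->; rewrite mul0rn.
by move/h; rewrite mpoly.mdegD mpoly.mdeg1 addn1 ltnS.
Qed.

Lemma degle_mderiv r j p : degle r.+1 p -> degle r (mpoly.mderiv j p).
Proof. by move/degbndP => h; apply/degbndP; exact: degbnd_mderiv. Qed.

(** Characteristic zero: if [m j] is positive, the coefficient of [m] reappears in the derivative
    along [j], multiplied by [m j]. *)
Lemma mderiv0_const p : (forall j, mpoly.mderiv j p = 0) ->
  p = mpoly.mpolyC n (mpoly.mcoeff mpoly.mnm0 p).
Proof.
move=> h; apply/mpoly.mpolyP => m; rewrite mpoly.mcoeffC.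
case: eqVneq => [->|m0]; first by rewrite mulr1.
rewrite mulr0.
have [j mj] : exists j, m j != 0%N.
  apply/existsP; apply: contra_neqT m0; rewrite negb_exists => /forallP m0.
  by apply/mpoly.mnmP => j; rewrite mpoly.mnm0E; apply/eqP; have := m0 j; rewrite negbK.
have := congr1 (mpoly.mcoeff (mpoly.mnm_sub m (mpoly.mnm1 j))) (h j).
rewrite mpoly.mcoeff_deriv mpoly.mcoeff0.
rewrite (_ : mpoly.mnm_add _ _ = m); last first.
  apply/mpoly.mnmP => i; rewrite mpoly.mnmDE mpoly.mnmBE mpoly.mnm1E.
  by rewrite subnK//; case: eqP => [<-|//]; rewrite lt0n.
by move/eqP; rewrite mulrn_eq0 /= => /eqP.
Qed.

(** Induction on the degree: the partial derivatives vanish on the ball as well, hence are zero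
    polynomials, so [p] is a constant, equal to its value at the centre. *)
Lemma ev_eq0_ball p x r : 0 < r ->
  (forall y, ball x r y -> ev p y = 0) -> p = 0.
Proof.
move=> r0; have [k] := ubnP (mpoly.msize p).
move/ltnW/degbndP; elim: k p => [|k IH] p hk hp.
  apply/mpoly.mpolyP => m; rewrite mpoly.mcoeff0.
  by apply/eqP; apply/negPn/negP; rewrite -mpoly.mcoeff_msupp => /hk.
have dp0 j : mpoly.mderiv j p = 0.
  apply: IH; first exact: degbnd_mderiv.
  move=> y xy.
  have D := ev_derive p y (delta_mx 0 j) 0.
  have : \forall s \near (0 : R), ev p (y + s *: delta_mx 0 j) = 0.
    have : \forall z \near y, ev p z = 0.
      apply: (@filterS _ _ _ (fun z => ball x r z)); first by move=> z /hp.
      by move: xy => /ballrV[_ xy]; apply: open_nbhs_nbhs; split;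
        [exact: ball_open|apply/ballrV].
    have cy : (fun s : R => y + s *: delta_mx 0 j) @ 0 --> y.
      rewrite -[X in _ --> X]addr0 -(scale0r (delta_mx 0 j)).
      apply: cvgD; first exact: cvg_cst.
      by apply: cvgZr_tmp.
    by move/cy.
  move=> h0.
  have D0 : is_derive (0 : R) 1 (fun s : R => ev p (y + s *: delta_mx 0 j)) 0.
    by apply: (near_eq_is_derive (f := cst 0)); apply: filterS h0 => s /= ->.
  have := @derive_val _ _ _ _ _ _ _ D; rewrite (@derive_val _ _ _ _ _ _ _ D0).
  rewrite (bigD1 j)//= big1 ?addr0; last first.
    by move=> i ij; rewrite mxE (negbTE ij) andbF mul0r.
  by rewrite mxE !eqxx mul1r scale0r addr0.
have pC := mderiv0_const dp0.
have : ev p x = 0 by apply: hp; exact: ballxx.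
by rewrite pC evC => ->; rewrite mpoly.mpolyC0.
Qed.

Lemma ev_neq0_open p (A : set 'rV[R]_n) : open A -> A !=set0 -> p != 0 ->
  exists2 x, A x & ev p x != 0.
Proof.
move=> oA [x Ax] p0; apply: contrapT => h; move/eqP : p0; apply.
have /nbhs_ballP[r /= r0 hr] : nbhs x A by exact: open_nbhs_nbhs.
apply: (ev_eq0_ball r0 (x := x)) => y /hr Ay; apply: contrapT => /eqP py.
by apply: h; exists y.
Qed.

End PolyFacts.

(** * Integration of polynomials *)

Section Scalar.
Context {R : realType} {V : lmodType R} (L : V -> R).
Hypothesis hL : forall a u v, L (a *: u + v) = a * L u + L v.

Lemma sclD u v : L (u + v) = L u + L v.
Proof. by rewrite -[u]scale1r hL mul1r scale1r. Qed.
Lemma scl0 : L 0 = 0.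
Proof. by have := sclD 0 0; rewrite addr0 => /eqP; rewrite addrC -subr_eq subrr => /eqP. Qed.
Lemma sclZ a u : L (a *: u) = a * L u.
Proof. by rewrite -[a *: u]addr0 hL scl0 addr0. Qed.
Lemma sclN u : L (- u) = - L u.
Proof. by rewrite -scaleN1r sclZ mulN1r. Qed.
Lemma sclB u v : L (u - v) = L u - L v.
Proof. by rewrite sclD sclN. Qed.
Lemma scl_sum (I : Type) (r : seq I) (P : pred I) (F : I -> V) :
  L (\sum_(i <- r | P i) F i) = \sum_(i <- r | P i) L (F i).
Proof. exact: (big_morph L sclD scl0). Qed.
End Scalar.

Section Nice.
Context {R : realType} {n : nat}.
Local Notation mp := (mpoly.mpoly n R).
Implicit Types (A : set 'rV[R]_n) (p q : mp).

(** All that is asked of a set for polynomials to be integrable over it. *)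
Definition nice A := measurable (vec @^-1` A) /\ bounded_rV A.

Lemma nice_lty A : nice A -> (lebesgue n (vec @^-1` A) < +oo)%E.
Proof.
move=> [mA [r hr]]; have [s [s0 hs]] : exists s, 0 <= s /\ r <= s.
  by exists `|r|; rewrite normr_ge0 ler_norm.
have [mC lC] := lebesgue_cube (0 : 'rV[R]_n) s0.
apply: (@le_lt_trans _ _ (lebesgue n (vec @^-1` cube 0 s))).
  apply: le_measure; rewrite ?inE// => t /= At i.
  by rewrite [X in _ - X]mxE subr0 (le_trans (hr _ At i)).
by rewrite lC ltry.
Qed.

Lemma nice_integrable A (phi : 'rV[R]_n -> R) : nice A ->
  measurable_fun (vec @^-1` A) (phi \o vec) ->
  (exists C : R, forall x, A x -> `|phi x| <= C) ->
  (lebesgue n).-integrable (vec @^-1` A) (EFin \o (phi \o vec)).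
Proof.
move=> nA mphi [C hC].
have [mA _] := nA.
apply: measurable_bounded_integrable => //; first exact: nice_lty.
exists C; split; first exact: num_real.
by move=> M CM t At; apply: (le_trans (hC _ At)); exact: ltW.
Qed.

Lemma ev_integrable A p : nice A ->
  (lebesgue n).-integrable (vec @^-1` A) (EFin \o (ev p \o vec)).
Proof.
move=> nA; apply: nice_integrable => //; last by apply: ev_bounded; exact: nA.2.
by apply: measurable_funS (ev_measurable p).
Qed.

Definition Iint A p := integral_on A (ev p).

Lemma Iint_linear A : nice A ->
  forall a p q, Iint A (a *: p + q) = a * Iint A p + Iint A q.
Proof.
move=> nA a p q; rewrite /Iint /integral_on.
under eq_Rintegral do rewrite evD evZ.
have [mA _] := nA.
have ip := ev_integrable p nA; have iq := ev_integrable q nA.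
rewrite RintegralD//; first by rewrite RintegralZl.
rewrite (_ : EFin \o _ = EFin \o (ev (a *: p) \o vec)); first exact: ev_integrable.
by apply/funext => t /=; rewrite evZ.
Qed.

Lemma Iint_sqr_ge0 A p : 0 <= Iint A (p * p).
Proof. by apply: Rintegral_ge0 => t _; rewrite evM -expr2 sqr_ge0. Qed.

(** If [p] were nonzero at a point of the ball, by continuity [|p|] would exceed half that value on
    a small cube inside [A], and the cube has positive measure. *)
Lemma Iint_sqr_eq0 A p c r : nice A -> 0 < r -> ball c r `<=` A ->
  Iint A (p * p) = 0 -> p = 0.
Proof.
move=> nA r0 cA I0; apply: (ev_eq0_ball r0 (x := c)) => x xc.
apply: contrapT => /eqP px0.
have [mA _] := nA.
have hnear : \forall y \near x, `|ev p x| / 2 <= `|ev p y| /\ A y.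
  apply: filterI.
    have /cvgrPdist_le /(_ (`|ev p x| / 2)) h := @ev_continuous R n p x.
    have e0 : 0 < `|ev p x| / 2 by rewrite divr_gt0 ?normr_gt0.
    have := h e0; apply: filterS => y hy.
    have := lerB_normD (ev p x - ev p y) (ev p y).
    have := ler_normD (ev p x - ev p y) (ev p y); rewrite subrK.
    by move: hy e0; set u := `|_ - _|; set w := `|ev p x|; lra.
  apply: (@filterS _ _ _ (ball c r)) => //.
  by apply: open_nbhs_nbhs; split => //; exact: ball_open.
have /nbhs_ballP[s /= s0 hs] := hnear.
have s20 : 0 < s / 2 by rewrite divr_gt0.
have [mC lC] := lebesgue_cube x (ltW s20).
set C := vec @^-1` cube x (s / 2) in mC lC.
have hC t : C t -> `|ev p x| / 2 <= `|ev p (vec t)| /\ A (vec t).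
  move=> Ct; apply: hs; apply/ballrV; split => // i; rewrite distrC.
  by rewrite (le_lt_trans (Ct i))// ltr_pdivrMr// mulr_natr mulr2n ltrDl.
pose e := (`|ev p x| / 2) ^+ 2.
have e0 : 0 < e by rewrite exprn_gt0// divr_gt0// normr_gt0.
have : (e%:E * lebesgue n C <= \int[lebesgue n]_(t in vec @^-1` A) (ev (p * p) (vec t))%:E)%E.
  rewrite -integral_cst//.
  apply: (@le_trans _ _ (\int[lebesgue n]_(t in C) (ev (p * p) (vec t))%:E)%E).
    apply: ge0_le_integral => //.
    - by move=> t _; rewrite lee_fin ltW.
    - by apply/measurable_EFinP; apply: measurable_funS (ev_measurable (p * p)).
    - move=> t Ct; rewrite lee_fin evM -expr2 -[X in _ <= X]real_normK ?num_real//.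
      by rewrite lerXn2r ?nnegrE ?normr_ge0 ?divr_ge0//; have [] := hC t Ct.
  apply: ge0_subset_integral => //.
  - by apply/measurable_EFinP; apply: measurable_funS (ev_measurable (p * p)).
  - by move=> t _; rewrite lee_fin evM -expr2 sqr_ge0.
  - by move=> t /hC[].
have -> : (\int[lebesgue n]_(t in vec @^-1` A) (ev (p * p) (vec t))%:E)%E = (Iint A (p * p))%:E.
  rewrite /Iint /integral_on /Rintegral fineK//.
  by apply: integrable_fin_num => //; exact: (ev_integrable (p * p)).
rewrite I0 lC -EFinM lee_fin leNgt mulr_gt0// exprn_gt0//.
by rewrite mulr2n addr_gt0.
Qed.

End Nice.

Section Affine.
Context {R : realType} {n : nat}.
Local Notation mp := (mpoly.mpoly n R).
Implicit Types (A : set 'rV[R]_n) (h x y : 'rV[R]_n).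

Lemma dotpE h x : dotp h x = \sum_j h 0 j * x 0 j.
Proof. by rewrite /dotp big_ord1. Qed.

Lemma dotp0 m l (A : 'M[R]_(m, l)) : dotp A 0 = 0.
Proof. by rewrite /dotp big1// => i _; rewrite big1// => j _; rewrite mxE mulr0. Qed.

Lemma dotpDr h x y : dotp h (x + y) = dotp h x + dotp h y.
Proof. by rewrite !dotpE -big_split; apply: eq_bigr => j _; rewrite mxE mulrDr. Qed.
Lemma dotpNr h x : dotp h (- x) = - dotp h x.
Proof. by rewrite !dotpE -sumrN; apply: eq_bigr => j _; rewrite mxE mulrN. Qed.
Lemma dotpBr h x y : dotp h (x - y) = dotp h x - dotp h y.
Proof. by rewrite dotpDr dotpNr. Qed.
Lemma dotpZr h a x : dotp h (a *: x) = a * dotp h x.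
Proof. by rewrite !dotpE mulr_sumr; apply: eq_bigr => j _; rewrite mxE mulrCA. Qed.
Lemma dotpC h x : dotp h x = dotp x h.
Proof. by rewrite !dotpE; apply: eq_bigr => j _; rewrite mulrC. Qed.
Lemma dotp_ge0 h : 0 <= dotp h h.
Proof. by rewrite dotpE sumr_ge0// => j _; rewrite -expr2 sqr_ge0. Qed.
Lemma dotp_eq0 h : dotp h h = 0 -> h = 0.
Proof.
rewrite dotpE => /eqP; rewrite psumr_eq0 => [/allP h0|j _]; last by rewrite -expr2 sqr_ge0.
by apply/rowP => j; have := h0 j (mem_index_enum _); rewrite mxE mulf_eq0 orbb => /eqP.
Qed.

(** An affine function as a polynomial: continuity, measurability and the existence of points off
    finitely many hyperplanes then follow from the facts on polynomials. *)
Definition affp h (b : R) : mp :=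
  \sum_j h 0 j *: mpoly.mpolyX R (mpoly.mnm1 j) - mpoly.mpolyC n b.

Lemma ev_affp h b x : ev (affp h b) x = dotp h x - b.
Proof.
rewrite evB evC ev_sum dotpE; congr (_ - _); apply: eq_bigr => j _.
by rewrite evZ evX.
Qed.

Lemma affp_neq0 h b : h != 0 -> affp h b != 0.
Proof.
apply: contra_neq => h0; apply: dotp_eq0.
have hx x : dotp h x = b.
  by apply/eqP; rewrite -subr_eq0 -ev_affp h0 ev0.
rewrite hx -(hx 0) dotpE big1// => i _.
by rewrite mxE mulr0.
Qed.

Lemma dotp_continuous h : continuous (dotp h : 'rV[R]_n -> R).
Proof.
rewrite (_ : dotp h = ev (affp h 0)); first exact: ev_continuous.
by apply/funext => x; rewrite ev_affp subr0.
Qed.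

Lemma dotp_measurable h : measurable_fun setT (dotp h \o (@vec R n)).
Proof.
rewrite (_ : dotp h = ev (affp h 0)); first exact: ev_measurable.
by apply/funext => x; rewrite ev_affp subr0.
Qed.

Lemma le_enorm x i : `|x 0 i| <= enorm x.
Proof.
rewrite -sqrtr_sqr ler_sqrt ?dotp_ge0// dotpE (bigD1 i)//= -expr2 lerDl.
by apply: sumr_ge0 => j _; rewrite -expr2 sqr_ge0.
Qed.

Lemma convex_polytope_nice A : convex_polytope A -> nice A.
Proof.
move=> [[M hM] [hs hA]]; split; last first.
  by exists M => x /hM xM i; exact: le_trans (le_enorm x i) xM.
rewrite hA; elim: hs {hA} => [|h hs IH].
  by rewrite (_ : _ @^-1` _ = setT)//; apply/seteqP; split.
rewrite (_ : _ @^-1` _ = (vec @^-1` [set x | forall h0 : 'rV[R]_n * R, h0 \in hs -> dotp h0.1 x <= h0.2])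
    `&` ([set t | dotp h.1 (vec t) <= h.2])).
  apply: measurableI => //.
  rewrite -[X in measurable X]setTI.
  by apply: measurable_fun_le => //; exact: dotp_measurable.
apply/seteqP; split => t /=.
  move=> ht; split; last by apply: ht; rewrite mem_head.
  by move=> h' hh'; apply: ht; rewrite in_cons hh' orbT.
by move=> [ht hh] h'; rewrite in_cons => /orP[/eqP->//|/ht].
Qed.

Lemma nice_bigcup (I : finType) (P : pred I) (B : I -> set 'rV[R]_n) :
  (forall i, P i -> nice (B i)) -> nice (\bigcup_(i in [set i | P i]) B i).
Proof.
move=> hB; split.
  rewrite preimage_bigcup; apply: fin_bigcup_measurable; first exact: finite_finset.
  by move=> i Pi; exact: (hB i Pi).1.
have [r hr] : exists r : I -> R, forall i, P i -> forall x, B i x -> forall k, `|x 0 k| <= r i.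
  have /choice[r hr] : forall i, exists r, P i -> forall x, B i x -> forall k, `|x 0 k| <= r.
    move=> i; case: (boolP (P i)) => Pi; last by exists 0.
    by have [_ [r hr]] := hB i Pi; exists r.
  by exists r.
exists (\big[Num.max/0]_i r i) => x [i /= Pi Bix] k.
by rewrite (le_trans (hr i Pi x Bix k))//; exact: le_bigmax.
Qed.

Lemma polytopal_nice A : polytopal A -> nice A.
Proof.
move=> [N [P [hP ->]]].
rewrite (_ : \bigcup_i P i = \bigcup_(i in [set i | xpredT i]) P i).
  by apply: nice_bigcup => i _; exact: convex_polytope_nice.
by apply/seteqP; split => x [i _ h]; exists i.
Qed.

End Affine.

Lemma sum_lift (R : nmodType) n (j : 'I_n.+1) (F : 'I_n.+1 -> R) :
  \sum_i F i = F j + \sum_i F (lift j i).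
Proof. exact: bigD1_ord. Qed.

Section Hyperplane.
Context {R : realType}.
Local Notation X := (measurableTypeR R).

Lemma dotp_rins n (h : 'rV[R]_n.+1) j t y :
  dotp h (rins j t y) = h 0 j * t + \sum_i h 0 (lift j i) * y 0 i.
Proof.
rewrite dotpE (sum_lift j) rinsE; congr (_ + _).
by apply: eq_bigr => i _; rewrite rins_lift.
Qed.

(** Along an axis [j] with [h 0 j] nonzero, every line meets the hyperplane in the single point [s];
    Tonelli then integrates zeros. *)
Lemma hyperplane_null n (h : 'rV[R]_n) (b : R) : h != 0 ->
  measurable (vec @^-1` [set x | dotp h x = b]) /\
  lebesgue n (vec @^-1` [set x | dotp h x = b]) = 0%E.
Proof.
case: n h => [|n] h h0; first by case/eqP: h0; apply/rowP => -[].
set A := vec @^-1` _.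
have mA : measurable A.
  rewrite (_ : A = (dotp h \o vec) @^-1` [set b]); last by [].
  rewrite -[X in measurable X]setTI; apply: dotp_measurable => //; exact: measurable_set1.
split => //.
have [j hj] : exists j, h 0 j != 0.
  apply/existsP; apply: contra_neqT h0; rewrite negb_exists => /forallP h0.
  by apply/rowP => j; rewrite mxE; apply/eqP; have := h0 j; rewrite negbK.
transitivity (\int[lebesgue n.+1]_(x in setT) (\1_A x)%:E)%E.
  by rewrite integral_indic ?setIT.
rewrite [LHS](tonelli_ins j).
- rewrite -[RHS](@integral0 _ _ _ (lebesgue n) setT); apply: eq_integral => y _ /=.
pose s := (b - \sum_i h 0 (lift j i) * vec y 0 i) / h 0 j.
rewrite (_ : (fun t => _) = fun t : X => (\1_([set s] : set X) t)%:E).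
  by rewrite integral_indic ?setIT//; exact: lebesgue_measure_set1.
apply/funext => t; congr EFin; rewrite /indic.
congr (nat_of_bool _)%:R; apply/idP/idP; rewrite !inE /A /= vec_tins dotp_rins.
  by move=> hb; rewrite /s -hb addrK mulrAC divff// mul1r.
by move=> ->; rewrite /s mulrCA divff// mulr1 subrK.
- by apply/measurable_EFinP; exact: measurable_indic.
- by move=> t; rewrite lee_fin.
Qed.

End Hyperplane.

(** * Flat faces *)

Section Face.
Context {R : realType} {n : nat} (e : set 'rV[R]_n.+1).
Local Notation X := (measurableTypeR R).
Hypothesis he : flat_face e.
Local Notation N := (face_normal e).
Implicit Types (x v : 'rV[R]_n.+1) (p q : mpoly.mpoly n.+1 R).

Lemma face_normalP : unit_normal e N.
Proof. by case: he => -[m hm] _ _ _ _; apply: (@xgetPex _ 0 [set m | unit_normal e m]); exists m. Qed.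

Definition face_level := dotp N (xget 0 e).

Lemma on_face x : e x -> dotp N x = face_level.
Proof.
move=> ex; have [_ /(_ x (xget 0 e))] := face_normalP.
move/(_ ex (xgetPex 0 (ex_intro _ x ex)))/eqP.
by rewrite dotpBr subr_eq0 => /eqP.
Qed.

Lemma small_move v (r : R) : 0 < r -> exists2 s : R, 0 < s & forall t, `|t| <= s -> forall x, ball x r (x + t *: v).
Proof.
move=> r0; pose B := \big[Num.max/0]_i `|v 0 i|.
have B0 : 0 <= B by exact: bigmax_ge_id.
(* The added 1 covers [v = 0] and makes the last inequality strict. *)
exists (r / (B + 1)); first by rewrite divr_gt0// ltr_wpDl.
move=> t ht x; apply/ballrV; split => // i.
rewrite !mxE opprD addNKr normrN normrM.
have vB : `|v 0 i| <= B by exact: le_bigmax.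
apply: (@le_lt_trans _ _ (r / (B + 1) * B)).
  by rewrite ler_pM.
by rewrite mulrAC ltr_pdivrMr ?ltr_wpDl// ltr_pM2l// ltrDl.
Qed.

(** From a relative interior point, a small move in any direction orthogonal to [N] stays in the
    face. So [m] is orthogonal to all these directions, hence a multiple of [N], of length 1. *)
Lemma unit_normal_unique m : unit_normal e m -> m = N \/ m = - N.
Proof.
move=> [m1 hm]; have [N1 _] := face_normalP.
case: he => _ _ [x0 [ex0 [r r0 hr]]] _ _.
have tang v : dotp N v = 0 -> dotp m v = 0.
  move=> Nv; have [s s0 hs] := small_move v r0.
  have := hm (x0 + s *: v) x0; rewrite addrAC subrr add0r dotpZr.
  have es : e (x0 + s *: v).
    apply: hr; first by apply: hs; rewrite gtr0_norm.
    by rewrite addrAC subrr add0r dotpZr Nv mulr0.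
  by move=> /(_ es ex0)/eqP; rewrite mulf_eq0 gt_eqF//= => /eqP.
pose a := dotp N m; pose v := m - a *: N.
have Nv : dotp N v = 0 by rewrite dotpBr dotpZr N1 mulr1 subrr.
have mv := tang _ Nv.
have : dotp v v = 0.
  by rewrite {1}/v dotpC dotpBr dotpZr dotpC mv dotpC Nv mulr0 subrr.
move/dotp_eq0/eqP; rewrite subr_eq0 => /eqP ma.
move: mv; rewrite dotpBr dotpZr m1 dotpC -/a => /eqP; rewrite subr_eq0 -expr2 eq_sym sqrf_eq1.
by move=> /orP[] /eqP a1; [left|right]; rewrite ma a1 ?scale1r ?scaleN1r.
Qed.

Definition lift_ht (j : 'I_n.+1) (y : 'rV[R]_n) : R :=
  (face_level - \sum_i N 0 (lift j i) * y 0 i) / N 0 j.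

Lemma face_liftE j (y : 'rV[R]_n) : face_lift e j y = rins j (lift_ht j y) y.
Proof. by []. Qed.

Lemma dotp_face_lift j (y : 'rV[R]_n) : N 0 j != 0 -> dotp N (face_lift e j y) = face_level.
Proof.
by move=> Nj; rewrite face_liftE dotp_rins /lift_ht mulrCA divff// mulr1 subrK.
Qed.

Lemma lift_ht_unique j t (y : 'rV[R]_n) : N 0 j != 0 -> dotp N (rins j t y) = face_level -> t = lift_ht j y.
Proof.
by move=> Nj; rewrite dotp_rins /lift_ht => <-; rewrite addrK mulrAC divff// mul1r.
Qed.

(** Substitution of the parametrization [face_lift]. The missing coordinate is affine in the others,
    so the result is again a polynomial and face integrals reduce to [Iint]. *)
Definition pull (j : 'I_n.+1) (p : mpoly.mpoly n.+1 R) : mpoly.mpoly n R :=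
  mpoly.mmap (mpoly.mpolyC n (R := R))
   (fun i => if unlift j i is Some i' then mpoly.mpolyX R (mpoly.mnm1 i')
     else - (N 0 j)^-1 *: affp (\row_i' N 0 (lift j i')) face_level) p.

Lemma ev_pull j p (y : 'rV[R]_n) : ev (pull j p) y = ev p (face_lift e j y).
Proof.
elim/(@mp_ring_ind R n.+1) : p => [c|i|p q hp hq|p q hp hq].
- by rewrite /pull mpoly.mmapC !evC.
- rewrite /pull mpoly.mmapX mpoly.mmap1U evX mxE.
  case: unliftP => [i' _|_]; first by rewrite evX.
  rewrite evZ ev_affp mulNr -mulrN opprB mulrC; congr ((_ - _) * _).
  by rewrite dotpE; apply: eq_bigr => i' _; rewrite mxE.
- by rewrite evD -hp -hq -evD; congr ev; exact: mpoly.mmapD.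
- by rewrite evM -hp -hq -evM; congr ev; exact: (rmorphM (mpoly.mmap _ _)).
Qed.

Lemma pull_linear j a p q : pull j (a *: p + q) = a *: pull j p + pull j q.
Proof. by rewrite /pull mpoly.mmapD mpoly.mmapZ mpoly.mul_mpolyC. Qed.

Lemma pullM j p q : pull j (p * q) = pull j p * pull j q.
Proof. exact: (rmorphM (mpoly.mmap _ _)). Qed.

(** When [N 0 j] is nonzero, this is the projection of [e] along the axis [j]. *)
Definition shadow j := face_lift e j @^-1` e.

Lemma face_lift_measurable j :
  exists2 h : n.-tuple X -> n.+1.-tuple X, measurable_fun setT h &
    forall t, vec (h t) = face_lift e j (vec t).
Proof.
exists (fun t => tins j (lift_ht j (vec t)) t); last by move=> t; rewrite vec_tins.
apply: measurable_tins => //.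
rewrite [f in measurable_fun _ f](_ : _ = ev (pull j (mpoly.mpolyX R (mpoly.mnm1 j))) \o vec).
  exact: ev_measurable.
by apply/funext => t /=; rewrite ev_pull evX face_liftE rinsE.
Qed.

Lemma face_nice : nice e.
Proof. by case: he => _ + _ _ _ => /polytopal_nice. Qed.

Lemma shadow_nice j : nice (shadow j).
Proof.
have [h mh hE] := face_lift_measurable j.
have [me [r hr]] := face_nice; split.
  rewrite (_ : vec @^-1` shadow j = h @^-1` (vec @^-1` e)).
    by rewrite -[X in measurable X]setTI; exact: mh.
  by apply/seteqP; split => t; rewrite /= hE.
by exists r => y /hr hy i; have := hy (lift j i); rewrite face_liftE rins_lift.
Qed.

Lemma rins_coords j x : x = rins j (x 0 j) (\row_i x 0 (lift j i)).
Proof.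
by apply/rowP => i; rewrite mxE; case: unliftP => [i'|] ->; rewrite ?mxE.
Qed.

Lemma face_lift_proj j x : N 0 j != 0 -> e x -> face_lift e j (\row_i x 0 (lift j i)) = x.
Proof.
move=> Nj ex; rewrite face_liftE [RHS](rins_coords j); congr rins; apply/esym.
by apply: lift_ht_unique => //; rewrite -rins_coords on_face.
Qed.

Lemma face_lift_near j (y0 : 'rV[R]_n) (r : R) : 0 < r ->
  exists2 s : R, 0 < s & forall y, ball y0 s y -> ball (face_lift e j y0) r (face_lift e j y).
Proof.
move=> r0.
have hi i : \forall y \near y0, `|face_lift e j y0 0 i - face_lift e j y 0 i| < r.
  have h := @ev_continuous R n (pull j (mpoly.mpolyX R (mpoly.mnm1 i))) y0.
  move/cvgrPdist_lt : h => /(_ r r0); apply: filterS => y.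
  by rewrite !ev_pull !evX.
have : \forall y \near y0, forall i, `|face_lift e j y0 0 i - face_lift e j y 0 i| < r.
  exact: filter_forall hi.
move=> /nbhs_ballP[s /= s0 hs]; exists s => // y /hs hy; apply/ballrV; split => //; exact: hy.
Qed.

Lemma shadow_ball j x : N 0 j != 0 -> relint e x ->
  exists2 s : R, 0 < s & ball (\row_i x 0 (lift j i)) s `<=` shadow j.
Proof.
move=> Nj [ex [r r0 hr]].
have [s s0 hs] := face_lift_near j (\row_i x 0 (lift j i)) r0.
exists s => // y /hs; rewrite face_lift_proj// => hy; apply: hr => //.
by rewrite dotpBr dotp_face_lift// on_face// subrr.
Qed.

Lemma face_normal_neq0 : exists j, N 0 j != 0.
Proof.
apply/existsP; have [N1 _] := face_normalP.
apply: contraT; rewrite negb_exists => /forallP h0.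
have N0 : N = 0 by apply/rowP => j; rewrite mxE; apply/eqP; have := h0 j; rewrite negbK.
by move: N1; rewrite N0 dotpE big1 => [/eqP|j _]; rewrite ?mxE ?mul0r// eq_sym oner_eq0.
Qed.

Definition Jint (p : mpoly.mpoly n.+1 R) : R := face_integral e (ev p).

(** The surface integral computed by projection along an axis [j] of free choice. *)
Definition Jint_at j p : R := `|N 0 j|^-1 * Iint (shadow j) (pull j p).

Lemma JintE : exists2 j, N 0 j != 0 & forall p, Jint p = Jint_at j p.
Proof.
rewrite /Jint /face_integral /face_coord; case: pickP => [j Nj|h].
  exists j => // p; congr (_ * _); rewrite /Iint /integral_on; apply: eq_Rintegral => t _ /=.
  by rewrite ev_pull.
by have [j] := face_normal_neq0; rewrite h.
Qed.

Lemma Jint_at_linear j a p q : Jint_at j (a *: p + q) = a * Jint_at j p + Jint_at j q.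
Proof.
by rewrite /Jint_at pull_linear Iint_linear ?mulrDr 1?mulrCA//; exact: shadow_nice.
Qed.

Lemma Jint_linear a p q : Jint (a *: p + q) = a * Jint p + Jint q.
Proof. by have [j _ h] := JintE; rewrite !h Jint_at_linear. Qed.

Lemma Jint_sqr_ge0 p : 0 <= Jint (p * p).
Proof. by have [j _ ->] := JintE; rewrite /Jint_at pullM mulr_ge0 ?Iint_sqr_ge0. Qed.

(** A relative interior point of the face gives a ball in the shadow, so the pulled back polynomial
    is zero, and every point of the face is the lift of its projection. *)
Lemma Jint_sqr_eq0 p : Jint (p * p) = 0 -> forall x, e x -> ev p x = 0.
Proof.
have [j Nj ->] := JintE; rewrite /Jint_at pullM => /eqP.
rewrite mulf_eq0 invr_eq0 normr_eq0 (negbTE Nj)/= => /eqP I0 x ex.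
case: he => _ _ [x0 x0e] _ _.
have [s s0 hs] := shadow_ball Nj x0e.
have p0 := Iint_sqr_eq0 (shadow_nice j) s0 hs I0.
by rewrite -(face_lift_proj Nj ex) -ev_pull p0 ev0.
Qed.

Lemma eq_Jint p q : (forall x, e x -> ev p x = ev q x) -> Jint p = Jint q.
Proof.
move=> h; rewrite /Jint /face_integral; case: face_coord => // j.
congr (_ * _); rewrite /integral_on; apply: eq_Rintegral => t; rewrite inE => ht.
exact: h.
Qed.

End Face.

(** * The surface integral does not depend on the axis of projection *)

Section CoordinateIndependence.
Context {R : realType}.
Local Notation X := (measurableTypeR R).

(** Two indices [j] and [j0] are deleted in either order: [a] is the position of [j0] once [j] is
    gone, and [b] that of [j] once [j0] is gone. *)
Lemma lift_lift n (j j0 : 'I_n.+2) (a b : 'I_n.+1) (k : 'I_n) :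
  j0 = lift j a -> j = lift j0 b -> lift j (lift a k) = lift j0 (lift b k).
Proof.
move=> /(congr1 val) /= h1 /(congr1 val) /= h2; apply: val_inj => /=.
by move: h1 h2; rewrite /bump; lia.
Qed.

Lemma rins_rins n (j j0 : 'I_n.+2) (a b : 'I_n.+1) (u s : R) (z : 'rV[R]_n) :
  j0 = lift j a -> j = lift j0 b -> rins j u (rins a s z) = rins j0 s (rins b u z).
Proof.
move=> hj0 hj; apply/rowP => i; case: (unliftP j i) => [i'|] ->; last first.
  by rewrite rinsE hj rins_lift rinsE.
rewrite rins_lift; case: (unliftP a i') => [k|] ->; last first.
  by rewrite rinsE -hj0 rinsE.
by rewrite rins_lift (lift_lift k hj0 hj) !rins_lift.
Qed.

Lemma Iint_mkcond n (A : set 'rV[R]_n) p :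
  Iint A p = fine (\int[lebesgue n]_t (if vec t \in A then (ev p (vec t))%:E else 0))%E.
Proof. by rewrite /Iint /integral_on /Rintegral integral_mkcond. Qed.

(* Squares are nonnegative, so that Tonelli suffices to exchange coordinates. *)
Lemma Jint_at_sqr n (e : set 'rV[R]_n.+1) (he : flat_face e) j j0 q :
  face_normal e 0 j != 0 -> face_normal e 0 j0 != 0 ->
  Jint_at e j (q * q) = Jint_at e j0 (q * q).
Proof.
move=> Nj Nj0; have [->//|jj0] := eqVneq j0 j.
case: n e he j j0 q Nj Nj0 jj0 => [|m] e he j j0 q Nj Nj0 jj0.
  by case/eqP: jj0; rewrite (ord1 j) (ord1 j0).
set N := face_normal e in Nj Nj0 *.
have [a hj0] : exists a, j0 = lift j a by case: (unliftP j j0) jj0 => [a|->]; [exists a|rewrite eqxx].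
have [b hj] : exists b, j = lift j0 b.
  by case: (unliftP j0 j) jj0 => [b|->]; [exists b|rewrite eqxx].
pose G (x : 'rV[R]_m.+2) : \bar R := if x \in e then (ev (q * q) x)%:E else 0%E.
have G0 x : (0 <= G x)%E by rewrite /G; case: ifP => // _; rewrite lee_fin evM -expr2 sqr_ge0.
pose F i (t : m.+1.-tuple X) := G (face_lift e i (vec t)).
have mF i : measurable_fun setT (F i).
  have [mS _] := shadow_nice he i.
  rewrite (_ : F i = fun t => if t \in vec @^-1` shadow e i then (ev (pull e i (q * q)) (vec t))%:E else 0%E).
    apply: (measurable_restrictT _ mS).1.
    apply/measurable_EFinP; apply: measurable_funS (ev_measurable _) => //.
  by apply/funext => t; rewrite /F /G ev_pull //; congr (if _ then _ else _); apply/idP/idP; rewrite !inE.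
have IF i : Iint (shadow e i) (pull e i (q * q)) = fine (\int[lebesgue m.+1]_t F i t)%E.
  rewrite Iint_mkcond; congr fine; apply: eq_integral => t _; rewrite /F /G ev_pull.
  by congr (if _ then _ else _); apply/idP/idP; rewrite !inE.
rewrite /Jint_at !IF.
(* The factor is the Jacobian between the two projections of the face. *)
suff -> : (\int[lebesgue m.+1]_t F j0 t = `|N 0 j0 / N 0 j|%:E * \int[lebesgue m.+1]_t F j t)%E.
  have : (0 <= \int[lebesgue m.+1]_t F j t)%E.
    by apply: integral_ge0 => t _; exact: G0.
  rewrite normrM normfV.
  case: (\int[lebesgue m.+1]_t F j t)%E => [r _|_|//] /=.
    by field; rewrite !normr_eq0 Nj Nj0.
  (* [fine] sends [+oo] to 0 on both sides, so finiteness need not be known here. *)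
  by rewrite mulry gtr0_sg ?mul1e ?mulr0// divr_gt0// normr_gt0.
have [mFj mFj0] := (mF j, mF j0).
rewrite (tonelli_ins b mFj0) ?(tonelli_ins a mFj)//; [|by move=> t; exact: G0..].
rewrite -ge0_integralZl//; last 2 first.
- by apply: measurable_integral_tins => // t; exact: G0.
- by move=> t _; apply: integral_ge0 => s _; exact: G0.
apply: eq_integral => z _.
(* With the other coordinates fixed at [z], the equation of the hyperplane gives coordinate [j] as
   an affine function of coordinate [j0], of slope [- N j0 / N j] and intercept [c]. *)
pose c := (face_level e - \sum_i N 0 (lift j (lift a i)) * vec z 0 i) / N 0 j.
rewrite (@affine_integral _ (- (N 0 j0 / N 0 j)) c) ?normrN.
- congr (_ * _)%E; apply: eq_integral => s _.
  rewrite /F !vec_tins !face_liftE; congr G.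
  have E : lift_ht e j (rins a s (vec z)) = - (N 0 j0 / N 0 j) * s + c.
    rewrite /lift_ht (sum_lift a) rinsE -hj0 /c.
    rewrite (eq_bigr (fun i => N 0 (lift j (lift a i)) * vec z 0 i)); last first.
      by move=> i _; rewrite rins_lift.
    by field.
  rewrite -E [RHS](rins_rins _ _ _ hj0 hj); congr rins; apply/esym.
  apply: (lift_ht_unique Nj0); rewrite -(rins_rins _ _ _ hj0 hj).
  exact: (dotp_face_lift (e := e) _ Nj).
- by rewrite oppr_eq0 mulf_neq0 ?invr_eq0.
- by apply: (measurableT_comp mFj0); apply: measurable_tins.
- by move=> x; exact: G0.
Qed.

(** Polarization: [2 p] is the square of [p + 1] minus the squares of [p] and of 1, and on squares
    the projections agree. *)
Lemma Jint_coord n (e : set 'rV[R]_n.+1) (he : flat_face e) j p :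
  face_normal e 0 j != 0 -> Jint e p = Jint_at e j p.
Proof.
move=> Nj; have [j0 Nj0 ->] := JintE he.
have E : p = 2^-1 *: ((p + 1) * (p + 1) - p * p - 1 * 1).
  rewrite (_ : _ - _ - _ = 2 *: p); last by rewrite scaler_nat; ring.
  by rewrite scalerA mulVf ?scale1r// pnatr_eq0.
have hL i := Jint_at_linear he i.
by rewrite E !(sclZ (hL _)) !(sclB (hL _)) !(Jint_at_sqr he _ Nj0 Nj).
Qed.

End CoordinateIndependence.

(** * Divergence theorem *)

Section Slice.
Context {R : realType}.
Local Notation mu := (@lebesgue_measure R).
Implicit Types (l s t B : R).

(* With s the component of the outward normal along the line, the conventions at
   t = l are those for which minus the sum of the steps is the indicator of the
   open element everywhere on the line, also on its faces. *)
Definition step s l t : R := if 0 < s then (l <= t)%R%:R else - (l < t)%R%:R.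

Section FTC.
Variables (psi dpsi : R -> R) (B : R).
Hypothesis hpsi : forall t, is_derive t 1 psi (dpsi t).
Hypothesis cdpsi : continuous dpsi.

Lemma dpsi_integrable a b : mu.-integrable `[a, b] (EFin \o dpsi).
Proof.
apply: continuous_compact_integrable; first exact: segment_compact.
exact: continuous_subspaceT.
Qed.

Lemma dpsi_ftc a b : a < b -> (\int[mu]_(t in `[a, b]) (dpsi t)%:E = (psi b - psi a)%:E)%E.
Proof.
move=> ab; rewrite (@continuous_FTC2 _ dpsi psi) //.
- exact: continuous_subspaceT.
- split.
  + by move=> x _; exact: (@ex_derive _ _ _ _ _ _ _ (hpsi x)).
  + apply: cvg_at_right_filter; apply: differentiable_continuous.
    by apply/derivable1_diffP; exact: (@ex_derive _ _ _ _ _ _ _ (hpsi a)).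
  + apply: cvg_at_left_filter; apply: differentiable_continuous.
    by apply/derivable1_diffP; exact: (@ex_derive _ _ _ _ _ _ _ (hpsi b)).
- by move=> x _; rewrite derive1E; exact: (@derive_val _ _ _ _ _ _ _ (hpsi x)).
Qed.

(** Whichever convention holds at [l], the step is active from [l] to [B], up to a single point. *)
Lemma step_ftc s l : - B < l -> l < B ->
  mu.-integrable `[- B, B] (fun t => (step s l t * dpsi t)%:E) /\
  (\int[mu]_(t in `[(- B)%R, B]) (step s l t * dpsi t)%:E =
   ((if 0 < s then 1 else -1) * (psi B - psi l))%:E)%E.
Proof.
move=> Bl lB.
have iB := dpsi_integrable (- B) B.
rewrite /step; case: ifP => s0.
  rewrite (_ : (fun t => (_%:R * _)%:E) = (EFin \o dpsi) \_ [set` `[l, +oo[ ]); last first.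
    apply/funext => t; rewrite patchE; rewrite [t \in _](_ : _ = (l <= t)); last first.
      by rewrite mem_setE in_itv /= andbT.
    by case: (l <= t); rewrite ?mul1r ?mul0r.
  have E : `[- B, B] `&` `[l, +oo[ = `[l, B]%classic.
    by apply/seteqP; split => t /=; rewrite !in_itv /= andbT; move: Bl lB; lra.
  split.
    by apply/integrable_restrict => //; rewrite E; exact: dpsi_integrable.
  by rewrite -integral_mkcondr E mul1r dpsi_ftc.
rewrite (_ : (fun t => (- _%:R * _)%:E) = (EFin \o (fun t => -1 * dpsi t)) \_ [set` `]l, +oo[ ]); last first.
  apply/funext => t; rewrite patchE; rewrite [t \in _](_ : _ = (l < t)); last first.
    by rewrite mem_setE in_itv /= andbT.
  by case: (l < t) => /=; [rewrite mulr1n|rewrite mulr0n oppr0 mul0r].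
have E : `[- B, B] `&` `]l, +oo[ = `]l, B]%classic.
  by apply/seteqP; split => t /=; rewrite !in_itv /= andbT; move: Bl lB; lra.
have il : mu.-integrable `]l, B] (EFin \o dpsi).
  apply: integrableS (dpsi_integrable l B) => //.
  by move=> t /=; rewrite !in_itv /=; lra.
split.
  apply/integrable_restrict => //; rewrite E.
  rewrite (_ : _ \o _ = (fun t => (-1)%:E * (EFin \o dpsi) t)%E); first exact: integrableZl.
  by apply/funext => t.
rewrite -integral_mkcondr E.
transitivity ((-1)%:E * \int[mu]_(t in `]l, B]) (dpsi t)%:E)%E.
  by rewrite -integralZl.
rewrite integral_itv_obnd_cbnd ?dpsi_ftc//.
exact: measurable_int il.
Qed.

(** [S] is the trace of an element on a line and the [l i] are the crossings of its faces. Each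
    crossing contributes a signed [psi B - psi (l i)]; the signs sum to 0, so the terms in [psi B]
    disappear. *)
Lemma slice_ftc (S : set R) (I : finType) (K : pred I) (s l : I -> R) :
  (forall t, S t -> - B <= t <= B) -> (forall i, K i -> - B < l i < B) ->
  0 <= B -> ~ S B ->
  (forall t, - B <= t <= B -> (t \in S)%:R = - \sum_(i | K i) step (s i) (l i) t) ->
  (\int[mu]_t (if t \in S then (dpsi t)%:E else 0) =
   (\sum_(i | K i) (if 0 < s i then 1 else -1) * psi (l i))%R%:E)%E.
Proof.
move=> SB lB B0 nSB hS.
pose c i : R := if 0 < s i then 1 else -1.
pose g i t : \bar R := (if K i then (-1)%:E * (step (s i) (l i) t * dpsi t)%R%:E else 0)%E.
have sumg t : (\sum_i g i t = ((- \sum_(i | K i) step (s i) (l i) t) * dpsi t)%:E)%E.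
  rewrite -mulN1r -mulrA mulr_suml mulr_sumr -sumEFin [in RHS]big_mkcond.
  by apply: eq_bigr => i _; rewrite /g; case: ifP.
have [ig Ig] : (forall i, mu.-integrable `[- B, B] (g i)) /\
  (forall i, (\int[mu]_(t in `[(- B)%R, B]) g i t =
    (if K i then - (c i * (psi B - psi (l i))) else 0)%:E)%E).
  split=> i; rewrite /g; case Ki: (K i).
  - have /andP[h1 h2] := lB i Ki; have [h _] := step_ftc (s i) h1 h2.
    exact: integrableZl.
  - exact: integrable0.
  - have /andP[h1 h2] := lB i Ki; have [h h'] := step_ftc (s i) h1 h2.
    by rewrite integralZl// h' -EFinM mulN1r.
  - exact: integral0.
transitivity (\int[mu]_(t in `[(- B)%R, B]) (\sum_i g i t))%E.
  rewrite [RHS]integral_mkcond; apply: eq_integral => t _; rewrite patchE.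
  case: ifPn => [tS|tS].
    have tB := SB t (set_mem tS).
    rewrite [t \in _](_ : _ = true); last by apply/mem_set; rewrite /= in_itv.
    by have := hS t tB; rewrite tS sumg => <-; rewrite mul1r.
  case: ifPn => // tB; have {}tB : - B <= t <= B by have := set_mem tB; rewrite /= in_itv.
  by have := hS t tB; rewrite (negbTE tS) sumg => <-; rewrite mul0r.
rewrite integral_sum//.
under eq_bigr do rewrite Ig.
rewrite sumEFin -big_mkcond /=; congr EFin.
(* At [B] all steps have jumped and the indicator is 0: the line leaves the element as often as it
   enters it. *)
have sc : \sum_(i | K i) c i = 0.
  have BB : - B <= B <= B by rewrite lexx ge0_cp.
  have := hS B BB; rewrite (_ : B \in S = false); last by apply/negbTE/negP => /set_mem.
  move/eqP; rewrite eq_sym oppr_eq0 => /eqP h; rewrite -[RHS]h; apply: eq_bigr => i Ki.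
  by rewrite /c /step; have /andP[_ lt] := lB i Ki; rewrite (ltW lt) lt; case: ifP.
rewrite (eq_bigr (fun i => c i * psi (l i) - c i * psi B)); last by move=> i _; rewrite mulrBr opprB.
by rewrite big_split /= sumrN -mulr_suml sc mul0r subr0.
Qed.

End FTC.
End Slice.

Lemma near_all_seq (T : topologicalType) (x : T) (I : eqType) (s : seq I) (Q : I -> T -> Prop) :
  (forall i, i \in s -> \forall y \near x, Q i y) ->
  \forall y \near x, forall i, i \in s -> Q i y.
Proof.
elim: s => [|i s IH] h; first by apply: nearW.
have h1 : \forall y \near x, Q i y by apply: h; rewrite mem_head.
have h2 : \forall y \near x, forall i, i \in s -> Q i y.
  by apply: IH => k ks; apply: h; rewrite in_cons ks orbT.
apply: filterS2 h1 h2 => y hi hs k; rewrite in_cons => /orP[/eqP->//|/hs].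
exact.
Qed.

(** * Lines in general position with respect to the faces *)

Section Edges.
Context {R : realType}.

Definition negl n (A : set 'rV[R]_n) := (lebesgue n).-negligible (vec @^-1` A).

Lemma negl_seq n (T : eqType) (s : seq T) (Q : T -> set 'rV[R]_n) :
  (forall h, h \in s -> negl (Q h)) -> negl [set y | exists2 h, h \in s & Q h y].
Proof.
elim: s => [|h s IH] hQ.
  by apply: negligibleS (negligible_set0 _) => t [].
have h1 : negl (Q h) by apply: hQ; rewrite mem_head.
have h2 := IH (fun k ks => hQ k (mem_behead (s := h :: s) ks)).
apply: negligibleS (negligibleU h1 h2) => t [k /=].
rewrite in_cons => /orP[/eqP->|ks] kt; [by left|by right; exists k].
Qed.

Lemma negl_hyperplane n (h : 'rV[R]_n) b : h != 0 -> negl [set x | dotp h x = b].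
Proof. by move=> /hyperplane_null-/(_ b)[mA A0]; apply/negligibleP. Qed.

(** [L] collects, among the inequalities defining the convex pieces of the face, those whose
    gradient is not a multiple of the normal. Where none of them is an equality, those of the piece
    containing [x] persist near [x]; the discarded ones are constant along the hyperplane of the
    face. *)
Lemma face_edges n (e : set 'rV[R]_n.+1) : flat_face e ->
  exists L : seq ('rV[R]_n.+1 * R),
    (forall h, h \in L -> forall a, h.1 <> a *: face_normal e) /\
    forall x, e x -> (forall h, h \in L -> dotp h.1 x <> h.2) -> relint e x.
Proof.
move=> he; have [_ [K [P [hP eP]]] _ _ _] := he.
have /choice[hs hsP] : forall k, exists hs : seq ('rV[R]_n.+1 * R),
    P k = [set x | forall h, h \in hs -> dotp h.1 x <= h.2].
  by move=> k; have [_] := hP k.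
pose par (h : 'rV[R]_n.+1 * R) : bool := `[< exists a, h.1 = a *: face_normal e >].
exists [seq h <- flatten [seq hs k | k <- enum 'I_K] | ~~ par h]; split.
  move=> h; rewrite mem_filter => /andP[/asboolPn nh _] a ha; apply: nh.
  by exists a.
move=> x ex hx; split => //.
have [k _ Pkx] : (\bigcup_i P i) x by rewrite -eP.
move: Pkx; rewrite hsP => /= Pkx.
have : \forall y \near x, forall h, h \in hs k -> ~~ par h -> dotp h.1 y < h.2.
  apply: near_all_seq => h hk; case: (boolP (par h)) => ph; first by apply/nbhs_ballP; exists 1 => //= y _; rewrite ?ph.
  have lt : dotp h.1 x < h.2.
    rewrite lt_neqAle Pkx// andbT; apply/eqP; apply: hx; rewrite mem_filter ph /=.
    by apply/flattenP; exists (hs k) => //; apply: map_f; rewrite mem_enum.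
  have c := @dotp_continuous R _ h.1 x.
  have /nbhs_ballP[r /= r0 hr] : \forall y \near x, dotp h.1 y < h.2 by exact: (c _ (lt_nbhsl lt)).
  by apply/nbhs_ballP; exists r => // y /hr.
move=> /nbhs_ballP[r /= r0 hr]; exists r => // y xy Ny.
rewrite eP; exists k => //; rewrite hsP => h hk.
case: (boolP (par h)) => ph; last by apply/ltW; exact: hr.
have [a ha] := asboolP _ ph.
have := Pkx h hk; apply: le_trans.
move: Ny; rewrite dotpBr => /eqP; rewrite subr_eq0 => /eqP Ny.
by rewrite ha ![dotp (_ *: _) _]dotpC !dotpZr ![dotp _ (face_normal e)]dotpC Ny.
Qed.

(** A face parallel to the axis is met only by lines contained in its hyperplane. On any other face,
    the lines to avoid pass through one of the finitely many hyperplanes of [face_edges]. Either way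
    the exceptional [y] lie on finitely many hyperplanes of one dimension less. *)
Lemma bad_lines n (e : set 'rV[R]_n.+1) j : flat_face e ->
  exists2 B : set 'rV[R]_n, negl B & forall y t, ~ B y -> e (rins j t y) ->
    relint e (rins j t y) /\ face_normal e 0 j != 0.
Proof.
move=> he; have [N1 _] := face_normalP he.
set N := face_normal e in N1 *.
have [Nj|Nj] := eqVneq (N 0 j) 0.
  exists [set y | dotp (\row_i N 0 (lift j i)) y = face_level e].
    apply: negl_hyperplane; apply/eqP => /rowP N0.
    have [i] := face_normal_neq0 he.
    case: (unliftP j i) => [i'|] ->; last by rewrite -/N Nj eqxx.
    by have := N0 i'; rewrite !mxE => ->; rewrite eqxx.
  move=> y t By ey; exfalso; apply: By => /=.
  rewrite -(on_face he ey) -/N dotp_rins Nj mul0r add0r dotpE.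
  by apply: eq_bigr => i _; rewrite mxE.
have [L [Lpar Lrel]] := face_edges he.
(* [h'] eliminates coordinate [j] between the hyperplane [h] and that of the face; it is nonzero
   because [h.1] is not a multiple of the normal. *)
pose h' (h : 'rV[R]_n.+1 * R) : 'rV[R]_n := \row_i (h.1 0 (lift j i) - h.1 0 j / N 0 j * N 0 (lift j i)).
exists [set y | exists2 h, h \in L & dotp (h' h) y = h.2 - h.1 0 j / N 0 j * face_level e].
  apply: (negl_seq (Q := fun h => [set y | dotp (h' h) y = h.2 - h.1 0 j / N 0 j * face_level e])).
  move=> h hL; apply: negl_hyperplane; apply/eqP => /rowP h0.
  apply: (Lpar h hL (h.1 0 j / N 0 j)); apply/rowP => i; rewrite mxE -/N.
  case: (unliftP j i) => [i'|] ->; last by rewrite divfK.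
  by have := h0 i'; rewrite !mxE => /eqP; rewrite subr_eq0 => /eqP.
move=> y t By ey; split => //; apply: Lrel => // h hL hx; apply: By; exists h => //.
rewrite -hx -(on_face he ey) -/N !dotp_rins dotpE.
rewrite (eq_bigr (fun i => h.1 0 (lift j i) * y 0 i - h.1 0 j / N 0 j * (N 0 (lift j i) * y 0 i))).
  by rewrite big_split /= sumrN -mulr_sumr; field.
by move=> i _; rewrite !mxE; ring.
Qed.

End Edges.

Lemma step_near (R : realType) (s l t0 : R) : l != t0 -> \forall t \near t0, step s l t = step s l t0.
Proof.
move=> lt0; have [h|h] : l < t0 \/ t0 < l by move: lt0; rewrite neq_lt => /orP.
  have hr : \forall t \near t0, l < t by exact: lt_nbhsr.
  by apply: filterS hr => t lt; rewrite /step !(ltW lt) !(ltW h) lt h.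
have hl : \forall t \near t0, t < l by exact: lt_nbhsl.
apply: filterS hl => t tl; rewrite /step.
by rewrite !(leNgt l) tl h /= !(ltNge l) (ltW tl) (ltW h).
Qed.

Lemma rins_ball (R : realType) n (j : 'I_n.+1) (y : 'rV[R]_n) (t0 r : R) : 0 < r ->
  \forall t \near t0, ball (rins j t0 y) r (rins j t y).
Proof.
move=> r0; have : \forall t \near t0, ball t0 r t by exact: nbhsx_ballx.
apply: filterS => t ht; apply/ballrV; split => // i.
case: (unliftP j i) => [i'|] ->; last by rewrite !rinsE.
by rewrite !rins_lift subrr normr0.
Qed.

(** * The divergence theorem on one element *)

Section Elt.
Context {R : realType} {n : nat} (T : set 'rV[R]_n.+1) (I : finType)
  (fc : I -> set 'rV[R]_n.+1) (P : pred I).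
Local Notation X := (measurableTypeR R).
Local Notation mu := (@lebesgue_measure R).
Hypothesis hT : polyhedral_domain T.
Hypothesis hfl : forall i, P i -> flat_face (fc i).
Hypothesis hdis : forall i i', i != i' -> relint (fc i) `&` relint (fc i') = set0.
Hypothesis hfr : frontier T = \bigcup_(i in [set i | P i]) fc i.
Hypothesis hout : forall i, P i -> exists m, outward_unit_normal T (fc i) m.
Local Notation nu i := (outward_normal T (fc i)).

Lemma outward_normalP i : P i -> outward_unit_normal T (fc i) (nu i).
Proof.
by move=> Pi; apply: (@xgetPex _ 0 [set m | outward_unit_normal T (fc i) m]); exact: hout.
Qed.

Lemma outward_normal_face i : P i -> nu i = face_normal (fc i) \/ nu i = - face_normal (fc i).
Proof. by move=> Pi; apply: unit_normal_unique (hfl Pi) _ _; have [] := outward_normalP Pi. Qed.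

Lemma normr_outward i j : P i -> `|nu i 0 j| = `|face_normal (fc i) 0 j|.
Proof. by move=> Pi; case: (outward_normal_face Pi) => ->; rewrite ?mxE ?normrN. Qed.

Lemma nice_closure : nice (closure T).
Proof. by case: hT => _ _ _ _ /polytopal_nice. Qed.

Lemma elt_closure : T `<=` closure T.
Proof. exact: subset_closure. Qed.

Lemma face_closure i : P i -> fc i `<=` closure T.
Proof. by move=> Pi x fx; have [] : frontier T x by rewrite hfr; exists i. Qed.

Lemma nice_elt : nice T.
Proof.
have [_ [r hr]] := nice_closure; split; last by exists r => x /elt_closure/hr.
by apply: open_measurable_vec; case: hT.
Qed.

Section Line.
Variables (j : 'I_n.+1) (y : 'rV[R]_n).
Hypothesis hgood : forall i t, P i -> fc i (rins j t y) ->
  relint (fc i) (rins j t y) /\ face_normal (fc i) 0 j != 0.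

Let K i := P i && `[< shadow (fc i) j y >].
Let l i := lift_ht (fc i) j y.

Lemma line_face i t : P i -> fc i (rins j t y) -> K i /\ l i = t.
Proof.
move=> Pi fx; have [_ Nj] := hgood Pi fx.
have lt : t = l i by apply: lift_ht_unique => //; exact: on_face (hfl Pi) _ fx.
by split => //; rewrite /K Pi /=; apply/asboolP; rewrite /shadow /= face_liftE -/(l i) -lt.
Qed.

Lemma line_K i : K i -> P i /\ fc i (rins j (l i) y).
Proof. by move=> /andP[Pi /asboolP]. Qed.

(* D is locally constant, hence constant, and zero far away. *)
Let D t : R := (rins j t y \in T)%:R + \sum_(i | K i) step (nu i 0 j) (l i) t.

Lemma line_near t0 : \forall t \near t0, D t0 = D t.
Proof.
have oT : open T by case: hT.
have [|nfr] := pselect (frontier T (rins j t0 y)).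
  rewrite hfr => -[i0 /= Pi0 fx0].
  have [Ki0 li0] := line_face Pi0 fx0.
  have [rel Nj] := hgood Pi0 fx0.
  have [_ /(_ _ rel)[r r0 hr]] := outward_normalP Pi0.
  have nuj : nu i0 0 j != 0 by rewrite -normr_eq0 normr_outward// normr_eq0.
  have h1 := rins_ball j y t0 r0.
  (* No other step jumps at [t0]: good lines meet faces at relative interior points only, and these
     are not shared by two faces. *)
  have h2 : \forall t \near t0, forall i, i \in [seq i <- index_enum I | K i && (i != i0)] ->
      step (nu i 0 j) (l i) t = step (nu i 0 j) (l i) t0.
    apply: near_all_seq => i; rewrite mem_filter => /andP[/andP[Ki ii0] _].
    apply: step_near; apply/eqP => lt0.
    have [Pi fi] := line_K Ki; have [reli _] := hgood Pi fi.
    have : (relint (fc i) `&` relint (fc i0)) (rins j t0 y) by split => //; rewrite -lt0.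
    by rewrite hdis.
  apply: filterS2 h1 h2 => t hb hs.
  have Tt s : ball (rins j t0 y) r (rins j s y) -> (rins j s y \in T) = (nu i0 0 j * (s - t0) < 0).
    move=> /hr h; apply/idP/idP; rewrite inE h dotpBr !dotp_rins.
      by rewrite opprD addrACA subrr addr0 -mulrBr.
    by rewrite opprD addrACA subrr addr0 -mulrBr.
  rewrite /D Tt ?Tt ?subrr ?mulr0 ?ltxx//; last exact: ballxx.
  rewrite (bigD1 i0)//= [in RHS](bigD1 i0)//= li0 !addrA; congr (_ + _); last first.
    by apply: eq_bigr => i hi; rewrite hs// mem_filter hi mem_index_enum.
  rewrite /step; have [np|nn] := ltrP 0 (nu i0 0 j).
    by rewrite lexx add0r pmulr_rlt0// subr_lt0; case: ltrP => _; rewrite ?addr0 ?add0r.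
  have {}nn : nu i0 0 j < 0 by rewrite lt_neqAle nuj.
  by rewrite ltxx oppr0 addr0 nmulr_rlt0// subr_gt0 subrr.
have h2 : \forall t \near t0, forall i, i \in [seq i <- index_enum I | K i] ->
    step (nu i 0 j) (l i) t = step (nu i 0 j) (l i) t0.
  apply: near_all_seq => i; rewrite mem_filter => /andP[Ki _].
  apply: step_near; apply/eqP => lt0; apply: nfr.
  by have [Pi fi] := line_K Ki; rewrite hfr; exists i => //; rewrite -lt0.
have h1 : \forall t \near t0, (rins j t y \in T) = (rins j t0 y \in T).
  have [Tx|nTx] := pselect (T (rins j t0 y)).
    have /nbhs_ballP[r /= r0 hr] : nbhs (rins j t0 y) T by exact: open_nbhs_nbhs.
    apply: filterS (rins_ball j y t0 r0) => t /hr Tt.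
    by rewrite (mem_set Tx) (mem_set Tt).
  have ncl : ~ closure T (rins j t0 y).
    by move=> cl; apply: nfr; split => //; rewrite (interior_id T).1.
  have /nbhs_ballP[r /= r0 hr] : nbhs (rins j t0 y) (~` closure T).
    by apply: open_nbhs_nbhs; split => //; apply: closed_openC; exact: closed_closure.
  apply: filterS (rins_ball j y t0 r0) => t /hr nt.
  rewrite (memNset nTx) memNset// => Tt; apply: nt; exact: elt_closure.
apply: filterS2 h1 h2 => t ht hs; rewrite /D ht; congr (_ + _).
by apply: eq_bigr => i Ki; rewrite hs// mem_filter Ki mem_index_enum.
Qed.

Lemma line_indicator t : (rins j t y \in T)%:R = - \sum_(i | K i) step (nu i 0 j) (l i) t.
Proof.
apply/eqP; rewrite -addr_eq0 -/(D t); apply/eqP.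
have [_ [r hr]] := nice_closure.
have hr' s : closure T (rins j s y) -> `|s| <= r by move=> /hr/(_ j); rewrite rinsE.
(* A locally constant function has derivative 0 everywhere, hence is constant. The reference point
   lies to the left of the whole element, before any step has jumped. *)
have -> : D t = D (- (`|r| + 1)).
  apply: is_derive_0_is_cst => x.
  by apply: (near_eq_is_derive (f := cst (D x))) (line_near x) _.
have rB : r < `|r| + 1 by rewrite (le_lt_trans (ler_norm _))// ltrDl.
have B0 : 0 <= `|r| + 1 by rewrite addr_ge0.
rewrite /D memNset ?add0r.
  apply: big1 => i /line_K[Pi fi].
  have := hr' _ (face_closure Pi fi); rewrite ler_norml => /andP[lr _].
  have lB : - (`|r| + 1) < l i by rewrite (lt_le_trans _ lr)// ltrN2.
  by rewrite /step (leNgt (l i)) lB /= (ltNge (l i)) (ltW lB) /= oppr0; case: ifP.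
move=> /elt_closure/hr'; rewrite normrN ger0_norm// leNgt rB//.
Qed.

(** The endpoint terms are written with [shadow] and [pull], so that integrating over [y] yields the
    face integrals directly. *)
Lemma line_integral phi :
  (\int[mu]_t (if rins j t y \in T then (ev (mpoly.mderiv j phi) (rins j t y))%:E else 0) =
   (\sum_i (if P i then Num.sg (nu i 0 j) * (if y \in shadow (fc i) j then ev (pull (fc i) j phi) y else 0) else 0))%:E)%E.
Proof.
have [_ [r hr]] := nice_closure.
have rB : r < `|r| + 1 by rewrite (le_lt_trans (ler_norm _))// ltrDl.
have B0 : 0 <= `|r| + 1 by rewrite addr_ge0.
have hr' s : closure T (rins j s y) -> `|s| < `|r| + 1.
  by move=> /hr/(_ j); rewrite rinsE => /le_lt_trans; apply.
have linE t : rins j t y = rins j 0 y + t *: delta_mx 0 j.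
  apply/rowP => i; rewrite !mxE eqxx /= eq_sym.
  case: (unliftP j i) => [i' ->|->]; last by rewrite eqxx mulr1 add0r.
  by rewrite (negbTE (neq_lift _ _)) mulr0 addr0.
have hd (t : R) : is_derive t 1 (fun s => ev phi (rins j s y)) (ev (mpoly.mderiv j phi) (rins j t y)).
  have D1 := ev_derive phi (rins j 0 y) (delta_mx 0 j) t.
  have -> : (fun s => ev phi (rins j s y)) = (fun s : R => ev phi (rins j 0 y + s *: delta_mx 0 j)).
    by apply/funext => s; rewrite -linE.
  apply: is_derive_eq; rewrite (bigD1 j)//= big1 ?addr0 -?linE.
    by rewrite mxE !eqxx mul1r.
  by move=> i ij; rewrite mxE (negbTE ij) andbF mul0r.
have cd : continuous (fun t => ev (mpoly.mderiv j phi) (rins j t y)).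
  move=> t; have := ev_derive (mpoly.mderiv j phi) (rins j 0 y) (delta_mx 0 j) t.
  move=> D1; apply: differentiable_continuous; apply/derivable1_diffP.
  rewrite (_ : (fun t => _) = (fun s : R => ev (mpoly.mderiv j phi) (rins j 0 y + s *: delta_mx 0 j))).
    exact: (@ex_derive _ _ _ _ _ _ _ D1).
  by apply/funext => s; rewrite -linE.
have := @slice_ftc _ _ _ (`|r| + 1) hd cd [set t | T (rins j t y)] I K (fun i => nu i 0 j) l.
have SB t : T (rins j t y) -> - (`|r| + 1) <= t <= `|r| + 1.
  by move=> /elt_closure/hr'/ltW; rewrite ler_norml.
have lB i : K i -> - (`|r| + 1) < l i < `|r| + 1.
  by move=> /line_K[Pi /(face_closure Pi)/hr']; rewrite ltr_norml.
move=> /(_ SB lB B0).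
have nS : ~ T (rins j (`|r| + 1) y).
  by move=> /elt_closure/hr'; rewrite ger0_norm// ltxx.
move=> /(_ nS (fun t _ => line_indicator t)) => h; rewrite [LHS]h.
congr EFin; rewrite [LHS]big_mkcond; apply: eq_bigr => i _; rewrite /K.
case: (boolP (P i)) => //= Pi.
have -> : (y \in shadow (fc i) j) = `[< shadow (fc i) j y >] by [].
case: asboolP => // [sy|_]; last by rewrite mulr0.
have [_ Nj] : relint (fc i) (rins j (l i) y) /\ face_normal (fc i) 0 j != 0 by exact: hgood.
have nuj : nu i 0 j != 0 by rewrite -normr_eq0 normr_outward// normr_eq0.
rewrite ev_pull; congr (_ * _); case: sgrP nuj => //.
Qed.

End Line.

Lemma measurable_integral_tins_gen (j : 'I_n.+1) (F : n.+1.-tuple X -> \bar R) :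
  measurable_fun setT F ->
  measurable_fun setT (fun y => \int[mu]_t F (tins j t y))%E.
Proof.
move=> mF.
have := measurable_integral_tins j (measurable_funepos mF) (fun x => funepos_ge0 F x).
have := measurable_integral_tins j (measurable_funeneg mF) (fun x => funeneg_ge0 F x).
move=> mn mp.
rewrite (_ : (fun y => _) = (fun y => \int[mu]_t F^\+%E (tins j t y) - \int[mu]_t F^\-%E (tins j t y))%E).
  exact: emeasurable_funB.
apply/funext => y; rewrite integralE.
by congr (_ - _)%E; apply: eq_integral => t _; rewrite ?funeposE ?funenegE.
Qed.

Lemma nice_restrict_integrable m (A : set 'rV[R]_m) p : nice A ->
  (lebesgue m).-integrable setT (fun t => if vec t \in A then (ev p (vec t))%:E else 0%E).
Proof.
move=> nA; have := ev_integrable p nA; have [mA _] := nA.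
by move=> /(integrable_mkcond _ mA).1.
Qed.

(** Along a line only the sign of [nu j] is seen; the area element [1 / |nu j|] of the face
    projected along [j] turns this sign into [nu j]. *)
Lemma divergence_theorem j phi :
  Iint T (mpoly.mderiv j phi) = \sum_(i | P i) nu i 0 j * Jint (fc i) phi.
Proof.
pose F (t : n.+1.-tuple X) : \bar R :=
  if vec t \in T then (ev (mpoly.mderiv j phi) (vec t))%:E else 0%E.
have iF : (lebesgue n.+1).-integrable setT F by exact: nice_restrict_integrable nice_elt.
have mF := measurable_int _ iF.
pose g i (y : n.-tuple X) : \bar R := if P i then
  ((Num.sg (nu i 0 j))%:E * (if vec y \in shadow (fc i) j then (ev (pull (fc i) j phi) (vec y))%:E else 0))%E else 0%E.
have [ig Ig] : (forall i, (lebesgue n).-integrable setT (g i)) /\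
   forall i, (\int[lebesgue n]_y g i y)%E = (if P i then nu i 0 j * Jint (fc i) phi else 0)%:E.
  split=> i; rewrite /g; case Pi: (P i).
  - by apply: integrableZl => //; apply: nice_restrict_integrable; exact: shadow_nice (hfl Pi) _.
  - exact: integrable0.
  - have iR := nice_restrict_integrable (pull (fc i) j phi) (shadow_nice (hfl Pi) j).
    rewrite integralZl// -[X in (_ * X)%E]fineK; last exact: integrable_fin_num.
    rewrite -Iint_mkcond -EFinM; congr EFin.
    (* A face parallel to the axis contributes 0 on both sides; its integral cannot be computed
       along this axis. *)
    have [->|nuj] := eqVneq (nu i 0 j) 0; first by rewrite sgr0 !mul0r.
    have Nj : face_normal (fc i) 0 j != 0 by rewrite -normr_eq0 -normr_outward// normr_eq0.
    rewrite (Jint_coord (hfl Pi) _ Nj) /Jint_at -normr_outward//.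
    rewrite mulrA; congr (_ * _); apply: (mulIf (x := `|nu i 0 j|)); first by rewrite normr_eq0.
    by rewrite divfK ?normr_eq0// -numEsg.
  - exact: integral0.
rewrite Iint_mkcond -/F [X in fine X](fubini_ins j iF).
transitivity (fine (\int[lebesgue n]_y \sum_i g i y)%E); last first.
  rewrite integral_sum//.
  under eq_bigr do rewrite Ig.
  by rewrite sumEFin [in RHS]big_mkcond.
congr fine; apply: ae_eq_integral => //.
- exact: measurable_integral_tins_gen.
- exact: emeasurable_sum (fun i => measurable_int _ (ig i)).
have /choice[B hB] : forall i, exists B : set 'rV[R]_n, negl B /\
    (P i -> forall y t, ~ B y -> fc i (rins j t y) ->
    relint (fc i) (rins j t y) /\ face_normal (fc i) 0 j != 0).
  move=> i; case Pi: (P i); last first.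
    by exists set0; split => //; exact: negligible_set0.
  by have [B nB hB] := bad_lines j (hfl Pi); exists B.
have nB : negl [set y | exists2 i, i \in index_enum I & B i y].
  by apply: negl_seq => i _; exact: (hB i).1.
apply: negligibleS nB => y /= h; apply: contrapT => hy; apply: h => _.
rewrite [LHS](_ : _ = (\int[mu]_t (if rins j t (vec y) \in T then (ev (mpoly.mderiv j phi) (rins j t (vec y)))%:E else 0))%E); last first.
  by apply: eq_integral => t _; rewrite /F vec_tins.
rewrite line_integral.
  rewrite -sumEFin; apply: eq_bigr => i _; rewrite /g; case: ifP => // _.
  by rewrite EFinM; congr (_ * _)%E; case: ifP.
move=> i t Pi fi; apply: (hB i).2 => // By; apply: hy; exists i => //.
by rewrite mem_index_enum.
Qed.

End Elt.

(** * Symmetric linear systems *)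

Section Solvable.
Context {R : fieldType} {N : nat}.
Implicit Types (u v : 'rV[R]_N).

Lemma subspace_matrix (P : 'rV[R]_N -> Prop) : P 0 ->
  (forall a u v, P u -> P v -> P (a *: u + v)) ->
  exists U : 'M[R]_N, forall u, P u <-> (u <= U)%MS.
Proof.
move=> P0 Plin.
have Pcomb (m : nat) (A : 'M[R]_(m, N)) : (forall i, P (row i A)) -> forall x, P (x *m A).
  move=> hA x; rewrite mulmx_sum_row; elim/big_ind : _ => // [u v Pu Pv|i _].
    by rewrite -[u]scale1r; exact: Plin.
  by rewrite -[_ *: _]addr0; exact: Plin.
pose Q r := `[< exists2 U : 'M[R]_N, forall u, (u <= U)%MS -> P u & \rank U = r >].
have Q0 : exists r, Q r.
  exists 0%N; apply/asboolP; exists 0; last exact: mxrank0.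
  by move=> u /submx0null ->.
have QN r : Q r -> (r <= N)%N by move=> /asboolP[U _ <-]; exact: rank_leq_row.
case: (ex_maxnP Q0 QN) => r /asboolP[U UP rU] rmax.
exists U => u; split; last exact: UP.
move=> Pu; apply: contraT => nuU.
have /rmax : Q (\rank (U + u)%MS).
  apply/asboolP; exists (U + u)%MS => // v /sub_addsmxP[[x y] /= ->].
  rewrite -[x *m U]scale1r; apply: Plin; first by apply: UP; exact: submxMl.
  by apply: Pcomb => i; rewrite row_id.
rewrite -rU leqNgt => /negP[]; apply: rank_ltmx.
by rewrite ltmxE addsmxSl addsmx_sub submx_refl.
Qed.

(* The range of a symmetric matrix is the annihilator of its kernel. *)
Lemma solvable (P : 'rV[R]_N -> Prop) (B : 'rV[R]_N -> 'rV[R]_N -> R)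
    (L : 'rV[R]_N -> R) :
  P 0 -> (forall a u v, P u -> P v -> P (a *: u + v)) ->
  (forall u v, B u v = B v u) ->
  (forall a u u' v, B (a *: u + u') v = a * B u v + B u' v) ->
  (forall a u v, L (a *: u + v) = a * L u + L v) ->
  (forall u, P u -> (forall v, P v -> B u v = 0) -> L u = 0) ->
  exists2 u, P u & forall v, P v -> B u v = L v.
Proof.
move=> P0 Plin Bsym Blin Llin ker.
have [U hU] := subspace_matrix P0 Plin.
have sumlin (f : 'rV[R]_N -> R) :
    (forall a u v, f (a *: u + v) = a * f u + f v) ->
    forall v, f v = \sum_i v 0 i * f (delta_mx 0 i).
  move=> fl v; have f0 : f 0 = 0.
    by have := fl (-1) 0 0; rewrite scaler0 addr0 mulN1r addNr.
  rewrite {1}[v]row_sum_delta; elim: (index_enum _) => [|i s IH].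
    by rewrite !big_nil f0.
  by rewrite !big_cons fl IH.
pose G : 'M[R]_N := \matrix_(i, j) B (delta_mx 0 i) (delta_mx 0 j).
pose l : 'rV[R]_N := \row_i L (delta_mx 0 i).
have BE u v : B u v = (u *m G *m v^T) 0 0.
  rewrite (sumlin (B u)); last by move=> a w w'; rewrite Bsym Blin !(Bsym u).
  rewrite mxE; apply: eq_bigr => i _; rewrite !mxE mulrC; congr (_ * _).
  rewrite (sumlin (fun u => B u (delta_mx 0 i))); last by move=> *; exact: Blin.
  by apply: eq_bigr => j _; rewrite mxE.
have LE v : L v = (l *m v^T) 0 0.
  by rewrite (sumlin L)// mxE; apply: eq_bigr => i _; rewrite !mxE mulrC.
have GT : G^T = G by apply/matrixP => i j; rewrite !mxE Bsym.
pose A := U *m G *m U^T.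
have AT : A^T = A by rewrite /A !trmx_mul trmxK GT mulmxA.
have : (l *m U^T <= A)%MS.
  rewrite submxE; apply/eqP/matrixP => i k; rewrite (ord1 i) [RHS]mxE.
  (* A column of the cokernel gives a vector [z *m U] of [P] that is orthogonal to [P] for [B];
     there [ker] makes [L] vanish, which is the condition for [l *m U^T] to lie in the row space of
     [A]. *)
  pose z := (col k (cokermx A))^T.
  have Az : A *m col k (cokermx A) = 0.
    by rewrite colE mulmxA mulmx_coker mul0mx.
  have -> : (l *m U^T *m cokermx A) 0 k = L (z *m U).
    by rewrite LE /z trmx_mul trmxK colE !mulmxA -colE [RHS]mxE.
  apply: ker; first by apply/hU; exact: submxMl.
  move=> v /hU/submxP[x ->]; rewrite Bsym BE trmx_mul /z trmxK.
  have -> : x *m U *m G *m (U^T *m col k (cokermx A)) = x *m (A *m col k (cokermx A)).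
    by rewrite /A !mulmxA.
  by rewrite Az mulmx0 mxE.
move=> /submxP[c hc]; exists (c *m U); first by apply/hU; exact: submxMl.
move=> v /hU/submxP[x ->]; rewrite BE LE trmx_mul [in RHS]mulmxA hc /A !mulmxA.
by [].
Qed.

End Solvable.

(** * Weak operators *)

Section PolyAlgebra.
Context {R : realType} {d : nat}.
Local Notation mp := (mpoly.mpoly d R).
Local Notation C := (mpoly.mpolyC d (R := R)).
Implicit Types (a : R) (x nn : 'rV[R]_d).

(** [pdot], [pmul] and [pdn] are [dotp], [mxdot] and the normal component kept at the level of
    polynomials, so that each integrand is the evaluation of one polynomial. *)
Definition pdot {m l} (A B : 'M[mp]_(m, l)) : mp := \sum_i \sum_j A i j * B i j.

Definition pmul (A : 'M[mp]_d) nn : 'rV[mp]_d := \row_i \sum_j nn 0 j *: A i j.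

Definition pdn (v : 'rV[mp]_d) nn : mp := \sum_j nn 0 j *: v 0 j.

Lemma ev_pdot m l (A B : 'M[mp]_(m, l)) x : ev (pdot A B) x = dotp (evm A x) (evm B x).
Proof.
rewrite ev_sum; apply: eq_bigr => i _; rewrite ev_sum; apply: eq_bigr => j _.
by rewrite evM !mxE.
Qed.

Lemma evm_pmul A nn x : evm (pmul A nn) x = mxdot (evm A x) nn.
Proof.
apply/rowP => i; rewrite !mxE ev_sum; apply: eq_bigr => j _.
by rewrite evZ !mxE.
Qed.

Lemma ev_pdn v nn x : ev (pdn v nn) x = dotp (evm v x) nn.
Proof.
by rewrite ev_sum dotpE; apply: eq_bigr => j _; rewrite evZ mxE mulrC.
Qed.

Lemma evmD m l (A B : 'M[mp]_(m, l)) x : evm (A + B) x = evm A x + evm B x.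
Proof. by apply/matrixP => i j; rewrite !mxE evD. Qed.
Lemma evmN m l (A : 'M[mp]_(m, l)) x : evm (- A) x = - evm A x.
Proof. by apply/matrixP => i j; rewrite !mxE evN. Qed.
Lemma evmB m l (A B : 'M[mp]_(m, l)) x : evm (A - B) x = evm A x - evm B x.
Proof. by rewrite evmD evmN. Qed.

Lemma evm0 m l x : evm (0 : 'M[mp]_(m, l)) x = 0.
Proof. by apply/matrixP => i j; rewrite !mxE ev0. Qed.

(** Matrices of polynomials are scaled by polynomials, so a real scalar acts on them as the constant
    [C a]; on single polynomials it acts directly. *)
Lemma CE a (p : mp) : C a * p = a *: p.
Proof. exact: mpoly.mul_mpolyC. Qed.

Lemma evm_lin m l a (A B : 'M[mp]_(m, l)) x : evm (C a *: A + B) x = a *: evm A x + evm B x.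
Proof. by apply/matrixP => i j; rewrite !mxE CE evD evZ. Qed.

Lemma pdot_row (u v : 'rV[mp]_d) : pdot u v = \sum_j u 0 j * v 0 j.
Proof. by rewrite /pdot big_ord1. Qed.

Lemma pdotC m l (A B : 'M[mp]_(m, l)) : pdot A B = pdot B A.
Proof. by apply: eq_bigr => i _; apply: eq_bigr => j _; rewrite mulrC. Qed.

Lemma pdot_lin m l a (A A' B : 'M[mp]_(m, l)) :
  pdot (C a *: A + A') B = a *: pdot A B + pdot A' B.
Proof.
rewrite /pdot scaler_sumr -big_split; apply: eq_bigr => i _ /=.
rewrite scaler_sumr -big_split; apply: eq_bigr => j _ /=.
by rewrite !mxE CE mulrDl scalerAl.
Qed.

Lemma pdot_linr m l a (A B B' : 'M[mp]_(m, l)) :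
  pdot A (C a *: B + B') = a *: pdot A B + pdot A B'.
Proof. by rewrite pdotC pdot_lin !(pdotC _ A). Qed.

Lemma pmul_lin a A B nn : pmul (C a *: A + B) nn = C a *: pmul A nn + pmul B nn.
Proof.
apply/rowP => i; rewrite !mxE CE scaler_sumr -big_split; apply: eq_bigr => j _ /=.
by rewrite !mxE CE scalerDr !scalerA mulrC.
Qed.

Lemma pdn_lin a u v nn : pdn (C a *: u + v) nn = a *: pdn u nn + pdn v nn.
Proof.
rewrite /pdn scaler_sumr -big_split; apply: eq_bigr => j _ /=.
by rewrite !mxE CE scalerDr !scalerA mulrC.
Qed.

Lemma mderiv_lin j a (p q : mp) :
  mpoly.mderiv j (a *: p + q) = a *: mpoly.mderiv j p + mpoly.mderiv j q.
Proof. by rewrite mpoly.mderivD mpoly.mderivZ. Qed.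

Lemma mderiv_sum (I : finType) (f : I -> mp) j :
  mpoly.mderiv j (\sum_i f i) = \sum_i mpoly.mderiv j (f i).
Proof. exact: (raddf_sum (mpoly.mderiv j)). Qed.

Lemma grad_lin a (p q : mp) : grad (a *: p + q) = C a *: grad p + grad q.
Proof. by apply/rowP => j; rewrite !mxE mderiv_lin CE. Qed.

Lemma gradv_lin a (u v : 'rV[mp]_d) : gradv (C a *: u + v) = C a *: gradv u + gradv v.
Proof. by apply/matrixP => i j; rewrite !mxE !CE mderiv_lin. Qed.

Lemma divv_lin a (u v : 'rV[mp]_d) : divv (C a *: u + v) = a *: divv u + divv v.
Proof.
rewrite /divv scaler_sumr -big_split; apply: eq_bigr => j _ /=.
by rewrite !mxE CE mderiv_lin.
Qed.

Lemma laplv_lin a (u v : 'rV[mp]_d) : laplv (C a *: u + v) = C a *: laplv u + laplv v.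
Proof.
apply/rowP => i; rewrite !mxE [in RHS]CE scaler_sumr -big_split; apply: eq_bigr => j _ /=.
by rewrite CE !mderiv_lin.
Qed.

Lemma degle_le r s (p : mp) : (r <= s)%N -> degle r p -> degle s p.
Proof. by rewrite /degle => rs h; rewrite (leq_trans h). Qed.

Lemma degle_lin r a (p q : mp) : degle r p -> degle r q -> degle r (a *: p + q).
Proof.
rewrite /degle => hp hq; apply: (leq_trans (mpoly.msizeD_le _ _)).
by rewrite geq_max hq (leq_trans (mpoly.msizeZ_le _ _) hp).
Qed.

Lemma degle0 r : degle r (0 : mp).
Proof. by rewrite /degle mpoly.msize0. Qed.

Lemma degle_mx0 r m l : degle_mx r (0 : 'M[mp]_(m, l)).
Proof. by move=> i j; rewrite mxE; exact: degle0. Qed.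

Lemma degle_mx_lin r a m l (A B : 'M[mp]_(m, l)) :
  degle_mx r A -> degle_mx r B -> degle_mx r (C a *: A + B).
Proof. by move=> hA hB i j; rewrite !mxE CE; exact: degle_lin. Qed.

Lemma degle_sum r (I : finType) (f : I -> mp) : (forall i, degle r (f i)) -> degle r (\sum_i f i).
Proof.
move=> hf; elim/big_ind : _ => //; first exact: degle0.
by move=> p q hp hq; rewrite -[p]scale1r; exact: degle_lin.
Qed.

Definition polc r (c : mpoly.bmultinom d r.+1 -> R) : mp :=
  \sum_(m : mpoly.bmultinom d r.+1) c m *: mpoly.mpolyX R (mpoly.bmnm m).

Lemma degle_polc r c : degle r (polc (r := r) c).
Proof.
apply: degle_sum => m; rewrite -[_ *: _]addr0; apply: degle_lin; last exact: degle0.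
by rewrite /degle mpoly.msizeX mpoly.bmdeg.
Qed.

Lemma polc_coef r p : degle r p -> polc (r := r) (fun m => mpoly.mcoeff m p) = p.
Proof. by move=> hp; rewrite {2}(mpoly.mpolywE hp). Qed.

Lemma polc_lin r a c c' :
  polc (r := r) (fun m => a * c m + c' m) = a *: polc c + polc c'.
Proof.
rewrite /polc scaler_sumr -big_split; apply: eq_bigr => m _ /=.
by rewrite scalerDl scalerA.
Qed.

End PolyAlgebra.

Section Coordinates.
Context {R : realType} (J : finType).
Definition cf (u : 'rV[R]_#|J|) (j : J) : R := u 0 (enum_rank j).
Lemma cf_lin a u v j : cf (a *: u + v) j = a * cf u j + cf v j.
Proof. by rewrite /cf !mxE. Qed.
Lemma cf_surj (f : J -> R) : exists u, cf u = f.
Proof.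
exists (\row_i f (enum_val i)); apply/funext => j.
by rewrite /cf mxE enum_rankK.
Qed.
End Coordinates.

Section MeshFunctionals.
Context {R : realType} {n : nat} {E F : finType}.
Variables (Omega : set 'rV[R]_n.+1) (M : @mesh R n.+1 E F) (rho : R).
Hypothesis hM : is_mesh Omega M rho.
Local Notation mp := (mpoly.mpoly n.+1 R).

Definition IT T (p : mp) : R := Iint (elt M T) p.
Definition Je e (p : mp) : R := Jint (face M e) p.

Lemma mesh_elt T : polyhedral_domain (elt M T).
Proof. by case: hM => -[h _ _] _ _; case: (h T). Qed.

Lemma mesh_elt_sub T : elt M T `<=` Omega.
Proof. by case: hM => -[h _ _] _ _; case: (h T). Qed.

Lemma mesh_face e : flat_face (face M e).
Proof. by case: hM => _ [h _ _ _ _] _; exact: h. Qed.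

Lemma mesh_disj e e' : e != e' -> relint (face M e) `&` relint (face M e') = set0.
Proof. by case: hM => _ [_ h _ _ _] _; exact: h. Qed.

Lemma mesh_frontier T : frontier (elt M T) = \bigcup_(e in [set e | face_of M T e]) face M e.
Proof. by case: hM => _ [_ _ h _ _] _; exact: h. Qed.

Lemma mesh_outward T e : face_of M T e -> exists m, outward_unit_normal (elt M T) (face M e) m.
Proof. by case: hM => _ [_ _ _ h _] _; exact: h. Qed.

Lemma mesh_nice T : nice (elt M T).
Proof. exact: nice_elt (mesh_elt T). Qed.

Lemma IT_linear T a p q : IT T (a *: p + q) = a * IT T p + IT T q.
Proof. by apply: Iint_linear; exact: mesh_nice. Qed.

Lemma Je_linear e a p q : Je e (a *: p + q) = a * Je e p + Je e q.
Proof. exact: (Jint_linear (mesh_face e)). Qed.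

Lemma IT_sqr_ge0 T p : 0 <= IT T (p * p).
Proof. exact: Iint_sqr_ge0. Qed.

Lemma IT_sqr_eq0 T p : IT T (p * p) = 0 -> p = 0.
Proof.
have [[x Tx] oT _ _ _] := mesh_elt T.
have /nbhs_ballP[r /= r0 hr] : nbhs x (elt M T) by exact: open_nbhs_nbhs.
exact: Iint_sqr_eq0 (mesh_nice T) r0 hr.
Qed.

Lemma Je_sqr_ge0 e p : 0 <= Je e (p * p).
Proof. exact: (Jint_sqr_ge0 (mesh_face e)). Qed.

Lemma Je_sqr_eq0 e p : Je e (p * p) = 0 -> forall x, face M e x -> ev p x = 0.
Proof. exact: (Jint_sqr_eq0 (mesh_face e)). Qed.

Lemma eq_Je e p q : (forall x, face M e x -> ev p x = ev q x) -> Je e p = Je e q.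
Proof. exact: eq_Jint. Qed.

Lemma mesh_divergence T j p :
  IT T (mpoly.mderiv j p) = \sum_(e | face_of M T e) nrm M T e 0 j * Je e p.
Proof.
apply: (divergence_theorem (mesh_elt T) _ mesh_disj (mesh_frontier T)) => e he.
  exact: mesh_face.
exact: mesh_outward.
Qed.

Lemma elt_integralE T phi p : (forall x, phi x = ev p x) -> elt_integral M T phi = IT T p.
Proof. by move=> h; congr integral_on; apply/funext. Qed.

Lemma bd_integralE T phi (p : F -> mp) : (forall e x, phi e x = ev (p e) x) ->
  bd_integral M T phi = \sum_(e | face_of M T e) Je e (p e).
Proof. by move=> h; apply: eq_bigr => e _; congr face_integral; apply/funext => x. Qed.

End MeshFunctionals.

Section Weak.
Context {R : realType} {n : nat} {E F : finType}.
Variables (Omega : set 'rV[R]_n.+1) (M : @mesh R n.+1 E F) (rho : R) (k : nat).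
Hypothesis hM : is_mesh Omega M rho.
Local Notation mp := (mpoly.mpoly n.+1 R).
Local Notation C := (mpoly.mpolyC n.+1 (R := R)).
Local Notation row := ('rV[mp]_n.+1).
Local Notation IT := (IT M).
Local Notation Je := (Je M).
Local Notation nr := (nrm M).
Local Notation ITl T := (IT_linear hM T).
Local Notation Jel e := (Je_linear hM e).
Implicit Types (a : R) (T : E) (e : F) (v : @wg R n.+1 E F) (q : @wp R n.+1 E F).

Let IT_lin T a (p1 p2 : mp) := IT_linear hM T a p1 p2.

Lemma Jsum_lin T a (f g h : F -> mp) : (forall e, h e = a *: f e + g e) ->
  \sum_(e | face_of M T e) Je e (h e) =
  a * \sum_(e | face_of M T e) Je e (f e) + \sum_(e | face_of M T e) Je e (g e).
Proof.
move=> hE; rewrite mulr_sumr -big_split; apply: eq_bigr => e _ /=.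
by rewrite hE (Jel _).
Qed.

Lemma lin2 (a x x' y y' : R) : - (a * x + x') + (a * y + y') = a * (- x + y) + (- x' + y').
Proof. by ring. Qed.

Lemma lin3 (a x x' y y' z z' : R) :
  (a * x + x') - (a * y + y') + (a * z + z') = a * (x - y + z) + (x' - y' + z').
Proof. by ring. Qed.

Lemma IT_pdot_ge0 T m l (A : 'M[mp]_(m, l)) : 0 <= IT T (pdot A A).
Proof.
rewrite (scl_sum (ITl T)) sumr_ge0// => i _.
by rewrite (scl_sum (ITl T)) sumr_ge0// => j _; exact: IT_sqr_ge0.
Qed.

Lemma IT_pdot_eq0 T m l (A : 'M[mp]_(m, l)) : IT T (pdot A A) = 0 -> A = 0.
Proof.
rewrite (scl_sum (ITl T)) => /eqP; rewrite psumr_eq0 => [/allP h|i _]; last first.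
  by rewrite (scl_sum (ITl T)) sumr_ge0// => j _; exact: IT_sqr_ge0.
apply/matrixP => i j; rewrite mxE.
have := h i (mem_index_enum _); rewrite /= (scl_sum (ITl T)).
rewrite psumr_eq0 => [/allP h'|j' _]; last exact: IT_sqr_ge0.
by have /eqP/(IT_sqr_eq0 hM) := h' j (mem_index_enum _).
Qed.

Lemma Je_pdot_eq0 e m l (A : 'M[mp]_(m, l)) : Je e (pdot A A) = 0 ->
  forall x, face M e x -> evm A x = 0.
Proof.
rewrite (scl_sum (Jel e)) => /eqP; rewrite psumr_eq0 => [/allP h x ex|i _]; last first.
  by rewrite (scl_sum (Jel e)) sumr_ge0// => j _; exact: (Je_sqr_ge0 hM).
apply/matrixP => i j; rewrite !mxE.
have := h i (mem_index_enum _); rewrite /= (scl_sum (Jel e)).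
rewrite psumr_eq0 => [/allP h'|j' _]; last exact: (Je_sqr_ge0 hM).
by have /eqP/(Je_sqr_eq0 hM) := h' j (mem_index_enum _); apply.
Qed.

(** [solvable] applied in coordinates to the L2 product of the element: the product is definite, so
    its kernel is zero and the compatibility condition is free. *)
Lemma riesz T r (L : row -> R) :
  (forall a w w', L (C a *: w + w') = a * L w + L w') ->
  exists2 D, degle_mx r D & forall w, degle_mx r w -> IT T (pdot D w) = L w.
Proof.
move=> Llin; pose J : finType := ('I_n.+1 * mpoly.bmultinom n.+1 r.+1)%type.
pose pol (u : 'rV[R]_#|J|) : row := \row_i polc (fun m => cf u (i, m)).
have pol_lin a (u v : 'rV[R]_#|J|) : pol (a *: u + v) = C a *: pol u + pol v.
  apply/rowP => i; rewrite !mxE CE -polc_lin; congr polc.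
  by apply/funext => m; rewrite cf_lin.
have pol_deg u : degle_mx r (pol u) by move=> i j; rewrite mxE; exact: degle_polc.
have pol_surj w : degle_mx r w -> exists u, pol u = w.
  move=> hw; have [u hu] := cf_surj (fun j : J => mpoly.mcoeff (mpoly.bmnm j.2) (w 0 j.1)).
  by exists u; apply/rowP => i; rewrite mxE hu /= polc_coef.
have L0 : L 0 = 0.
  by have := Llin (-1) 0 0; rewrite scaler0 addr0 mulN1r addNr.
have [] := @solvable R #|J| (fun=> True) (fun u v : 'rV[R]_#|J| => IT T (pdot (pol u) (pol v))) (fun u => L (pol u)).
- by [].
- by [].
- by move=> u v; rewrite pdotC.
- by move=> a u u' v; rewrite pol_lin pdot_lin (ITl _).
- by move=> a u v; rewrite pol_lin Llin.
- by move=> u _ /(_ u I)/IT_pdot_eq0 ->.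
move=> u _ hu; exists (pol u) => // w /pol_surj[v <-]; exact: hu.
Qed.

Lemma riesz_unique T r (L : row -> R) D D' :
  degle_mx r D -> (forall w, degle_mx r w -> IT T (pdot D w) = L w) ->
  degle_mx r D' -> (forall w, degle_mx r w -> IT T (pdot D' w) = L w) -> D = D'.
Proof.
move=> dD hD dD' hD'; apply/eqP; rewrite -subr_eq0; apply/eqP.
have dB : degle_mx r (C (-1) *: D' + D) by exact: degle_mx_lin.
have -> : D - D' = C (-1) *: D' + D by rewrite addrC mpoly.mpolyCN mpoly.mpolyC1 scaleN1r.
by apply: (@IT_pdot_eq0 T); rewrite pdot_lin (ITl _) (hD _ dB) (hD' _ dB) mulN1r addNr.
Qed.

(** The vector case, read on the first component. *)
Lemma riesz1 T r (L : mp -> R) :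
  (forall a w w', L (a *: w + w') = a * L w + L w') ->
  exists2 D, degle r D & forall w, degle r w -> IT T (D * w) = L w.
Proof.
move=> Llin; have Llin0 a (w w' : row) : L ((C a *: w + w') 0 0) = a * L (w 0 0) + L (w' 0 0).
  by rewrite !mxE CE Llin.
have [D dD hD] := riesz T r Llin0.
exists (D 0 0) => // w dw.
have := hD (\row_i (if i == 0 then w else 0)); rewrite !mxE eqxx => <-.
  congr IT; rewrite /pdot big_ord1 (bigD1 0)//= big1 ?addr0 => [|i /negbTE i0]; rewrite !mxE ?eqxx//.
  by rewrite i0 mulr0.
by move=> i j; rewrite mxE; case: ifP => // _; exact: degle0.
Qed.

Lemma riesz1_unique T r (L : mp -> R) D D' :
  degle r D -> (forall w, degle r w -> IT T (D * w) = L w) ->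
  degle r D' -> (forall w, degle r w -> IT T (D' * w) = L w) -> D = D'.
Proof.
move=> dD hD dD' hD'; apply/eqP; rewrite -subr_eq0; apply/eqP.
have dB : degle r (-1 *: D' + D) by exact: degle_lin.
have -> : D - D' = -1 *: D' + D by rewrite addrC scaleN1r.
by apply: (@IT_sqr_eq0 _ _ _ _ _ _ _ hM T); rewrite mulrDl -scalerAl (ITl _) (hD _ dB) (hD' _ dB) mulN1r addNr.
Qed.

(** The right-hand sides that define the three weak operators, as linear functionals of the test
    polynomial. *)
Definition Llapl v T (w : row) : R :=
  IT T (pdot (v0 v T) (laplv w))
  - \sum_(e | face_of M T e) Je e (pdot (vb v e) (pmul (gradv w) (nr T e)))
  + \sum_(e | face_of M T e) Je e (pdot (pmul (vg v e) (nr T e)) w).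

Definition Ldiv v T (w : mp) : R :=
  - IT T (pdot (v0 v T) (grad w))
  + \sum_(e | face_of M T e) Je e (pdn (vb v e) (nr T e) * w).

Definition Lgrad q T (w : row) : R :=
  - IT T (q0 q T * divv w)
  + \sum_(e | face_of M T e) Je e (qb q e * pdn w (nr T e)).

Lemma is_weak_laplE v T D : is_weak_lapl M k v T D <->
  degle_mx (k - 2)%N D /\ forall w, degle_mx (k - 2)%N w -> IT T (pdot D w) = Llapl v T w.
Proof.
have EQ w : (elt_integral M T (fun x => dotp (evm D x) (evm w x)) =
    elt_integral M T (fun x => dotp (evm (v0 v T) x) (evm (laplv w) x))
    - bd_integral M T (fun e x =>
        dotp (evm (vb v e) x) (mxdot (evm (gradv w) x) (nrm M T e)))
    + bd_integral M T (fun e x =>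
        dotp (mxdot (evm (vg v e) x) (nrm M T e)) (evm w x))) <->
   (IT T (pdot D w) = Llapl v T w).
  rewrite (@elt_integralE _ _ _ _ M T _ (pdot D w)); last by move=> x; rewrite ev_pdot.
  rewrite (@elt_integralE _ _ _ _ M T _ (pdot (v0 v T) (laplv w))); last by move=> x; rewrite ev_pdot.
  rewrite (@bd_integralE _ _ _ _ M T _ (fun e => pdot (vb v e) (pmul (gradv w) (nr T e)))); last first.
    by move=> e x; rewrite ev_pdot evm_pmul.
  rewrite (@bd_integralE _ _ _ _ M T _ (fun e => pdot (pmul (vg v e) (nr T e)) w)) //.
  by move=> e x; rewrite ev_pdot evm_pmul.
by split => -[h1 h2]; split => // w hw; apply/EQ; exact: h2.
Qed.

Lemma is_weak_divE v T D : is_weak_div M k v T D <->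
  degle (k - 1)%N D /\ forall w, degle (k - 1)%N w -> IT T (D * w) = Ldiv v T w.
Proof.
have EQ w : (elt_integral M T (fun x => ev D x * ev w x) =
    - elt_integral M T (fun x => dotp (evm (v0 v T) x) (evm (grad w) x))
    + bd_integral M T (fun e x => dotp (evm (vb v e) x) (nrm M T e) * ev w x)) <->
   (IT T (D * w) = Ldiv v T w).
  rewrite (@elt_integralE _ _ _ _ M T _ (D * w)); last by move=> x; rewrite evM.
  rewrite (@elt_integralE _ _ _ _ M T _ (pdot (v0 v T) (grad w))); last by move=> x; rewrite ev_pdot.
  rewrite (@bd_integralE _ _ _ _ M T _ (fun e => pdn (vb v e) (nr T e) * w)) //.
  by move=> e x; rewrite evM ev_pdn.
by split => -[h1 h2]; split => // w hw; apply/EQ; exact: h2.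
Qed.

Lemma is_weak_gradE q T G : is_weak_grad M k q T G <->
  degle_mx (k - 2)%N G /\ forall w, degle_mx (k - 2)%N w -> IT T (pdot G w) = Lgrad q T w.
Proof.
have EQ w : (elt_integral M T (fun x => dotp (evm G x) (evm w x)) =
    - elt_integral M T (fun x => ev (q0 q T) x * ev (divv w) x)
    + bd_integral M T (fun e x => ev (qb q e) x * dotp (evm w x) (nrm M T e))) <->
   (IT T (pdot G w) = Lgrad q T w).
  rewrite (@elt_integralE _ _ _ _ M T _ (pdot G w)); last by move=> x; rewrite ev_pdot.
  rewrite (@elt_integralE _ _ _ _ M T _ (q0 q T * divv w)); last by move=> x; rewrite evM.
  rewrite (@bd_integralE _ _ _ _ M T _ (fun e => qb q e * pdn w (nr T e))) //.
  by move=> e x; rewrite evM ev_pdn.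
by split => -[h1 h2]; split => // w hw; apply/EQ; exact: h2.
Qed.

Lemma Llapl_linr v T a w w' : Llapl v T (C a *: w + w') = a * Llapl v T w + Llapl v T w'.
Proof.
rewrite /Llapl -lin3; congr (_ - _ + _).
- by rewrite laplv_lin pdot_linr IT_lin.
- by apply: Jsum_lin => e; rewrite gradv_lin pmul_lin pdot_linr.
- by apply: Jsum_lin => e; rewrite pdot_linr.
Qed.

Lemma Ldiv_linr v T a w w' : Ldiv v T (a *: w + w') = a * Ldiv v T w + Ldiv v T w'.
Proof.
rewrite /Ldiv -lin2; congr (- _ + _).
- by rewrite grad_lin pdot_linr IT_lin.
- by apply: Jsum_lin => e; rewrite mulrDr -scalerAr.
Qed.

Lemma Lgrad_linr q T a w w' : Lgrad q T (C a *: w + w') = a * Lgrad q T w + Lgrad q T w'.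
Proof.
rewrite /Lgrad -lin2; congr (- _ + _).
- by rewrite divv_lin mulrDr -scalerAr IT_lin.
- by apply: Jsum_lin => e; rewrite pdn_lin mulrDr -scalerAr.
Qed.

(** By [riesz] the [xget] in [weak_lapl] does not fall back on its default value. *)
Lemma weak_laplP v T : is_weak_lapl M k v T (weak_lapl M k v T).
Proof.
have [D dD hD] := riesz T (k - 2)%N (Llapl_linr v T).
by apply: (@xgetPex _ 0 [set D | is_weak_lapl M k v T D]); exists D; apply/is_weak_laplE.
Qed.

Lemma weak_divP v T : is_weak_div M k v T (weak_div M k v T).
Proof.
have [D dD hD] := riesz1 T (k - 1)%N (Ldiv_linr v T).
by apply: (@xgetPex _ 0 [set D | is_weak_div M k v T D]); exists D; apply/is_weak_divE.
Qed.

Lemma weak_gradP q T : is_weak_grad M k q T (weak_grad M k q T).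
Proof.
have [D dD hD] := riesz T (k - 2)%N (Lgrad_linr q T).
by apply: (@xgetPex _ 0 [set D | is_weak_grad M k q T D]); exists D; apply/is_weak_gradE.
Qed.

Lemma weak_lapl_unique v T D : degle_mx (k - 2)%N D ->
  (forall w, degle_mx (k - 2)%N w -> IT T (pdot D w) = Llapl v T w) -> weak_lapl M k v T = D.
Proof.
by move=> dD hD; have /is_weak_laplE[d h] := weak_laplP v T; exact: riesz_unique d h dD hD.
Qed.

Lemma weak_div_unique v T D : degle (k - 1)%N D ->
  (forall w, degle (k - 1)%N w -> IT T (D * w) = Ldiv v T w) -> weak_div M k v T = D.
Proof.
by move=> dD hD; have /is_weak_divE[d h] := weak_divP v T; exact: riesz1_unique d h dD hD.
Qed.

Lemma weak_grad_unique q T D : degle_mx (k - 2)%N D ->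
  (forall w, degle_mx (k - 2)%N w -> IT T (pdot D w) = Lgrad q T w) -> weak_grad M k q T = D.
Proof.
by move=> dD hD; have /is_weak_gradE[d h] := weak_gradP q T; exact: riesz_unique d h dD hD.
Qed.

(** [wg] and [wp] are bare records without module structure; [wgl] and [wpl] supply their linear
    combinations. *)
Definition wgl a v v' : @wg R n.+1 E F :=
  Wg (fun T => C a *: v0 v T + v0 v' T) (fun e => C a *: vb v e + vb v' e)
     (fun e => C a *: vg v e + vg v' e).

Definition wpl a q q' : @wp R n.+1 E F :=
  Wp (fun T => a *: q0 q T + q0 q' T) (fun e => a *: qb q e + qb q' e).

Lemma Llapl_linl a v v' T w : Llapl (wgl a v v') T w = a * Llapl v T w + Llapl v' T w.
Proof.
rewrite /Llapl -lin3; congr (_ - _ + _).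
- by rewrite (pdot_lin a (v0 v T) (v0 v' T)) IT_lin.
- by apply: Jsum_lin => e; rewrite (pdot_lin a (vb v e) (vb v' e)).
- by apply: Jsum_lin => e; rewrite (pmul_lin a (vg v e) (vg v' e)) pdot_lin.
Qed.

Lemma Ldiv_linl a v v' T w : Ldiv (wgl a v v') T w = a * Ldiv v T w + Ldiv v' T w.
Proof.
rewrite /Ldiv -lin2; congr (- _ + _).
- by rewrite (pdot_lin a (v0 v T) (v0 v' T)) IT_lin.
- by apply: Jsum_lin => e; rewrite (pdn_lin a (vb v e) (vb v' e)) mulrDl -scalerAl.
Qed.

Lemma Lgrad_linl a q q' T w : Lgrad (wpl a q q') T w = a * Lgrad q T w + Lgrad q' T w.
Proof.
rewrite /Lgrad -lin2; congr (- _ + _).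
- by rewrite (mulrDl (a *: q0 q T)) -scalerAl IT_lin.
- by apply: Jsum_lin => e; rewrite (mulrDl (a *: qb q e)) -scalerAl.
Qed.

Lemma weak_lapl_lin a v v' T :
  weak_lapl M k (wgl a v v') T = C a *: weak_lapl M k v T + weak_lapl M k v' T.
Proof.
have /is_weak_laplE[d h] := weak_laplP v T; have /is_weak_laplE[d' h'] := weak_laplP v' T.
apply: weak_lapl_unique => [|w dw]; first exact: degle_mx_lin.
by rewrite Llapl_linl -(h w dw) -(h' w dw) pdot_lin IT_lin.
Qed.

Lemma weak_div_lin a v v' T :
  weak_div M k (wgl a v v') T = a *: weak_div M k v T + weak_div M k v' T.
Proof.
have /is_weak_divE[d h] := weak_divP v T; have /is_weak_divE[d' h'] := weak_divP v' T.
apply: weak_div_unique => [|w dw]; first exact: degle_lin.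
by rewrite Ldiv_linl -(h w dw) -(h' w dw) mulrDl -scalerAl IT_lin.
Qed.

Lemma weak_grad_lin a q q' T :
  weak_grad M k (wpl a q q') T = C a *: weak_grad M k q T + weak_grad M k q' T.
Proof.
have /is_weak_gradE[d h] := weak_gradP q T; have /is_weak_gradE[d' h'] := weak_gradP q' T.
apply: weak_grad_unique => [|w dw]; first exact: degle_mx_lin.
by rewrite Lgrad_linl -(h w dw) -(h' w dw) pdot_lin IT_lin.
Qed.

End Weak.

(** * The stabilized form *)

Section SquareForm.
Context {R : realType} {d : nat} {E F : finType} {X : Type}.
Local Notation mp := (mpoly.mpoly d R).
Local Notation C := (mpoly.mpolyC d (R := R)).
Variables (lin : R -> X -> X -> X) (I : E -> mp -> R) (J : F -> mp -> R) (ft : E -> F -> bool)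
  (c h : E -> R) (r : X -> E -> 'rV[mp]_d) (dv : X -> E -> mp)
  (d0 : X -> E -> F -> 'rV[mp]_d) (d1 : X -> E -> F -> 'M[mp]_d) (d2 : X -> E -> F -> mp).
Hypothesis Ilin : forall T a p q, I T (a *: p + q) = a * I T p + I T q.
Hypothesis Jlin : forall e a p q, J e (a *: p + q) = a * J e p + J e q.
Hypothesis rlin : forall a x y T, r (lin a x y) T = C a *: r x T + r y T.
Hypothesis dvlin : forall a x y T, dv (lin a x y) T = a *: dv x T + dv y T.
Hypothesis d0lin : forall a x y T e, d0 (lin a x y) T e = C a *: d0 x T e + d0 y T e.
Hypothesis d1lin : forall a x y T e, d1 (lin a x y) T e = C a *: d1 x T e + d1 y T e.
Hypothesis d2lin : forall a x y T e, d2 (lin a x y) T e = a *: d2 x T e + d2 y T e.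
Hypothesis c_gt0 : forall T, 0 < c T.
Hypothesis h_gt0 : forall T, 0 < h T.
Hypothesis I_ge0 : forall T p, 0 <= I T (p * p).
Hypothesis J_ge0 : forall e p, 0 <= J e (p * p).

(** The common shape of [a + s_1 + s_2]: products of residuals and jumps that are linear in the
    pair, with positive weights. The functionals [I] and [J] are left abstract, so that symmetry,
    linearity and positivity are pure algebra. *)
Definition sqform (x y : X) : R :=
  \sum_T (I T (pdot (r x T) (r y T)) + I T (dv x T * dv y T))
  + \sum_T (c T * (\sum_(e | ft T e) J e (pdot (d0 x T e) (d0 y T e)))
           + h T * (\sum_(e | ft T e) J e (pdot (d1 x T e) (d1 y T e))))
  + \sum_T (h T * (\sum_(e | ft T e) J e (d2 x T e * d2 y T e))).

Lemma sqform_sym x y : sqform x y = sqform y x.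
Proof.
rewrite /sqform; congr (_ + _ + _); apply: eq_bigr => T _.
- by congr (_ + _); rewrite ?[pdot (r x T) _]pdotC ?[dv x T * _]mulrC.
- by congr (_ * _ + _ * _); apply: eq_bigr => e _; congr J; exact: pdotC.
- by congr (_ * _); apply: eq_bigr => e _; congr J; exact: mulrC.
Qed.

Lemma sum_lin (K : finType) (P : pred K) a (f g k : K -> R) :
  (forall i, k i = a * f i + g i) ->
  \sum_(i | P i) k i = a * (\sum_(i | P i) f i) + \sum_(i | P i) g i.
Proof. by move=> hE; rewrite mulr_sumr -big_split; apply: eq_bigr => i _; rewrite hE. Qed.

Lemma sqform_lin a x x' y : sqform (lin a x x') y = a * sqform x y + sqform x' y.
Proof.
rewrite /sqform !mulrDr [RHS]addrACA [X in _ = X + _]addrACA; congr (_ + _ + _); apply: sum_lin => T.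
- rewrite rlin pdot_lin Ilin dvlin mulrDl -scalerAl Ilin.
  by rewrite mulrDr addrACA.
- rewrite mulrDr [RHS]addrACA; congr (_ + _).
    rewrite mulrCA -mulrDr; congr (_ * _); apply: sum_lin => e.
    by rewrite d0lin pdot_lin Jlin.
  rewrite mulrCA -mulrDr; congr (_ * _); apply: sum_lin => e.
  by rewrite d1lin pdot_lin Jlin.
- rewrite mulrCA -mulrDr; congr (_ * _); apply: sum_lin => e.
  by rewrite d2lin mulrDl -scalerAl Jlin.
Qed.

Lemma I_pdot_ge0 T m l (A : 'M[mp]_(m, l)) : 0 <= I T (pdot A A).
Proof.
rewrite (scl_sum (Ilin T)) sumr_ge0// => i _.
by rewrite (scl_sum (Ilin T)) sumr_ge0.
Qed.

Lemma J_pdot_ge0 e m l (A : 'M[mp]_(m, l)) : 0 <= J e (pdot A A).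
Proof.
rewrite (scl_sum (Jlin e)) sumr_ge0// => i _.
by rewrite (scl_sum (Jlin e)) sumr_ge0.
Qed.

Lemma sqform_eq0 x : sqform x x = 0 -> forall T,
  [/\ I T (pdot (r x T) (r x T)) = 0, I T (dv x T * dv x T) = 0 &
    forall e, ft T e -> [/\ J e (pdot (d0 x T e) (d0 x T e)) = 0,
      J e (pdot (d1 x T e) (d1 x T e)) = 0 & J e (d2 x T e * d2 x T e) = 0]].
Proof.
have a_ge0 T := I_pdot_ge0 T (r x T).
have s1_ge0 T : 0 <= c T * (\sum_(e | ft T e) J e (pdot (d0 x T e) (d0 x T e))).
  by rewrite mulr_ge0 ?(ltW (c_gt0 T))// sumr_ge0// => e _; exact: J_pdot_ge0.
have s1'_ge0 T : 0 <= h T * (\sum_(e | ft T e) J e (pdot (d1 x T e) (d1 x T e))).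
  by rewrite mulr_ge0 ?(ltW (h_gt0 T))// sumr_ge0// => e _; exact: J_pdot_ge0.
have s2_ge0 T : 0 <= h T * (\sum_(e | ft T e) J e (d2 x T e * d2 x T e)).
  by rewrite mulr_ge0 ?(ltW (h_gt0 T))// sumr_ge0.
rewrite /sqform -!big_split /= => /eqP.
rewrite psumr_eq0 => [/allP h0 T|T _]; last by rewrite !addr_ge0.
have := h0 T (mem_index_enum _); rewrite /= !paddr_eq0 ?addr_ge0//.
case/andP => /andP[/andP[/eqP h1 /eqP h2] /andP[h3 h4]] h5.
split=> // e Te; move: h3 h4 h5; rewrite !mulf_eq0 (gt_eqF (h_gt0 T)) (gt_eqF (c_gt0 T)) /=.
rewrite psumr_eq0 => [/allP h3|e' _]; last exact: J_pdot_ge0.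
rewrite psumr_eq0 => [/allP h4|e' _]; last exact: J_pdot_ge0.
rewrite psumr_eq0 => [/allP h5|e' _]; last exact: J_ge0.
split.
- exact/eqP/(implyP (h3 e (mem_index_enum _)))/Te.
- exact/eqP/(implyP (h4 e (mem_index_enum _)))/Te.
- exact/eqP/(implyP (h5 e (mem_index_enum _)))/Te.
Qed.

Lemma sqform_nullr x y :
  (forall T, [/\ r y T = 0, dv y T = 0 & forall e, ft T e ->
    [/\ J e (pdot (d0 x T e) (d0 y T e)) = 0, J e (pdot (d1 x T e) (d1 y T e)) = 0 &
     J e (d2 x T e * d2 y T e) = 0]]) -> sqform x y = 0.
Proof.
move=> h0; rewrite /sqform.
have pdot0 (A : 'rV[mp]_d) : pdot A 0 = 0.
  by rewrite /pdot big1// => i _; rewrite big1// => j _; rewrite mxE mulr0.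
rewrite big1 => [|T _]; last first.
  by have [-> -> _] := h0 T; rewrite pdot0 mulr0 (scl0 (Ilin T)) addr0.
rewrite big1 => [|T _]; last first.
  have [_ _ hT] := h0 T; rewrite big1 => [|e /hT[]//].
  by rewrite mulr0 add0r big1 ?mulr0// => e /hT[].
rewrite big1 ?addr0// => T _.
by have [_ _ hT] := h0 T; rewrite big1 ?mulr0// => e /hT[].
Qed.

End SquareForm.

Section Forms.
Context {R : realType} {n : nat} {E F : finType}.
Variables (Omega : set 'rV[R]_n.+1) (M : @mesh R n.+1 E F) (rho : R) (k : nat).
Hypothesis hM : is_mesh Omega M rho.
Local Notation mp := (mpoly.mpoly n.+1 R).
Local Notation C := (mpoly.mpolyC n.+1 (R := R)).
Local Notation row := ('rV[mp]_n.+1).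
Local Notation IT := (IT M).
Local Notation Je := (Je M).
Local Notation wg := (@wg R n.+1 E F).
Local Notation wp := (@wp R n.+1 E F).
Implicit Types (a : R) (T : E) (e : F) (u v w : wg) (p q : wp).

(** An open nonempty element contains two distinct points; boundedness is needed for the [sup] in
    [diam] to bound their distance. *)
Lemma hT_gt0 T : 0 < hT M T.
Proof.
have [_ [r hr]] := mesh_nice hM T.
have [[x Tx] oT _ _ _] := mesh_elt hM T.
have /nbhs_ballP[s /= s0 hs] : nbhs x (elt M T) by exact: open_nbhs_nbhs.
have [t t0 ht] := small_move (delta_mx 0 0 : 'rV[R]_n.+1) s0.
pose y : 'rV[R]_n.+1 := x + t *: delta_mx 0 0.
have Ty : elt M T y by apply/hs/ht; rewrite gtr0_norm.
have r0 : 0 <= r by rewrite (le_trans _ (hr _ Tx 0)).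
pose D := [set enorm (a - b) | a in elt M T & b in elt M T].
have ubD : has_ubound D.
  exists (Num.sqrt (\sum_(i < n.+1) (r + r) ^+ 2)) => _ [z Tz [z' Tz' <-]].
  rewrite ler_sqrt; last by rewrite sumr_ge0// => i _; rewrite sqr_ge0.
  rewrite dotpE ler_sum// => i _; rewrite !mxE -expr2 -[leLHS]real_normK ?num_real//.
  rewrite lerXn2r ?nnegrE ?normr_ge0 ?addr_ge0// (le_trans (ler_normB _ _))//.
  by rewrite lerD ?hr.
have : enorm (y - x) <= sup D by apply: ub_le_sup => //; exists y => //; exists x.
apply: lt_le_trans; apply: lt_le_trans (le_enorm (y - x) 0).
by rewrite /y !mxE !eqxx mulr1 addrAC subrr add0r normr_gt0 gt_eqF.
Qed.

(** The residual of the momentum equation; the load depends on the test pair only through it. *)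
Definition rsd u p T : row := - weak_lapl M k u T + weak_grad M k p T.

Lemma rsd_lin a u u' p p' T : rsd (wgl a u u') (wpl a p p') T = C a *: rsd u p T + rsd u' p' T.
Proof.
rewrite /rsd (weak_lapl_lin _ hM a u u' T) (weak_grad_lin _ hM a p p' T) scalerDr scalerN opprD.
exact: addrACA.
Qed.

Definition wlin a (x y : wg * wp) : wg * wp := (wgl a x.1 y.1, wpl a x.2 y.2).

Definition rsdx (x : wg * wp) T := rsd x.1 x.2 T.
Definition divx (x : wg * wp) T := weak_div M k x.1 T.
Definition jump0 (x : wg * wp) T e : row := v0 x.1 T - vb x.1 e.
Definition jump1 (x : wg * wp) T e : 'M[mp]_n.+1 := gradv (v0 x.1 T) - vg x.1 e.
Definition jump2 (x : wg * wp) T e : mp := q0 x.2 T - qb x.2 e.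

Definition Bform := sqform IT Je (face_of M) (fun T => (hT M T)^-1) (hT M) rsdx divx jump0 jump1 jump2.

Lemma form_aE u p v q : form_a M k u p v q =
  \sum_T (IT T (pdot (rsd u p T) (rsd v q T)) + IT T (weak_div M k u T * weak_div M k v T)).
Proof.
have evr w s T x : - evm (weak_lapl M k w T) x + evm (weak_grad M k s T) x = evm (rsd w s T) x.
  by rewrite -evmN -evmD.
apply: eq_bigr => T _; apply: (congr2 +%R); apply: elt_integralE => x; last first.
  exact: (esym (evM _ _ _)).
exact: (etrans (congr2 dotp (evr u p T x) (evr v q T x)) (esym (ev_pdot _ _ _))).
Qed.

Lemma form_s1E u v p q : form_s1 M u v = \sum_T
  ((hT M T)^-1 * (\sum_(e | face_of M T e) Je e (pdot (jump0 (u, p) T e) (jump0 (v, q) T e)))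
   + hT M T * (\sum_(e | face_of M T e) Je e (pdot (jump1 (u, p) T e) (jump1 (v, q) T e)))).
Proof.
apply: eq_bigr => T _; apply: (congr2 +%R); apply: (congr2 *%R) => //; apply: bd_integralE => e x.
  exact: (etrans (congr2 dotp (esym (evmB _ _ _)) (esym (evmB _ _ _))) (esym (ev_pdot _ _ _))).
exact: (etrans (congr2 dotp (esym (evmB _ _ _)) (esym (evmB _ _ _))) (esym (ev_pdot _ _ _))).
Qed.

Lemma form_s2E p q u v : form_s2 M p q = \sum_T
  (hT M T * (\sum_(e | face_of M T e) Je e (jump2 (u, p) T e * jump2 (v, q) T e))).
Proof.
apply: eq_bigr => T _; apply: (congr2 *%R) => //; apply: bd_integralE => e x.
exact: (etrans (congr2 *%R (esym (evB _ _ _)) (esym (evB _ _ _))) (esym (evM _ _ _))).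
Qed.

Lemma BformE u p v q : form_a M k u p v q + form_s1 M u v + form_s2 M p q = Bform (u, p) (v, q).
Proof. exact: (congr2 +%R (congr2 +%R (form_aE u p v q) (form_s1E u v p q)) (form_s2E p q u v)). Qed.

Lemma Bform_sym x y : Bform x y = Bform y x.
Proof. exact: sqform_sym. Qed.

Lemma Bform_lin a x x' y : Bform (wlin a x x') y = a * Bform x y + Bform x' y.
Proof.
apply: sqform_lin.
- exact: (IT_linear hM).
- exact: (Je_linear hM).
- move=> b z z' T; exact: rsd_lin.
- move=> b z z' T; exact: (weak_div_lin _ hM).
- by move=> b z z' T e; rewrite /jump0 /= scalerBr opprD addrACA.
- by move=> b z z' T e; rewrite /jump1 /= gradv_lin scalerBr opprD addrACA.
- by move=> b z z' T e; rewrite /jump2 /= scalerBr opprD addrACA.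
Qed.

(** Zero energy in pointwise form. On the open elements the residuals vanish as polynomials; a jump
    vanishes only at the points of the face, where other polynomials may have the same values. *)
Definition null_pair (x : wg * wp) := forall T,
  [/\ rsdx x T = 0, divx x T = 0 & forall e y, face_of M T e -> face M e y ->
    [/\ evm (jump0 x T e) y = 0, evm (jump1 x T e) y = 0 & ev (jump2 x T e) y = 0]].

Lemma Bform_null x : Bform x x = 0 -> null_pair x.
Proof.
move=> B0 T; have [||||||h1 h2 h3] := sqform_eq0 _ _ _ _ _ _ B0 T.
- exact: (IT_linear hM).
- exact: (Je_linear hM).
- by move=> T'; rewrite invr_gt0; exact: hT_gt0.
- exact: hT_gt0.
- exact: IT_sqr_ge0.
- exact: (Je_sqr_ge0 hM).
split; [exact: (IT_pdot_eq0 hM) h1|exact: (IT_sqr_eq0 hM) h2|].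
move=> e y Te ey; have [j0 j1 j2] := h3 e Te; split.
- exact: (Je_pdot_eq0 hM) j0 _ ey.
- exact: (Je_pdot_eq0 hM) j1 _ ey.
- exact: (Je_sqr_eq0 hM) j2 _ ey.
Qed.

Lemma Je0 e (P : mp) : (forall x, face M e x -> ev P x = 0) -> Je e P = 0.
Proof.
move=> h; apply: etrans (scl0 (Je_linear hM e)); apply: eq_Je => x ex.
exact: (etrans (h x ex) (esym (ev0 x))).
Qed.

(** [x] is arbitrary: the lifted boundary datum, which need not vanish on the boundary, is
    orthogonal to the pairs of zero energy too. *)
Lemma Bform_nullr x y : null_pair y -> Bform x y = 0.
Proof.
move=> h; apply: sqform_nullr; first exact: (IT_linear hM).
move=> T; have [h1 h2 h3] := h T; split => // e Te; split; apply: Je0 => z ez;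
  have [j0 j1 j2] := h3 e z Te ez.
- by rewrite ev_pdot j0 dotp0.
- by rewrite ev_pdot j1 dotp0.
- by rewrite evM j2 mulr0.
Qed.

End Forms.

(** * Existence *)

Section Existence.
Context {R : realType} {n : nat} {E F : finType}.
Variables (Omega : set 'rV[R]_n.+1) (M : @mesh R n.+1 E F) (rho : R) (k : nat).
Hypothesis hM : is_mesh Omega M rho.
Hypothesis oOmega : open Omega.
Local Notation mp := (mpoly.mpoly n.+1 R).
Local Notation C := (mpoly.mpolyC n.+1 (R := R)).
Local Notation row := ('rV[mp]_n.+1).
Local Notation IT := (IT M).
Local Notation wg := (@wg R n.+1 E F).
Local Notation wp := (@wp R n.+1 E F).

Section Load.
Variable f : 'rV[R]_n.+1 -> 'rV[R]_n.+1.
Hypothesis hf : forall i, L2_on Omega (fun x => f x 0 i).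

(** The product is dominated by the sum of the two squares; that of the polynomial is integrable
    because the element is bounded. *)
Lemma L2_mul_integrable T i (p : mp) :
  (lebesgue n.+1).-integrable (vec @^-1` elt M T) (fun t => (f (vec t) 0 i * ev p (vec t))%:E).
Proof.
have [mf if2] := hf i; have nT := mesh_nice hM T; have [mT _] := nT.
have mO := open_measurable_vec oOmega.
have sub : vec @^-1` elt M T `<=` vec @^-1` Omega by move=> t; exact: mesh_elt_sub hM _ _.
have mfT := measurable_funS mO sub mf.
have if2T := integrableS mO mT sub if2.
have ip := ev_integrable (p * p) nT.
apply: (@le_integrable _ _ _ _ _ mT _ (fun t => (f (vec t) 0 i ^+ 2)%:E + (ev (p * p) (vec t))%:E)%E).
- apply/measurable_EFinP; apply: measurable_funM => //.
  exact: measurable_funS (ev_measurable p).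
- move=> t _; rewrite -EFinD !abse_EFin lee_fin evM -expr2.
  set a := f _ _ _; set b := ev _ _.
  rewrite (ger0_norm (addr_ge0 (sqr_ge0 a) (sqr_ge0 b))) normrM -(real_normK (num_real a)) -(real_normK (num_real b)).
  set x := `|a|; set y := `|b|.
  have := sqr_ge0 (x - y); have : 0 <= x * y by rewrite mulr_ge0 ?normr_ge0.
  by nra.
- exact: integrableD.
Qed.

Definition load1 T (w : row) : R := elt_integral M T (fun x => dotp (f x) (evm w x)).

Lemma load1_lin T a w w' : load1 T (C a *: w + w') = a * load1 T w + load1 T w'.
Proof.
have [mT _] := mesh_nice hM T.
have iw (v : row) : (lebesgue n.+1).-integrable (vec @^-1` elt M T)
    (EFin \o (fun t => dotp (f (vec t)) (evm v (vec t)))).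
  rewrite (_ : _ \o _ = fun t => (\sum_i (f (vec t) 0 i * ev (v 0 i) (vec t))%:E)%E).
    by apply: integrable_sum => [|i _]; [exact: mT|exact: L2_mul_integrable].
  apply/funext => t /=; rewrite dotpE -sumEFin; apply: eq_bigr => i _.
  by rewrite mxE.
rewrite /load1 /elt_integral /integral_on.
rewrite -RintegralZl// -RintegralD//.
  by apply: eq_Rintegral => t _; rewrite evm_lin dotpDr dotpZr.
rewrite (_ : EFin \o _ = (fun t => a%:E * (EFin \o (fun t => dotp (f (vec t)) (evm w (vec t)))) t)%E).
  exact: integrableZl.
by apply/funext.
Qed.

Lemma loadE (x : wg * wp) : load M k f x.1 x.2 = \sum_T load1 T (rsdx M k x T).
Proof.
apply: eq_bigr => T _; congr integral_on; apply/funext => y.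
by apply: (congr1 (dotp (f y))); rewrite -evmN -evmD.
Qed.

Definition loadx (x : wg * wp) := load M k f x.1 x.2.

Lemma loadx_lin a x y : loadx (wlin a x y) = a * loadx x + loadx y.
Proof.
apply: etrans (loadE _) _; apply: etrans (esym (congr2 (fun r s => a * r + s) (loadE x) (loadE y))).
apply: sum_lin => T; apply: etrans (load1_lin _ _ _ _).
by apply: (congr1 (load1 T)); exact: (rsd_lin k hM).
Qed.

Lemma loadx_null x : null_pair M k x -> loadx x = 0.
Proof.
move=> h; apply: etrans (loadE _) _; apply: big1 => T _; have [h1 _ _] := h T.
apply: etrans (congr1 (load1 T) h1) _.
have := load1_lin T (-1) 0 0; rewrite scaler0 addr0 mulN1r addNr.
exact.
Qed.

End Load.

Definition in_X0 (x : wg * wp) := in_W0 Omega M k x.1 /\ in_V M k x.2.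

Lemma sum_ITE (q : wp) : \sum_T elt_integral M T (ev (q0 q T)) = \sum_T IT T (q0 q T).
Proof. by apply: eq_bigr => T _; exact: elt_integralE. Qed.

Lemma in_W_lin a (u v : wg) : in_W k u -> in_W k v -> in_W k (wgl a u v).
Proof.
by move=> [h1 h2 h3] [h1' h2' h3']; split => [T|e|e]; apply: degle_mx_lin.
Qed.

Lemma in_V_lin a (p q : wp) : in_V M k p -> in_V M k q -> in_V M k (wpl a p q).
Proof.
move=> [h1 h2 h3] [h1' h2' h3']; split => [T||e]; [exact: degle_lin| |exact: degle_lin].
have := sum_lin xpredT (a := a) (f := fun T => IT T (q0 p T)) (g := fun T => IT T (q0 q T))
  (k := fun T => IT T (q0 (wpl a p q) T)) (fun T => IT_linear hM T a _ _).
by move: h2 h2'; rewrite !sum_ITE => -> ->; rewrite mulr0 addr0.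
Qed.

Lemma in_X0_lin a x y : in_X0 x -> in_X0 y -> in_X0 (wlin a x y).
Proof.
move=> [[h1 h2] h3] [[h1' h2'] h3']; split; last exact: in_V_lin.
split; first exact: in_W_lin.
by move=> e be z ez; rewrite /= evm_lin h2// h2'// scaler0 addr0.
Qed.

Definition wg0 : wg := Wg (fun=> 0) (fun=> 0) (fun=> 0).
Definition wp0 : wp := Wp (fun=> 0) (fun=> 0).

Lemma in_V0 : in_V M k wp0.
Proof.
split => [T||e]; [exact: degle0| |exact: degle0].
by rewrite sum_ITE big1// => T _; exact: (scl0 (IT_linear hM T)).
Qed.

Lemma in_X0_0 : in_X0 (wg0, wp0).
Proof.
split; last exact: in_V0.
by split => [|e _ z _]; [split => ?; exact: degle_mx0|exact: evm0].
Qed.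

Local Notation bm := (mpoly.bmultinom n.+1 k.+1).
(* Every component is given by coefficients up to degree k; the smaller degrees
   of some of them are part of the constraint in_X0. *)
Definition dofs : finType := (E * 'I_n.+1 * bm + F * 'I_n.+1 * bm + F * 'I_n.+1 * 'I_n.+1 * bm
  + E * bm + F * bm)%type.

Definition of_dofs (u : 'rV[R]_#|dofs|) : wg * wp :=
  (Wg (fun T => \row_i polc (fun m => cf u (inl (inl (inl (inl (T, i, m)))))))
      (fun e => \row_i polc (fun m => cf u (inl (inl (inl (inr (e, i, m)))))))
      (fun e => \matrix_(i, j) polc (fun m => cf u (inl (inl (inr (e, i, j, m)))))),
   Wp (fun T => polc (fun m => cf u (inl (inr (T, m)))))
      (fun e => polc (fun m => cf u (inr (e, m))))).

Lemma of_dofs_lin a u v : of_dofs (a *: u + v) = wlin a (of_dofs u) (of_dofs v).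
Proof.
have P (g : bm -> dofs) : polc (fun m => cf (a *: u + v) (g m)) =
    a *: polc (fun m => cf u (g m)) + polc (fun m => cf v (g m)).
  by rewrite -polc_lin; congr polc; apply/funext => m; rewrite cf_lin.
congr pair.
  congr Wg; apply/funext => ?; apply/matrixP => i j; rewrite !mxE CE; exact: P.
by congr Wp; apply/funext => ?; exact: P.
Qed.

Lemma of_dofs_surj x : in_X0 x -> exists u, of_dofs u = x.
Proof.
case: x => -[w0 wb wgr] [p0 pb] [[[/= h1 h2 h3] _] [/= h4 _ h5]].
have kk r (p : mp) : degle (k - r)%N p -> degle k p by apply: degle_le; exact: leq_subr.
have [u hu] := cf_surj (fun j : dofs => match j with
  | inl (inl (inl (inl (T, i, m)))) => mpoly.mcoeff (mpoly.bmnm m) (w0 T 0 i)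
  | inl (inl (inl (inr (e, i, m)))) => mpoly.mcoeff (mpoly.bmnm m) (wb e 0 i)
  | inl (inl (inr (e, i, j, m))) => mpoly.mcoeff (mpoly.bmnm m) (wgr e i j)
  | inl (inr (T, m)) => mpoly.mcoeff (mpoly.bmnm m) (p0 T)
  | inr (e, m) => mpoly.mcoeff (mpoly.bmnm m) (pb e)
  end).
exists u; rewrite /of_dofs hu; congr pair; [congr Wg|congr Wp]; apply/funext => y.
- by apply/rowP => i; rewrite mxE (polc_coef (h1 y 0 i)).
- by apply/rowP => i; rewrite mxE (polc_coef (h2 y 0 i)).
- by apply/matrixP => i j; rewrite mxE (polc_coef (kk _ _ (h3 y i j))).
- by rewrite (polc_coef (kk _ _ (h4 y))).
- by rewrite (polc_coef (kk _ _ (h5 y))).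
Qed.

Lemma of_dofs0 : of_dofs 0 = (wg0, wp0).
Proof.
have [u hu] := of_dofs_surj in_X0_0.
have := of_dofs_lin (-1) u u; rewrite scaleN1r addNr hu => ->.
by congr pair; [congr Wg|congr Wp]; apply/funext => ?; rewrite /= scaler0 addr0.
Qed.

(** [G] carries the boundary datum and [x] is the correction sought in the test space, with
    right-hand side the load minus [Bform G]. *)
Lemma wg_existence (f : 'rV[R]_n.+1 -> 'rV[R]_n.+1) (hf : forall i, L2_on Omega (fun x => f x 0 i)) (G : wg * wp) :
  exists2 x, in_X0 x & forall y, in_X0 y ->
    Bform M k x y + Bform M k G y = loadx f y.
Proof.
have [||||||u Pu hu] := @solvable R #|dofs| (fun u => in_X0 (of_dofs u))
  (fun u v => Bform M k (of_dofs u) (of_dofs v))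
  (fun u => loadx f (of_dofs u) - Bform M k G (of_dofs u)).
- by rewrite of_dofs0; exact: in_X0_0.
- by move=> a u v hu hv; rewrite of_dofs_lin; exact: in_X0_lin.
- by move=> u v; exact: Bform_sym.
- by move=> a u u' v; rewrite of_dofs_lin; exact: Bform_lin hM _ _ _ _.
- move=> a u v; rewrite of_dofs_lin (loadx_lin hf).
  have -> : Bform M k G (wlin a (of_dofs u) (of_dofs v)) =
     a * Bform M k G (of_dofs u) + Bform M k G (of_dofs v).
    apply: etrans (Bform_sym _ _ _ _) _; apply: etrans (Bform_lin k hM _ _ _ _) _.
    exact: (congr2 (fun r s => a * r + s) (Bform_sym _ _ _ _) (Bform_sym _ _ _ _)).
  move: (loadx _ _) (Bform _ _ _ _) (loadx _ _) (Bform _ _ _ _) => a1 a2 a3 a4.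
  by ring.
(* Orthogonality to the whole test space, tested on [u] itself, gives zero energy; then both parts
   of the right-hand side vanish. *)
- move=> u Pu hu; have /(Bform_null hM) nu := hu u Pu.
  by rewrite (loadx_null hf nu) (Bform_nullr hM G nu) subr0.
exists (of_dofs u) => // y Py; have [v hv] := of_dofs_surj Py.
have := hu v; rewrite hv => /(_ Py) ->; exact: subrK.
Qed.

End Existence.

(** * Piecewise constants on the mesh *)

(** [V] is a relation because the value to be propagated is attached to open elements and is missing
    on the faces. The sets [O u] where all nearby values equal [u] are open and cover [A]; density
    of the points with a value makes them disjoint on [A]. *)
Lemma connected_locally_constant (T : topologicalType) (A : set T) (S : Type)
    (V : T -> S -> Prop) : connected A ->
  (forall x, A x -> exists v, \forall y \near x, forall v', V y v' -> v' = v) ->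
  (forall x, A x -> forall N, nbhs x N -> exists2 y, N y & exists v, V y v) ->
  forall x y v w, A x -> A y -> V x v -> V y w -> v = w.
Proof.
move=> cA loc dns x y v w Ax Ay Vx Vy.
pose O (u : S) : set T := [set z : T | \forall t \near z, forall v', V t v' -> v' = u].
have oO u : open (O u) by rewrite openE => z; rewrite /O /= => /nbhs_interior.
have OO z u u' : A z -> O u z -> O u' z -> u = u'.
  move=> Az h h'; have [t [h1 h2] [a Va]] := dns z Az _ (filterI h h').
  by rewrite -(h1 _ Va) (h2 _ Va).
have Oval z u v' : O u z -> V z v' -> v' = u by move=> /nbhs_singleton; apply.
have Ox : O v x.
  by have [u hu] := loc x Ax; rewrite (Oval x u v hu Vx).
have BA : A `&` O v = A.
  apply: cA; first by exists x.
    by exists (O v).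
  exists (~` \bigcup_(u in [set u | u <> v]) O u).
    by apply: open_closedC; apply: bigcup_open => u _; exact: oO.
  apply/seteqP; split => z [Az Oz]; split => //.
    by move=> [u /= uv Ou]; apply: uv; exact: (OO z).
  have [u hu] := loc z Az; have [<-//|uv] := pselect (u = v).
  by exfalso; apply: Oz; exists u.
have : (A `&` O v) y by rewrite BA.
by move=> [_ /Oval]/(_ _ Vy).
Qed.

Section Connectivity.
Context {R : realType} {n : nat} {E F : finType}.
Variables (Omega : set 'rV[R]_n.+1) (M : @mesh R n.+1 E F) (rho : R).
Hypothesis hM : is_mesh Omega M rho.
Hypothesis hO : polyhedral_domain Omega.
Implicit Types (T : E) (e : F) (x y z : 'rV[R]_n.+1).

Lemma elt_open T : open (elt M T).
Proof. by case: (mesh_elt hM T). Qed.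

Lemma elt_unique T T' x : elt M T x -> elt M T' x -> T = T'.
Proof.
case: hM => -[_ h _] _ _ Tx T'x; apply: contrapT => /eqP /h h0.
by have : (elt M T `&` elt M T') x by []; rewrite h0.
Qed.

Lemma Omega_closure x : Omega x -> exists T, closure (elt M T) x.
Proof.
case: hM => -[_ _ h] _ _ Ox; have : closure Omega x by exact: subset_closure.
by rewrite h => -[T _ Tx]; exists T.
Qed.

Lemma inner_face_not_bface e x : face M e x -> Omega x -> ~~ bface Omega M e.
Proof.
move=> ex Ox; apply/asboolP => /(_ x ex)[_]; apply.
by rewrite (interior_id Omega).1//; case: hO.
Qed.

Lemma face_two e : ~~ bface Omega M e -> #|[pred T | face_of M T e]| = 2%N.
Proof. by case: hM => _ [_ _ _ _ h] _ nb; case: (h e) => -[//]; rewrite (negbTE nb). Qed.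

Lemma nrmP T e : face_of M T e -> outward_unit_normal (elt M T) (face M e) (nrm M T e).
Proof. exact: outward_normalP (mesh_outward hM (T := T)) _. Qed.

Lemma nrm_face T e : face_of M T e ->
  nrm M T e = face_normal (face M e) \/ nrm M T e = - face_normal (face M e).
Proof. by move=> Te; apply: unit_normal_unique (mesh_face hM e) _ _; have [] := nrmP Te. Qed.

(** With equal outward normals both elements would fill the same side of the face near a relative
    interior point, and would overlap. *)
Lemma nrm_opp T T' e : T != T' -> face_of M T e -> face_of M T' e -> nrm M T' e = - nrm M T e.
Proof.
move=> TT' Te T'e; have [->//|eqn] : nrm M T' e = - nrm M T e \/ nrm M T' e = nrm M T e.
  case: (nrm_face Te) => ->; case: (nrm_face T'e) => ->; rewrite ?opprK; tauto.
exfalso; have [_ _ [x relx] _ _] := mesh_face hM e.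
have [[n1 _] /(_ x relx)[r r0 hr]] := nrmP Te.
have [_ /(_ x relx)[r' r'0 hr']] := nrmP T'e.
have m0 : 0 < Num.min r r' by rewrite lt_min r0.
have [s s0 hs] := small_move (nrm M T e) m0.
have sb := hs (- s) _ x; rewrite normrN gtr0_norm// lexx in sb.
have {sb}/ballrV[_ sb] := sb isT.
have neg : dotp (nrm M T e) (x + - s *: nrm M T e - x) < 0.
  by rewrite addrAC subrr add0r dotpZr n1 mulr1 oppr_lt0.
have Ty : elt M T (x + - s *: nrm M T e).
  apply/hr => //; apply/ballrV; split => // i.
  by have := sb i; rewrite lt_min => /andP[].
have : elt M T' (x + - s *: nrm M T e).
  apply/hr'; rewrite ?eqn//; apply/ballrV; split => // i.
  by have := sb i; rewrite lt_min => /andP[].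
by move=> /(elt_unique Ty) /eqP; rewrite (negbTE TT').
Qed.

Lemma frontier_face T x : frontier (elt M T) x -> exists2 e, face_of M T e & face M e x.
Proof. by rewrite (mesh_frontier hM) => -[e]; exists e. Qed.

Section Color.
Variable c : E -> R.
Hypothesis hc : forall T T' e, face_of M T e -> face_of M T' e -> c T = c T'.

Let V x v := exists2 T, elt M T x & c T = v.

Section Segment.
Variables (z d : 'rV[R]_n.+1).
Let gam (t : R) := z + t *: d.
Hypothesis transv : forall e, dotp (face_normal (face M e)) d != 0.
Hypothesis generic : forall e t, face M e (gam t) -> relint (face M e) (gam t).

Let gam_near t (r : R) : 0 < r -> \forall s \near t, ball (gam t) r (gam s).
Proof.
move=> r0; have [e e0 he] := small_move d r0.
have hb : \forall s \near t, ball t e s by exact: nbhsx_ballx.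
apply: filterS hb => s hs; rewrite (_ : gam s = gam t + (s - t) *: d); last first.
  by rewrite /gam -addrA -scalerDl [t + _]addrC subrK.
by apply: he; rewrite distrC; exact: ltW.
Qed.

(** Where the segment crosses a face, the two elements sharing it lie on opposite sides, fill a
    punctured neighbourhood of [t] on the segment, and have the same colour by [hc]. *)
Lemma segment_near t : Omega (gam t) -> exists v,
  (\forall s \near t, forall v', V (gam s) v' -> v' = v) /\
  (\forall s \near t, s != t -> exists v', V (gam s) v') .
Proof.
move=> Ot; have [T clT] := Omega_closure Ot.
have [Tx|nTx] := pselect (elt M T (gam t)).
  have /nbhs_ballP[r /= r0 hr] : nbhs (gam t) (elt M T).
    by apply: open_nbhs_nbhs; split => //; exact: elt_open.
  exists (c T); split; apply: filterS (gam_near t r0) => s /hr Ts.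
    by move=> v' [T' T's <-]; rewrite (elt_unique Ts T's).
  by exists (c T), T.
have [e Te ex] : exists2 e, face_of M T e & face M e (gam t).
  apply: frontier_face; split => //.
  by rewrite (interior_id (elt M T)).1//; exact: elt_open.
have relx := generic ex.
have c2 := face_two (inner_face_not_bface ex Ot).
have [T' T'e TT'] : exists2 T', face_of M T' e & T != T'.
  have : (0 < #|[predD1 [pred T | face_of M T e] & T]|)%N.
    by have := cardD1 T [pred T | face_of M T e]; rewrite c2 inE Te add1n => -[<-].
  by move=> /card_gt0P[T']; rewrite !inE => /andP[]; exists T'; rewrite // eq_sym.
have [_ /(_ _ relx)[r r0 hr]] := nrmP Te.
have [_ /(_ _ relx)[r' r'0 hr']] := nrmP T'e.
have nd : dotp (nrm M T e) d != 0.
  case: (nrm_face Te) => ->; first exact: transv.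
  by rewrite dotpC dotpNr oppr_eq0 dotpC transv.
have diff s : gam s - gam t = (s - t) *: d.
  by rewrite /gam opprD addrACA subrr add0r scalerBl.
have cov : \forall s \near t, s != t -> elt M T (gam s) \/ elt M T' (gam s).
  have h1 := gam_near t r0; have h2 := gam_near t r'0.
  apply: filterS2 h1 h2 => s /hr h1 /hr' h2 st.
  have : dotp (nrm M T e) (gam s - gam t) != 0.
    by rewrite diff dotpZr mulf_neq0// subr_eq0.
  rewrite neq_lt => /orP[lt|gt]; [left; exact/h1|right; apply/h2].
  by rewrite (nrm_opp TT' Te T'e) dotpC dotpNr oppr_lt0 dotpC.
exists (c T); split; apply: filterS cov => s hs.
  (* At [s = t] there is no value: the point is in the closure of [T] but not in [T], and an open
     element containing it would meet [T]. *)
  move=> v' [T2 T2s <-]; have [st|st] := eqVneq s t.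
    exfalso; apply: nTx; have : nbhs (gam t) (elt M T2).
      by apply: open_nbhs_nbhs; split; [exact: elt_open|rewrite -st].
    by move=> /clT[y [Ty T2y]]; rewrite (elt_unique Ty T2y) -st.
  by case: (hs st) => Ts; rewrite (elt_unique T2s Ts)//; exact: hc T'e Te.
by move=> /hs[Ts|Ts]; [exists (c T), T|exists (c T'), T'].
Qed.

Lemma segment_color T T' : elt M T z -> elt M T' (z + d) ->
  (forall t, 0 <= t <= 1 -> Omega (gam t)) -> c T = c T'.
Proof.
move=> Tz T'd hOm.
have key := @connected_locally_constant _ _ _ (fun (t : R) v => V (gam t) v) (@segment_connected R 0 1).
apply: (key _ _ 0 1).
- move=> t; rewrite /= in_itv /= => /hOm/segment_near[v [h _]]; by exists v.
- move=> t; rewrite /= in_itv /= => /hOm/segment_near[v [_ h]] N hN.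
  have /nbhs_ballP[r /= r0 hr] : \forall s \near t, (s != t -> exists v', V (gam s) v') /\ N s.
    exact: filterI h hN.
  have [h1 h2] : (t + r / 2 != t -> exists v', V (gam (t + r / 2)) v') /\ N (t + r / 2).
    apply: hr; rewrite /ball /= opprD addrA subrr sub0r normrN gtr0_norm ?divr_gt0//.
    by rewrite ltr_pdivrMr// mulr_natr mulr2n ltrDl.
  exists (t + r / 2) => //; apply: h1.
  by rewrite -subr_eq0 addrAC subrr add0r gt_eqF// divr_gt0.
- by rewrite /= in_itv /= lexx ler01.
- by rewrite /= in_itv /= lexx ler01.
- by exists T => //; rewrite /gam scale0r addr0.
- by exists T' => //; rewrite /gam scale1r.
Qed.

End Segment.

(** The endpoints are moved inside their elements to make the segment generic: [z] off the
    hyperplanes of all faces, then [y] so that the direction is transversal to every face and the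
    line avoids the edges. Each requirement says that a nonzero polynomial does not vanish, which is
    possible in any nonempty open set. *)
Lemma ball_color x0 r T T' y0 y1 : (forall x, ball x0 r x -> Omega x) ->
  ball x0 r y0 -> ball x0 r y1 -> elt M T y0 -> elt M T' y1 -> c T = c T'.
Proof.
move=> hB By0 By1 Ty0 T'y1.
pose N e := face_normal (face M e); pose lv e := face_level (face M e).
have N1 e : dotp (N e) (N e) = 1 by have [] := face_normalP (mesh_face hM e).
have N0 e : N e != 0.
  apply/eqP => Ne0; have := N1 e; rewrite Ne0 dotpE big1 => [/eqP|i _]; last by rewrite mxE mul0r.
  by rewrite eq_sym oner_eq0.
have /choice[L hL] : forall e, exists L : seq ('rV[R]_n.+1 * R),
    (forall h, h \in L -> forall a, h.1 <> a *: N e) /\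
    forall x, face M e x -> (forall h, h \in L -> dotp h.1 x <> h.2) -> relint (face M e) x.
  by move=> e; exact: face_edges (mesh_face hM e).
have oB T1 : open (elt M T1 `&` ball x0 r).
  by apply: openI; [exact: elt_open|exact: ball_open].
have p1 : \prod_e affp (N e) (lv e) != 0.
  by apply/prodf_neq0 => e _; exact: affp_neq0.
have [z [Tz Bz]] := ev_neq0_open (oB T) (ex_intro _ y0 (conj Ty0 By0)) p1.
rewrite ev_prod => /prodf_neq0 hz.
have {}hz e : lv e - dotp (N e) z != 0.
  have := hz e isT; rewrite ev_affp.
  by rewrite -oppr_eq0 opprB.
(* The line from z in direction v meets the hyperplane of e on the hyperplane h
   if and only if v is orthogonal to g e h. *)
pose g e (h : 'rV[R]_n.+1 * R) : 'rV[R]_n.+1 :=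
  (h.2 - dotp h.1 z) *: N e - (lv e - dotp (N e) z) *: h.1.
(* The coefficient of [h.1] is nonzero since [z] is off the hyperplane of [e]; if [g e h] were 0,
   [h.1] would be a multiple of the normal. *)
have g0 e h : h \in L e -> g e h != 0.
  move=> hh; apply/eqP => /eqP; rewrite subr_eq0 => /eqP gh.
  apply: ((hL e).1 h hh ((lv e - dotp (N e) z)^-1 * (h.2 - dotp h.1 z))).
  by rewrite -scalerA gh scalerA mulVf// scale1r.
have p2 : \prod_e (affp (N e) (dotp (N e) z) * \prod_(h <- L e) affp (g e h) (dotp (g e h) z)) != 0.
  apply/prodf_neq0 => e _; rewrite mulf_neq0 ?affp_neq0//.
  by rewrite prodf_seq_neq0; apply/allP => h hh; apply/implyP => _; apply: affp_neq0; exact: g0.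
have [y [T'y By]] := ev_neq0_open (oB T') (ex_intro _ y1 (conj T'y1 By1)) p2.
rewrite ev_prod => /prodf_neq0 hy.
have trans e : dotp (N e) (y - z) != 0.
  have := hy e isT; rewrite evM mulf_eq0 negb_or => /andP[+ _].
  by rewrite ev_affp dotpBr.
have transg e h : h \in L e -> dotp (g e h) (y - z) != 0.
  move=> hh; have := hy e isT; rewrite evM mulf_eq0 negb_or => /andP[_].
  by rewrite ev_prod prodf_seq_neq0 => /allP/(_ h hh)/=; rewrite ev_affp dotpBr.
apply: (@segment_color z (y - z)) => //.
- move=> e t et; apply: (hL e).2 => // h hh hx.
  have := transg e h hh.
  have Nx : dotp (N e) (z + t *: (y - z)) = lv e := on_face (mesh_face hM e) et.
  move: hx Nx; rewrite !(dotpDr _ z) !dotpZr => hx Nx.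
  have -> : dotp (g e h) (y - z) = (h.2 - dotp h.1 z) * dotp (N e) (y - z)
      - (lv e - dotp (N e) z) * dotp h.1 (y - z).
    by rewrite dotpC /g (dotpBr (y - z)) !dotpZr !(dotpC (y - z)).
  by rewrite -hx -Nx; case/eqP; rewrite [X in X * _ - _]addrAC subrr add0r [X in _ - X * _]addrAC subrr add0r; ring.
- by rewrite addrC subrK.
- move=> t /andP[t0 t1]; apply: hB; move/ballrV : Bz => [r0 Bz]; move/ballrV : By => [_ By].
  apply/ballrV; split => // i; rewrite !mxE.
  have -> : x0 0 i - (z 0 i + t * (y 0 i - z 0 i)) = (1 - t) * (x0 0 i - z 0 i) + t * (x0 0 i - y 0 i) by ring.
  rewrite (le_lt_trans (ler_normD _ _))// !normrM (ger0_norm t0) ger0_norm ?subr_ge0//.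
  have [->|tn0] := eqVneq t 0; first by rewrite subr0 mul1r mul0r addr0.
  have {}t0 : 0 < t by rewrite lt_neqAle eq_sym tn0.
  rewrite [ltRHS](_ : r = (1 - t) * r + t * r); last by ring.
  by apply: ler_ltD; [rewrite ler_wpM2l ?subr_ge0// ltW|rewrite ltr_pM2l].
Qed.

Lemma mesh_color T T' : c T = c T'.
Proof.
have [[x Tx] _ _ _ _] := mesh_elt hM T; have [[x' T'x'] _ _ _ _] := mesh_elt hM T'.
have [_ oO cO _ _] := hO.
have dns z : Omega z -> forall N, nbhs z N -> exists2 y, N y & exists v, V y v.
  move=> Oz N Nz; have [T1 cl] := Omega_closure Oz.
  by have [y [T1y Ny]] := cl N Nz; exists y => //; exists (c T1), T1.
apply: (@connected_locally_constant _ Omega _ V cO _ dns x x').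
- move=> z Oz; have /nbhs_ballP[r /= r0 hr] : nbhs z Omega by exact: open_nbhs_nbhs.
  have [y0 By0 [v [T0 T0y0 cT0]]] := dns z Oz _ (nbhsx_ballx z r r0).
  exists v; apply: filterS (nbhsx_ballx z r r0) => y By v' [T1 T1y <-].
  by rewrite -cT0; exact: ball_color hr By By0 T1y T0y0.
- exact: mesh_elt_sub hM _ _ Tx.
- exact: mesh_elt_sub hM _ _ T'x'.
- by exists T.
- by exists T'.
Qed.

End Color.
End Connectivity.

(** * Pairs of zero energy *)

Section Uniqueness.
Context {R : realType} {n : nat} {E F : finType}.
Variables (Omega : set 'rV[R]_n.+1) (M : @mesh R n.+1 E F) (rho : R) (k : nat).
Hypothesis hM : is_mesh Omega M rho.
Hypothesis hO : polyhedral_domain Omega.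
Hypothesis hk : (2 <= k)%N.
Local Notation mp := (mpoly.mpoly n.+1 R).
Local Notation C := (mpoly.mpolyC n.+1 (R := R)).
Local Notation row := ('rV[mp]_n.+1).
Local Notation IT := (IT M).
Local Notation Je := (Je M).
Local Notation wg := (@wg R n.+1 E F).
Local Notation wp := (@wp R n.+1 E F).
Implicit Types (T : E) (e : F).

Lemma divergence_field T (G : row) :
  IT T (divv G) = \sum_(e | face_of M T e) Je e (pdn G (nrm M T e)).
Proof.
rewrite /divv (scl_sum (IT_linear hM T)).
under eq_bigr do rewrite (mesh_divergence hM).
rewrite exchange_big; apply: eq_bigr => e _ /=.
rewrite /pdn (scl_sum (Je_linear hM e)); apply: eq_bigr => j _.
by rewrite (sclZ (Je_linear hM e)).
Qed.

(** The field whose divergence and flux are the two sides of Green's second identity. *)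
Definition green_field (w z : row) : row :=
  \row_j (\sum_i (mpoly.mderiv j (w 0 i) * z 0 i - w 0 i * mpoly.mderiv j (z 0 i))).

Lemma divv_green w z : divv (green_field w z) = pdot (laplv w) z - pdot w (laplv z).
Proof.
rewrite /divv !pdot_row -sumrB.
under eq_bigr do rewrite mxE mderiv_sum.
rewrite exchange_big; apply: eq_bigr => i _ /=.
rewrite !mxE mulr_suml mulr_sumr -sumrB; apply: eq_bigr => j _.
by rewrite mpoly.mderivB !mpoly.mderivM; ring.
Qed.

Lemma pdn_green w z nn :
  pdn (green_field w z) nn = pdot (pmul (gradv w) nn) z - pdot w (pmul (gradv z) nn).
Proof.
rewrite /pdn !pdot_row -sumrB.
under eq_bigr do rewrite mxE scaler_sumr.
rewrite exchange_big; apply: eq_bigr => i _ /=.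
rewrite !mxE mulr_suml mulr_sumr -sumrB; apply: eq_bigr => j _.
by rewrite !mxE scalerBr -scalerAl -scalerAr.
Qed.

Lemma divv_scale (p : mp) (z : row) : divv (p *: z) = p * divv z + pdot z (grad p).
Proof.
rewrite /divv pdot_row mulr_sumr -big_split; apply: eq_bigr => j _ /=.
by rewrite !mxE mpoly.mderivM; ring.
Qed.

Lemma pdn_scale (p : mp) (z : row) nn : pdn (p *: z) nn = p * pdn z nn.
Proof.
rewrite /pdn mulr_sumr; apply: eq_bigr => j _.
by rewrite !mxE scalerAr.
Qed.

Lemma degle_laplv (w : row) : degle_mx k w -> degle_mx (k - 2)%N (laplv w).
Proof.
move=> hw i j; rewrite !mxE; apply: degle_sum => l.
case: k hk hw => [|[|k']] // _ hw; rewrite subn2 /=.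
by apply: degle_mderiv; apply: degle_mderiv; exact: hw.
Qed.

Lemma degle_divv (w : row) : degle_mx k w -> degle (k - 1)%N (divv w).
Proof.
move=> hw; apply: degle_sum => l.
case: k hk hw => [|k'] // _ hw; rewrite subn1 /=.
by apply: degle_mderiv; exact: hw.
Qed.

Lemma degle_grad (p : mp) : degle (k - 1)%N p -> degle_mx (k - 2)%N (grad p).
Proof.
move=> hp i j; rewrite !mxE.
case: k hk hp => [|[|k']] // _; rewrite subn1 subn2 /= => hp.
exact: degle_mderiv.
Qed.

Section NullPair.
Variable x : wg * wp.
Hypothesis x0 : null_pair M k x.
Hypothesis xX : in_X0 Omega M k x.
Let w T := v0 x.1 T.
Let r T := q0 x.2 T.

Let wb T e y : face_of M T e -> face M e y -> evm (vb x.1 e) y = evm (w T) y.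
Proof.
move=> Te ey; have [_ _ h] := x0 T; have [h0 _ _] := h e y Te ey.
by apply/esym/eqP; rewrite -subr_eq0 -evmB h0.
Qed.

Let wgr T e y : face_of M T e -> face M e y -> evm (vg x.1 e) y = evm (gradv (w T)) y.
Proof.
move=> Te ey; have [_ _ h] := x0 T; have [_ h0 _] := h e y Te ey.
by apply/esym/eqP; rewrite -subr_eq0 -evmB h0.
Qed.

Let rb T e y : face_of M T e -> face M e y -> ev (qb x.2 e) y = ev (r T) y.
Proof.
move=> Te ey; have [_ _ h] := x0 T; have [_ _ h0] := h e y Te ey.
by apply/esym/eqP; rewrite -subr_eq0 -evB h0.
Qed.

(** On the faces [vb] and [vg] have the values of [w] and of its gradient, so Green's second
    identity is the defining equation. As [laplv (w T)] has degree at most [k - 2], it lies in the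
    space where that equation has one solution. *)
Lemma null_weak_lapl T : weak_lapl M k x.1 T = laplv (w T).
Proof.
have [[[h1 _ _] _] _] := xX.
apply: (weak_lapl_unique hM); first exact: degle_laplv (h1 T).
move=> z _; rewrite /Llapl -/(w T).
have -> : pdot (laplv (w T)) z = divv (green_field (w T) z) + pdot (w T) (laplv z).
  by rewrite divv_green subrK.
rewrite (sclD (IT_linear hM T)) divergence_field [LHS]addrC -addrA; congr (_ + _).
rewrite addrC -sumrB; apply: eq_bigr => e Te; rewrite pdn_green (sclB (Je_linear hM e)).
apply: (congr2 (fun a b => a - b)); apply: eq_Je => y ey.
  by rewrite !ev_pdot !evm_pmul (wgr Te ey).
by rewrite !ev_pdot (wb Te ey).
Qed.

Lemma null_weak_div T : weak_div M k x.1 T = divv (w T).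
Proof.
have [[[h1 _ _] _] _] := xX.
apply: (weak_div_unique hM); first exact: degle_divv (h1 T).
move=> z _; rewrite /Ldiv -/(w T).
have -> : divv (w T) * z = divv (z *: w T) - pdot (w T) (grad z).
  by rewrite divv_scale addrK mulrC.
rewrite (sclB (IT_linear hM T)) divergence_field [LHS]addrC; congr (_ + _).
apply: eq_bigr => e Te; apply: eq_Je => y ey.
by rewrite pdn_scale !evM !ev_pdn (wb Te ey) mulrC.
Qed.

Lemma null_weak_grad T : weak_grad M k x.2 T = grad (r T).
Proof.
have [_ [h1 _ _]] := xX.
apply: (weak_grad_unique hM); first exact: degle_grad (h1 T).
move=> z _; rewrite /Lgrad -/(r T).
have -> : pdot (grad (r T)) z = divv (r T *: z) - r T * divv z.
  by rewrite divv_scale [LHS]pdotC addrAC subrr add0r.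
rewrite (sclB (IT_linear hM T)) divergence_field [LHS]addrC; congr (_ + _).
apply: eq_bigr => e Te; apply: eq_Je => y ey.
by rewrite pdn_scale !evM !ev_pdn (rb Te ey).
Qed.

Lemma null_momentum T : laplv (w T) = grad (r T).
Proof.
have [h _ _] := x0 T; move: h; rewrite /rsdx /rsd null_weak_lapl null_weak_grad.
by move/eqP; rewrite addrC subr_eq0 => /eqP.
Qed.

Lemma null_div T : divv (w T) = 0.
Proof. by have [_ h _] := x0 T; move: h; rewrite /divx null_weak_div. Qed.

Lemma null_shared T T' e y : face_of M T e -> face_of M T' e -> face M e y ->
  [/\ evm (w T) y = evm (w T') y, evm (gradv (w T)) y = evm (gradv (w T')) y &
      ev (r T) y = ev (r T') y].
Proof.
move=> Te T'e ey; split.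
- by rewrite -(wb Te ey) -(wb T'e ey).
- by rewrite -(wgr Te ey) -(wgr T'e ey).
- by rewrite -(rb Te ey) -(rb T'e ey).
Qed.

Lemma null_boundary T e y : face_of M T e -> bface Omega M e -> face M e y -> evm (w T) y = 0.
Proof.
by move=> Te be ey; have [[_ h] _] := xX; rewrite -(wb Te ey); exact: h.
Qed.

End NullPair.

Lemma sum_divv (G : E -> row) :
  (forall T T' e y, face_of M T e -> face_of M T' e -> face M e y -> evm (G T) y = evm (G T') y) ->
  (forall T e y, face_of M T e -> bface Omega M e -> face M e y -> evm (G T) y = 0) ->
  \sum_T IT T (divv (G T)) = 0.
Proof.
move=> hs hb.
under eq_bigr do rewrite divergence_field.
rewrite (exchange_big_dep xpredT)//=; apply: big1 => e _.
have [_ [_ _ _ _ hcard] _] := hM.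
case: (hcard e) => -[cd be]; last first.
  apply: big1 => T Te; apply: etrans (scl0 (Je_linear hM e)); apply: eq_Je => y ey.
  by rewrite ev_pdn (hb T e y)// ev0 dotpE big1// => j _; rewrite mxE mul0r.
have /card_gt0P[T Te] : (0 < #|[pred T | face_of M T e]|)%N by rewrite cd.
have {}Te : face_of M T e := Te.
have c1 : #|[predD1 [pred T | face_of M T e] & T]| = 1%N.
  have TP : T \in [pred T | face_of M T e] by [].
  by have := cardD1 T [pred T | face_of M T e]; rewrite cd TP add1n => -[<-].
have [T' hT'] : exists T', T' \in [predD1 [pred T | face_of M T e] & T].
  by apply/card_gt0P; rewrite c1.
have c0 : #|[predD1 [predD1 [pred T | face_of M T e] & T] & T']| = 0%N.
  by have := cardD1 T' [predD1 [pred T | face_of M T e] & T]; rewrite c1 hT' add1n => -[<-].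
have /andP[T'T T'e] : (T' != T) && face_of M T' e := hT'.
(* Only the two elements sharing [e] remain in its sum of fluxes; their traces agree and their
   normals are opposite. *)
rewrite (bigD1 T)//= (bigD1 T') /= ?T'e// big_pred0; last first.
  by move=> T2; have := card0_eq c0 T2; rewrite !inE => <-; rewrite andbC andbA andbAC -andbA andbC andbA.
rewrite addr0 (nrm_opp hM _ Te T'e) 1?eq_sym// -(sclD (Je_linear hM e)).
apply: etrans (scl0 (Je_linear hM e)); apply: eq_Je => y ey.
by rewrite evD !ev_pdn (hs T T' e y)// dotpNr subrr ev0.
Qed.

Lemma null_pair_eq0 (x : wg * wp) : null_pair M k x -> in_X0 Omega M k x ->
  (forall T, v0 x.1 T = 0) /\ (forall T, q0 x.2 T = 0).
Proof.
move=> x0 xX.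
pose w T := v0 x.1 T; pose r T := q0 x.2 T.
(* By the momentum and mass equations, div (G T) = |grad w|^2. *)
pose G T : row := \row_j (\sum_i mpoly.mderiv j (w T 0 i) * w T 0 i - r T * w T 0 j).
have divG T : divv (G T) = pdot (gradv (w T)) (gradv (w T)).
  have mom := null_momentum x0 xX T; have dv0 := null_div x0 xX T.
  (* An identity for arbitrary fields: the bracket is [(laplv w - grad r) . w - r divv w], which the
     two equations cancel. *)
  transitivity (pdot (gradv (w T)) (gradv (w T)) + (pdot (laplv (w T)) (w T) - (pdot (grad (r T)) (w T) + r T * divv (w T)))).
    rewrite /divv !pdot_row mulr_sumr -big_split /= -/(w T).
    rewrite /pdot exchange_big /=.
    have -> : \sum_(j < n.+1) laplv (w T) 0 j * w T 0 j =
        \sum_(j < n.+1) \sum_i mpoly.mderiv j (mpoly.mderiv j (w T 0 i)) * w T 0 i.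
      by rewrite [RHS]exchange_big; apply: eq_bigr => i _; rewrite mxE mulr_suml.
    rewrite -sumrB -big_split; apply: eq_bigr => j _ /=.
    rewrite mxE mpoly.mderivB mderiv_sum mpoly.mderivM addrA -big_split; congr (_ - _).
      by apply: eq_bigr => i _ /=; rewrite !mxE mpoly.mderivM addrC.
    by rewrite mxE.
  by rewrite mom dv0 mulr0 addr0 subrr addr0.
have gw0 T : gradv (w T) = 0.
  have : \sum_T IT T (divv (G T)) = 0.
    apply: sum_divv => [T1 T2 e y T1e T2e ey|T1 e y T1e be ey].
      have [h1 h2 h3] := null_shared x0 T1e T2e ey.
      apply/rowP => j; rewrite !mxE !evB !ev_sum !evM h3.
      have := congr1 (fun A : 'rV[R]_n.+1 => A 0 j) h1; rewrite !mxE => ->; congr (_ - _).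
      apply: eq_bigr => i _; rewrite !evM.
      have := congr1 (fun A : 'M[R]_n.+1 => A i j) h2; rewrite !mxE => ->.
      by have := congr1 (fun A : 'rV[R]_n.+1 => A 0 i) h1; rewrite !mxE => ->.
    have h := null_boundary x0 xX T1e be ey.
    have hi i : ev (w T1 0 i) y = 0 by have := congr1 (fun A : 'rV[R]_n.+1 => A 0 i) h; rewrite !mxE.
    apply/rowP => j; rewrite !mxE evB ev_sum evM hi mulr0 subr0 big1// => i _.
    by rewrite evM hi mulr0.
  under eq_bigr do rewrite divG.
  move/eqP; rewrite psumr_eq0 => [/allP h|T1 _]; last exact: (IT_pdot_ge0 hM).
  by have /eqP/(IT_pdot_eq0 hM) := h T (mem_index_enum _).
have dw0 T i j : mpoly.mderiv j (w T 0 i) = 0.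
  by have := congr1 (fun A : 'M[mp]_n.+1 => A i j) (gw0 T); rewrite !mxE.
have w0 T : w T = 0.
  (* As w is constant on T, div (H T) = |w|^2. *)
  pose H T : row := \row_j (if j == 0 then mpoly.mpolyX R (mpoly.mnm1 0) * pdot (w T) (w T) else 0).
  have divH T1 : divv (H T1) = pdot (w T1) (w T1).
    have dp j : mpoly.mderiv j (pdot (w T1) (w T1)) = 0.
      rewrite pdot_row mderiv_sum big1// => i _.
      by rewrite mpoly.mderivM dw0 mul0r mulr0 addr0.
    rewrite /divv (bigD1 0)//= big1 ?addr0 => [|j /negbTE j0]; last by rewrite mxE j0 mpoly.mderiv0.
    rewrite mxE eqxx mpoly.mderivM dp mulr0 addr0 mpoly.mderivX mpoly.mnm1E eqxx scale1r.
    rewrite (_ : mpoly.mnm_sub _ _ = mpoly.mnm0) ?mpoly.mpolyX0 ?mul1r//.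
    by apply/mpoly.mnmP => l; rewrite !mpoly.mnmE subnn.
  have : \sum_T IT T (divv (H T)) = 0.
    apply: sum_divv => [T1 T2 e y T1e T2e ey|T1 e y T1e be ey].
      have [h1 _ _] := null_shared x0 T1e T2e ey.
      apply/rowP => j; rewrite !mxE; case: ifP => // _; rewrite !evM; congr (_ * _).
      by rewrite !ev_pdot -/(w T1) -/(w T2) [evm (w T1) y]h1.
    have h := null_boundary x0 xX T1e be ey.
    apply/rowP => j; rewrite !mxE; case: ifP => _; last exact: ev0.
    by rewrite evM ev_pdot [evm (w T1) y]h dotp0 mulr0.
  under eq_bigr do rewrite divH.
  move/eqP; rewrite psumr_eq0 => [/allP h|T1 _]; last exact: (IT_pdot_ge0 hM).
  by have /eqP/(IT_pdot_eq0 hM) := h T (mem_index_enum _).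
split => // T.
have gr0 T1 : grad (r T1) = 0.
  rewrite -(null_momentum x0 xX) -/(w T1) w0; apply/rowP => i; rewrite !mxE big1// => j _.
  by rewrite ?mxE !mpoly.mderiv0.
have rC T1 : r T1 = C (mpoly.mcoeff mpoly.mnm0 (r T1)).
  apply: mderiv0_const => j.
  by have := congr1 (fun A : row => A 0 j) (gr0 T1); rewrite !mxE.
pose c T1 := mpoly.mcoeff mpoly.mnm0 (r T1).
have cE : forall T1 T2, c T1 = c T2.
  apply: (mesh_color hM hO) => T1 T2 e T1e T2e.
  have [_ _ [y [ey _]] _ _] := mesh_face hM e.
  have [_ _] := null_shared x0 T1e T2e ey.
  by rewrite -/(r T1) -/(r T2) (rC T1) (rC T2) !evC.
have [_ [_ mean _]] := xX.
move: mean; rewrite sum_ITE => mean.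
(* The volume of an element, written as the integral of a square so that definiteness makes it
   positive. *)
have IT1 T1 : 0 < IT T1 (1 * 1).
  rewrite lt_neqAle IT_sqr_ge0 andbT eq_sym; apply/eqP => /(IT_sqr_eq0 hM)/eqP.
  by rewrite oner_eq0.
have : c T * \sum_T1 IT T1 (1 * 1) = 0.
  apply: etrans mean; rewrite mulr_sumr; apply: eq_bigr => T1 _.
  by rewrite -/(r T1) (rC T1) -/(c T1) (cE T1 T) -(sclZ (IT_linear hM T1)) -CE !mulr1.
move/eqP; rewrite mulf_eq0 psumr_eq0 => [|T1 _]; last exact: ltW.
case/orP => [/eqP c0|/allP/(_ T (mem_index_enum _))]; last by rewrite gt_eqF ?IT1.
by rewrite -/(r T) (rC T) -/(c T) c0 mpoly.mpolyC0.
Qed.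

End Uniqueness.

(** * Well-posedness *)

Lemma wg_well_posed (R : realType) (n : nat) (Omega : set 'rV[R]_n.+1) (E F : finType)
    (M : @mesh R n.+1 E F) (rho : R) (k : nat) (f g : 'rV[R]_n.+1 -> 'rV[R]_n.+1) :
  polyhedral_domain Omega -> is_mesh Omega M rho -> (2 <= k)%N ->
  (forall i, L2_on Omega (fun x => f x 0 i)) ->
  exists (u : wg) (p : wp),
    is_wg_solution Omega M k f g u p /\
    forall (u' : wg) (p' : wp),
      is_wg_solution Omega M k f g u' p' -> wg_eq M u u' /\ wp_eq M p p'.
Proof.
move=> hO hM hk hf; have [_ oO _ _ _] := hO.
(* If the projection of g did not exist, Qb would be 0: the degree bound holds in
   any case. *)
pose G : @wg R n.+1 E F * @wp R n.+1 E F :=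
  (Wg (fun=> 0) (fun e => if bface Omega M e then Qb M k g e else 0) (fun=> 0), wp0).
have dG : in_W k G.1.
  split => [T|e|e]; [exact: degle_mx0| |exact: degle_mx0].
  rewrite /=; case: ifP => _; last exact: degle_mx0.
  move=> i j; rewrite mxE; case: xgetP => [p -> []//|_]; exact: degle0.
have [x Px hx] := wg_existence k hM oO hf G.
have sol (u : @wg R n.+1 E F) (p : @wp R n.+1 E F) (v : wg) (q : wp) :
    form_a M k u p v q + form_s1 M u v + form_s2 M p q = Bform M k (u, p) (v, q).
  exact: BformE.
have [[Wx bx] Vx] := Px.
pose y := wlin 1 x G.
have by_ e z : bface Omega M e -> face M e z -> evm (vb y.1 e) z = evm (Qb M k g e) z.
  move=> be ez; rewrite /= evm_lin (bx e be z ez) scaler0 add0r.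
  by rewrite be.
have soly : is_wg_solution Omega M k f g y.1 y.2.
  split => [||e be z ez|v q Wv Vq].
  - exact: in_W_lin.
  - exact: in_V_lin hM _ _ _ Vx (in_V0 k hM).
  - exact: by_.
  - apply: etrans (sol _ _ _ _) _; apply: etrans (Bform_lin k hM 1 x G (v, q)) _.
    by rewrite mul1r; exact: (hx (v, q) (conj Wv Vq)).
exists y.1, y.2; split => // u' p' [Wu' Vp' bu' eu'].
have [Wy Vy _ ey] := soly.
pose z := wlin (-1) (u', p') y.
have Pz : in_X0 Omega M k z.
  split; last exact: (in_V_lin hM).
  split; first exact: in_W_lin.
  by move=> e be t et; rewrite /= evm_lin bu'// by_// scaleN1r addNr.
(* Both solutions have the same boundary values, so their difference is itself an admissible test
   pair; testing both problems with it gives it zero energy. *)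
have nz : null_pair M k z.
  apply: (Bform_null hM); apply: etrans (Bform_lin k hM (-1) (u', p') y z) _.
  rewrite mulN1r; apply/eqP; rewrite addrC subr_eq0; apply/eqP.
  apply: etrans (esym (sol y.1 y.2 z.1 z.2)) _; apply: etrans _ (sol u' p' z.1 z.2).
  exact: etrans (ey _ _ Pz.1 Pz.2) (esym (eu' _ _ Pz.1 Pz.2)).
have [z0 z1] := null_pair_eq0 hM hO hk nz Pz.
(* Through an element having [e] as a face, the zero interior components and the zero jumps make the
   face components vanish on [e]. *)
have hface e : exists T, face_of M T e.
  have : (0 < #|[pred T | face_of M T e]|)%N.
    by case: hM => _ [_ _ _ _ h] _; case: (h e) => -[->].
  by move=> /card_gt0P[T]; exists T.
split; split => [T t Tt|e t et].
- have /eqP := z0 T; rewrite /z /= mpoly.mpolyCN mpoly.mpolyC1 scaleN1r addrC subr_eq0.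
  by move=> /eqP ->.
- have [T Te] := hface e; have [_ _ /(_ e t Te et)[j0 j1 _]] := nz T.
  split.
    move: j0; rewrite /jump0 z0 sub0r evmN => /eqP.
    by rewrite oppr_eq0 /= evm_lin scaleN1r addrC subr_eq0 => /eqP.
  move: j1; rewrite /jump1 z0 evmB => /eqP.
  rewrite (_ : gradv 0 = 0) ?evm0 ?sub0r; last by apply/matrixP => i j; rewrite !mxE mpoly.mderiv0.
  by rewrite oppr_eq0 /= evm_lin scaleN1r addrC subr_eq0 => /eqP.
- by have /eqP := z1 T; rewrite /z /= scaleN1r addrC subr_eq0 => /eqP ->.
- have [T Te] := hface e; have [_ _ /(_ e t Te et)[_ _ j2]] := nz T.
  move: j2; rewrite /jump2 z1 sub0r evN => /eqP.
  by rewrite oppr_eq0 /= evD evZ mulN1r addrC subr_eq0 => /eqP.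
Qed.

Theorem theorem3p1 (R : realType) (d : nat) (hd : d = 2%N \/ d = 3%N)
  (Omega : set 'rV[R]_d)
  (hOmega : polyhedral_domain Omega) (hLip : lipschitz_boundary Omega)
  (E F : finType) (M : @mesh R d E F) (rho : R) (hM : is_mesh Omega M rho)
  (k : nat) (hk : (2 <= k)%N)
  (f : 'rV[R]_d -> 'rV[R]_d)
  (hf : forall i, L2_on Omega (fun x => f x 0 i))
  (g : 'rV[R]_d -> 'rV[R]_d)
  (hg : forall e, bface Omega M e ->
          forall i, L2_face (face M e) (fun x => g x 0 i)) :
  exists (u : wg) (p : wp),
    is_wg_solution Omega M k f g u p /\
    forall (u' : wg) (p' : wp),
      is_wg_solution Omega M k f g u' p' -> wg_eq M u u' /\ wp_eq M p p'.
Proof.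
case: d Omega hd hOmega {hLip} M hM f hf g {hg} => [|n] Omega hd hOmega M hM f hf g.
  by case: hd.
exact: wg_well_posed hOmega hM hk hf.
Qed.
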